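(* Let a Markov renewal process on $S=S_1\cup\dots\cup S_M$ satisfy conditions (a)–(f) below, let $1<M'<M$ be such that $\{1,\dots,M'\}$ forms one ergodic class with respect to $P^0_{ij}$, with invariant probability $\lambda$ on $\{1,\dots,M'\}$, and suppose the limits $\tau_i=\lim_{\varepsilon\downarrow0}\tau^\varepsilon_i$ exist with $\tau_{i_0}=1$ for some $1\le i_0\le M'$ and $\tau_i\le1$ for $1\le i\le M'$. Let $S'=S_1\cup\dots\cup S_{M'}$, $\mu(i)=\lambda(i)\tau_i/\sum_{j=1}^{M'}\lambda(j)\tau_j$ for $1\le i\le M'$, and $\eta^{x,\varepsilon}=\inf\{t\ge0:X^{x,\varepsilon}_t\notin S'\}$ for $x\in S'$. Suppose $t(\varepsilon)\to\infty$ as $\varepsilon\downarrow0$ and $\mathbb P(\eta^{x,\varepsilon}\le t(\varepsilon))\to0$ uniformly in $x\in S'$. Then $\lim_{\varepsilon\downarrow0}\mathbb P(X^{x,\varepsilon}_{t(\varepsilon)}\in S_i)=\mu(i)$ uniformly in $x\in S'$, for $1\le i\le M'$. Moreover, if $t_1(\varepsilon)\le t_2(\varepsilon)$ for all $\varepsilon>0$, $t_1(\varepsilon)\to\infty$, and $\mathbb P(\eta^{x,\varepsilon}\le t_2(\varepsilon))\to0$ uniformly in $x\in S'$, then this limit holds uniformly also over all time scales $t(\varepsilon)$ with $t_1(\varepsilon)\le t(\varepsilon)\le t_2(\varepsilon)$.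
   Context: $S$ is a metric space partitioned into disjoint Borel sets $S_1,\dots,S_M$; $Q^\varepsilon$ are Markov kernels from $S$ to $S\times[0,\infty)$; $(\mathbf X^{x,\varepsilon}_n,\mathbf T^{x,\varepsilon}_n)$ is the Markov chain started at $(x,0)$ with transitions $Q^\varepsilon(y,\cdot)$ from $(y,s)$; $X^{x,\varepsilon}_t=\mathbf X^{x,\varepsilon}_n$ for $\sum_{m\le n}\mathbf T^{x,\varepsilon}_m\le t<\sum_{m\le n+1}\mathbf T^{x,\varepsilon}_m$. $P^\varepsilon(x,B)=Q^\varepsilon(x,B\times[0,\infty))$; $T^\varepsilon(x,B)$ has law $Q^\varepsilon(x,B\times\cdot)/P^\varepsilon(x,B)$. (a) $P^\varepsilon(x,S_i)=0$ for $x\in S_i$; for $i\ne j$, $P^\varepsilon(x,S_j)$ is $0$ for all $x\in S_i,\varepsilon$ ($P^\varepsilon_{ij}:\equiv0$) or positive, with positive $P^\varepsilon_{ij}$, $P^\varepsilon(x,S_j)/P^\varepsilon_{ij}\to1$ uniformly in $x\in S_i$, $\sum_jP^\varepsilon_{ij}=1$, every $i\ne j$ connected by a chain of indices with positive $P^\varepsilon$. (b) Positive $\tau^\varepsilon_i$ with $\mathbb ET^\varepsilon(x,S_j)/\tau^\varepsilon_i\to1$ uniformly in $x\in S_i$ when $P^\varepsilon_{ij}\not\equiv0$. (c) $\mathrm{Var}\,T^\varepsilon(x,S_j)\le C(\tau^\varepsilon_i)^2$ for $\varepsilon\le\varepsilon_0$. (d) For bounded continuous $f$: $\mathbb Ef(T^\varepsilon(x_1,S_{j_1})/\tau^\varepsilon_i)-\mathbb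 Ef(T^\varepsilon(x_2,S_{j_2})/\tau^\varepsilon_i)\to0$ uniformly in $x_1,x_2\in S_i$ when $P^\varepsilon_{ij_1},P^\varepsilon_{ij_2}\not\equiv0$. (e) Distributional limits of $T^{\varepsilon_n}(x_n,S_j)/\tau^{\varepsilon_n}_i$ ($x_n\in S_i$, $\varepsilon_n\downarrow0$) have no atoms. (f) $\lim_{\varepsilon\downarrow0}\prod_{k=1}^n\frac{P^\varepsilon_{a_kb_k}}{P^\varepsilon_{a_kd_k}}\frac{\tau^\varepsilon_a}{\tau^\varepsilon_c}\in[0,\infty]$ whenever defined. $P^0_{ij}=\lim P^\varepsilon_{ij}$; ''$\{1,\dots,M'\}$ forms one ergodic class'' means it is a closed irreducible class of the chain with transition matrix $(P^0_{ij})$. *)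

(* Defs.v *)
From HB Require Import structures.
From mathcomp Require Import all_boot all_order all_algebra.
From mathcomp Require Import all_classical all_reals all_analysis.
From Stdlib Require Import Relations.
Set Implicit Arguments. Unset Strict Implicit. Unset Printing Implicit Defensive.
Import Order.TTheory GRing.Theory Num.Theory numFieldNormedType.Exports.
Local Open Scope classical_set_scope. Local Open Scope ring_scope.

(* The Borel measurable space of a (nonempty) metric space S.         *)
(* MathComp-Analysis' generated sigma-algebra construction needs a    *)
(* pointed carrier, hence the base point s0.                          *)
Definition with_point {S : choiceType} (s0 : S) : Type := S.
HB.instance Definition _ (S : choiceType) (s0 : S) := Choice.on (with_point s0).
HB.instance Definition _ (S : choiceType) (s0 : S) :=
  isPointed.Build (with_point s0) s0.

Definition borel_space {R : realType} {S : metricType R} (s0 : S) :=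
  g_sigma_algebraType (T := with_point s0) (@open S).

Section markov_renewal.
Context {R : realType} {dS : measure_display} {S : measurableType dS}.

Definition TD (B : set S) : set (S * R) := B `*` `[0%R, +oo[%classic.

Definition Pk (Q : R.-pker S ~> (S * R)%type) (x : S) (B : set S) : R :=
  fine (Q x (TD B)).

Definition momT (Q : R.-pker S ~> (S * R)%type) (x : S) (B : set S)
  (g : R -> R) : \bar R :=
  (\int[Q x]_(p in TD B) (g p.2)%:E)%E.

(* E g(T(x,B)), where T(x,B) has law Q(x, B x .)/P(x,B) *)
Definition EgT (Q : R.-pker S ~> (S * R)%type) (x : S) (B : set S)
  (g : R -> R) : R :=
  fine (momT Q x B g) / Pk Q x B.

Definition meanT Q x B : R := EgT Q x B id.

(* Var T(x,B) <= c, stated in the extended reals: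
   \int (s - E T)^2 Q(x, B x ds) <= c * P(x,B)  *)
Definition varT_le (Q : R.-pker S ~> (S * R)%type) (x : S) (B : set S)
  (c : R) : Prop :=
  (momT Q x B (fun s => ((s - meanT Q x B) ^+ 2)%R) <= (c * Pk Q x B)%:E)%E.

(* Realisation of the Markov chain (X_n, T_n) started at (x,0) with
   transition kernel Q(y,.) from (y,s), given through its
   finite-dimensional distributions. Y n = (X_n, T_n). *)
Definition is_MRchain {dO : measure_display} {O : measurableType dO}
  (Pr : probability O R) (Q : R.-pker S ~> (S * R)%type) (x : S)
  (Y : nat -> O -> S * R) : Prop :=
  [/\ (forall n, measurable_fun setT (Y n)),
      (forall w, Y 0%N w = (x, 0%R)) &
      (forall (n : nat) (B : nat -> set (S * R)),
          (forall k, measurable (B k)) ->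
          Pr (\bigcap_(k in `I_n.+2) (Y k @^-1` B k)) =
          (\int[Pr]_(w in \bigcap_(k in `I_n.+1) (Y k @^-1` B k))
             Q (Y n w).1 (B n.+1))%E)].

Definition sumT {O : Type} (Y : nat -> O -> S * R) (n : nat) (w : O) : R :=
  \sum_(m < n.+1) (Y m w).2.

Definition Xt_in {O : Type} (Y : nat -> O -> S * R) (t : R) (B : set S)
  (w : O) : Prop :=
  exists n : nat, sumT Y n w <= t < sumT Y n.+1 w /\ B (Y n w).1.

Definition exit_time {O : Type} (Y : nat -> O -> S * R) (S' : set S)
  (w : O) : \bar R :=
  ereal_inf [set t%:E | t in [set t : R | 0 <= t /\ Xt_in Y t (~` S') w]].

End markov_renewal.

Definition unif_lim0 {R : realType} {X : Type} (A : set X)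
  (f : R -> X -> R) (l : R) : Prop :=
  forall e : R, 0 < e -> exists2 d : R, 0 < d &
    forall eps : R, 0 < eps -> eps < d -> forall x, A x -> `|f eps x - l| < e.

Definition Pnz {R : realType} {M : nat} (Pm : R -> 'I_M -> 'I_M -> R)
  (i j : 'I_M) : Prop :=
  exists eps : R, 0 < eps /\ Pm eps i j != 0.

Definition bounded_fun_R {R : realType} (f : R -> R) : Prop :=
  exists K : R, forall r, `|f r| <= K.

(* Main.v *)
(** Argue by contradiction along a sequence eps_n -> 0 and run the chain killed when it leaves the
    ergodic class.  A supersolution of exponential type bounds the killed renewal measure on unit
    time windows uniformly in n, so the densities of the renewals in the k-th cell around time
    t_n - u, smoothed by a tent function, are uniformly bounded and Lipschitz in u.  By
    Arzela-Ascoli and Helly they converge along a subsequence to a bounded solution of the renewal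
    convolution equation on the whole line for the limit chain.  The sojourn law of the state with
    tau = 1 has no atoms, so a Choquet-Deny argument makes that solution constant in u; it is then a
    multiple kappa * lambda(k) of the invariant law.  Summing it against the survival functions of
    the sojourn times gives the occupation probabilities kappa * lambda(k) * tau_k, and the fact
    that the process has not left the class by time t_n determines kappa. *)

Require Import Defs.
From HB Require Import structures.
From mathcomp Require Import all_boot all_order all_algebra.
From mathcomp Require Import all_classical all_reals all_analysis.
From mathcomp Require Import measurable_realfun unstable.
From mathcomp Require Import ring lra.
From Stdlib Require Import Relations.
Import Order.TTheory GRing.Theory Num.Theory numFieldNormedType.Exports.
Set Implicit Arguments. Unset Strict Implicit. Unset Printing Implicit Defensive.
Local Open Scope classical_set_scope. Local Open Scope ring_scope.

(** * Compactness of sequences of functions and of laws *)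

(** The sequence carries [eps], the starting point and the observation time together, so all the
    uniformity claimed is obtained at once. Hypotheses (d) and (e) control [T / tau] only, so the
    limit laws are rescaled by [tau0]; a state with [tau0 i = 0] then has its whole limit law at 0,
    which is why atomlessness is used at one state only. Three obstacles shape the estimates.
    Renewals could pile up when sojourns are short: the exponential supersolution takes its time
    decay from the state with [tau0 = 1] and its drift towards that state from a Lyapunov function
    of the limit chain. The one-step laws converge uniformly on bounded time ranges only: beyond
    them the variance bound (c) gives Chebyshev terms of order [r^-2], summable against the bound on
    unit windows. Finally, the constant produced by Choquet-Deny depends on the scale [m] of the
    tents and on the subsequence: [m] is therefore chosen from the target accuracy, before [n] tends
    to infinity, and all errors are kept of order [1 / m]. *)

Lemma diagonal_subsequence {R : realType} (x : nat -> nat -> R) (C : nat -> R) :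
  (forall n j, `|x n j| <= C j) ->
  exists2 phi : nat -> nat, (forall n, (phi n < phi n.+1)%N) &
    forall j, cvgn (fun n => x (phi n) j).
Proof.
move=> xC.
(* An ultrafilter finer than [\oo] selects a limit for every coordinate at once. It then remains to
   choose increasing indices, the k-th one close in the first k + 1 coordinates, and no nested
   extraction is needed. *)
have [U [UU oU]] := @ultraFilterLemma nat \oo _.
have lim_ j : exists l : R, (x ^~ j) @ U --> l.
  have [|l [_ cl]] := @segment_compact R (- C j) (C j) ((x ^~ j) @ U) _.
    rewrite /fmap /=; apply: (@filterS _ U _ setT) => [n _|]; last exact: filterT.
    by rewrite /= in_itv /= -ler_norml.
  exists l => B Bl; have [//|UB] := in_ultra_setVsetC (x ^~ j @^-1` B) UU.
  by have [y []] := cl (~` B) B UB Bl.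
pose l j := projT1 (cid (lim_ j)).
have xl j : (x ^~ j) @ U --> l j by exact: (projT2 (cid (lim_ j))).
have step (k N : nat) : exists n : nat, (N < n)%N /\
    forall j, (j <= k)%N -> `|l j - x n j| < k.+1%:R^-1.
  have H : U [set n | (N < n)%N /\
      forall j : 'I_k.+1, `|l j - x n j| < k.+1%:R^-1].
    apply: filterI; first by apply: oU; exists N.+1.
    apply: filter_forall => j.
    by move/cvgrPdist_lt : (xl j); apply; rewrite invr_gt0.
  have [n [Nn Hn]] := filter_ex H.
  by exists n; split=> // j jk; exact: (Hn (Ordinal (jk : (j < k.+1)%N))).
pose h k N := projT1 (cid (step k N)).
have hP k N : (N < h k N)%N /\
    forall j, (j <= k)%N -> `|l j - x (h k N) j| < k.+1%:R^-1.
  exact: (projT2 (cid (step k N))).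
pose phi := fix phi n := if n is m.+1 then h m.+1 (phi m) else h 0%N 0%N.
exists phi; first by move=> n; have [] := hP n.+1 (phi n).
move=> j; apply/cvg_ex; exists (l j); apply/cvgrPdist_lt => e e0.
near=> n.
have jn : (j <= n)%N by near: n; exists j.
have ne : n.+1%:R^-1 < e.
  near: n; have [N _ HN] := near_infty_natSinv_lt (PosNum e0).
  by exists N => // n Nn; exact: HN.
apply: (lt_trans _ ne).
have [m ->] : exists m, phi n = h n m.
  by case: (n) => [|n']; [exists 0%N | exists (phi n')].
exact: (hP _ _).2.
Unshelve. all: by end_near. Qed.

Lemma subsequence_ge (phi : nat -> nat) :
  (forall n, (phi n < phi n.+1)%N) -> forall n, (n <= phi n)%N.
Proof. by move=> h; elim=> [//|n IH]; exact: leq_ltn_trans IH (h n). Qed.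

Lemma cvg_subsequence (phi : nat -> nat) :
  (forall n, (phi n < phi n.+1)%N) -> phi @ \oo --> \oo.
Proof.
move=> h; apply/cvgnyPge => A; near=> n.
by apply: leq_trans _ (subsequence_ge h n); near: n; exists A.
Unshelve. all: by end_near. Qed.

(** Only pointwise convergence is extracted, since bounded convergence needs no more. Values at
    rationals are enumerated by [pickle]; the common Lipschitz constant carries the Cauchy property
    to all reals. *)
Lemma arzela_ascoli {R : realType} {J : countType} (f : nat -> J -> R -> R)
    (C L : J -> R) :
  (forall n j u, `|f n j u| <= C j) ->
  (forall n j u v, `|f n j u - f n j v| <= L j * `|u - v|) ->
  exists2 phi : nat -> nat, (forall n, (phi n < phi n.+1)%N) &
    forall j u, cvgn (fun n => f (phi n) j u).
Proof.
move=> fC fL.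
pose x n m := if @unpickle (J * rat)%type m is Some (j, q) then f n j (ratr q) else 0.
pose D m := if @unpickle (J * rat)%type m is Some (j, q) then C j else 0.
have xD n m : `|x n m| <= D m.
  by rewrite /x /D; case: unpickle => [[j q]|]; rewrite ?normr0.
have [phi phiS cphi] := diagonal_subsequence xD.
exists phi => // j u; apply: cauchy_cvg; apply: cauchy_exP => e e0.
have L0 : 0 < `|L j| + 1 by rewrite ltr_wpDl.
have [q] : exists q : rat, ratr q \in `]u, u + e / 3 / (`|L j| + 1)[%R.
  by apply: rat_in_itvoo; rewrite ltrDl !divr_gt0.
rewrite in_itv /= => /andP[uq qu].
have /cvg_ex[l /cvgrPdist_lt/(_ (e / 3))] := cphi (pickle (j, q)).
rewrite /x pickleK divr_gt0// => /(_ isT) H.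
exists l; near=> n.
rewrite /ball /=.
have -> : l - f (phi n) j u =
    (l - f (phi n) j (ratr q)) + (f (phi n) j (ratr q) - f (phi n) j u).
  by rewrite addrA subrK.
apply: le_lt_trans (ler_normD _ _) _.
have h1 : `|l - f (phi n) j (ratr q)| < e / 3 by near: n; exact: H.
have h2 : `|f (phi n) j (ratr q) - f (phi n) j u| <= e / 3.
  apply: le_trans (fL _ _ _ _) _.
  rewrite gtr0_norm ?subr_gt0//.
  have : L j * (ratr q - u) <= (`|L j| + 1) * (ratr q - u).
    rewrite ler_wpM2r ?subr_ge0 ?ltW//.
    by rewrite (le_lt_trans (ler_norm _))// ltrDl.
  move=> /le_trans; apply.
  rewrite mulrC -ler_pdivlMr//.
  by rewrite lerBlDl ltW.
lra.
Unshelve. all: by end_near. Qed.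

Lemma measurable_nondecreasing_in {R : realType} (D : set R) (f : R -> R) :
  is_interval D -> measurable D -> {in D &, {homo f : x y / x <= y}} ->
  measurable_fun D f.
Proof.
move=> iD mD fnd.
apply: (measurability (@RGenCInfty.G R)) => [|/= _ [_] [r] -> <-].
  exact: RGenCInfty.measurableE.
apply: is_interval_measurable => s t [Ds /=] + [Dt /=].
rewrite !in_itv/= !andbT => fs ft u /andP[su ut].
have Du : D u by apply: (iD s t) => //; rewrite su ut.
split=> //=; rewrite in_itv/= andbT (le_trans fs)//.
by apply: fnd; rewrite ?inE.
Qed.

Lemma measurable_nondecreasing01 {R : realType} (f : R -> R) :
  {in `]0, 1[%classic &, {homo f : x y / x <= y}} ->
  (forall x, x \notin `]0, 1[%classic -> f x = 0) -> measurable_fun setT f.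
Proof.
move=> fnd f0.
rewrite -(setUv `]0, 1[%classic); apply/measurable_funU => //; first exact: measurableC.
split; first by apply: measurable_nondecreasing_in => //; exact: interval_is_interval.
apply: (@eq_measurable_fun _ _ _ _ _ (cst (0 : R) : R -> R)).
  by move=> x; rewrite inE/= => xN; rewrite f0// notin_setE.
exact: measurable_cst.
Qed.

Section bounded_functions.
Context d (T : measurableType d) (R : realType) (P : probability T R).

Lemma bounded_integrable (f : T -> R) (K : R) : measurable_fun setT f ->
  (forall x, `|f x| <= K) -> P.-integrable setT (EFin \o f).
Proof.
move=> mf fK; apply: (le_integrable measurableT _ _ (finite_measure_integrable_cst P K measurableT)).
  exact/measurable_EFinP.
move=> x _ /=; rewrite lee_fin; apply: le_trans (fK x) _; exact: ler_norm.
Qed.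

Lemma bounded_convergence (f_ : nat -> T -> R) (f : T -> R) (K : R) :
  (forall n, measurable_fun setT (f_ n)) -> measurable_fun setT f ->
  (forall n x, `|f_ n x| <= K) ->
  {ae P, forall x, f_ n x @[n --> \oo] --> f x} ->
  \int[P]_x f_ n x @[n --> \oo] --> \int[P]_x f x.
Proof.
move=> mf_ mf fK cf.
have [ |||||i _ c] := @dominated_convergence _ T R P setT measurableT
  (fun n x => (f_ n x)%:E) (EFin \o f) (cst K%:E).
- by move=> n; exact/measurable_EFinP.
- exact/measurable_EFinP.
- by apply: filterS cf => x cx _; apply: cvg_EFin cx; exact: nearW.
- exact: finite_measure_integrable_cst.
- by apply: aeW => x n _ /=; rewrite lee_fin.
- rewrite /Rintegral; apply: fine_cvg; rewrite fineK//.
  exact: integrable_fin_num.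
Qed.

End bounded_functions.

(** * Quantile coupling with the uniform law *)

Section uniform01.
Context {R : realType}.

Definition unif01 : set (measurableTypeR R) -> \bar R :=
  mrestr (@lebesgue_measure R) (measurable_itv `]0, 1[%R).

HB.instance Definition _ := Measure.on unif01.

Let unif01_setT : unif01 setT = 1%E.
Proof. by rewrite /unif01 /mrestr setTI lebesgue_measure_itv/= lte01 oppr0 adde0. Qed.

HB.instance Definition _ := Measure_isProbability.Build _ _ _ unif01 unif01_setT.

End uniform01.

Section quantile.
Context {R : realType} (P : probability R R).

Let F (a : R) : R := fine (P `]-oo, a]%classic).

Let FE a : P `]-oo, a]%classic = (F a)%:E.
Proof. by rewrite /F fineK// fin_num_measure. Qed.

Let F_nd : {homo F : a b / a <= b}.
Proof.
move=> a b ab; rewrite -lee_fin -!FE; apply: le_measure; rewrite ?inE//.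
exact: subset_itvl.
Qed.

Let F_ge0 a : 0 <= F a.
Proof. by rewrite -lee_fin -FE. Qed.

Let F_le1 a : F a <= 1.
Proof. by rewrite -lee_fin -FE probability_le1. Qed.

Let F_right (a w : R) : (forall n, w <= F (a + n.+1%:R^-1)) -> w <= F a.
Proof.
move=> H; rewrite -lee_fin -FE.
have -> : `]-oo, a]%classic = \bigcap_n `]-oo, (a + n.+1%:R^-1)%R]%classic.
  exact: (itvNycEbigcap false).
have := @nonincreasing_cvg_mu _ _ _ P (fun n => `]-oo, (a + n.+1%:R^-1)%R]%classic) _ _ _ _.
move=> /(_ _ _ _ _)/cvg_lim => <- //.
- apply: lime_ge.
    apply: ereal_nonincreasing_is_cvgn => m n mn.
    apply: le_measure; rewrite ?inE//; apply: subset_itvl.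
    by rewrite bnd_simp lerD2l lef_pV2 ?posrE// ler_nat.
  by apply: nearW => n /=; rewrite FE lee_fin.
- by rewrite (le_lt_trans (probability_le1 _ _))// ltry.
- exact: bigcap_measurable.
- move=> m n mn; apply/subsetPset; apply: subset_itvl.
  by rewrite bnd_simp lerD2l lef_pV2 ?posrE// ler_nat.
Qed.

Let F_large (w : R) : w < 1 -> exists a, w <= F a.
Proof.
move=> w1; apply: contrapT => /forallNP H.
have : (P setT <= w%:E)%E; last by rewrite probability_setT lee_fin leNgt w1.
rewrite (_ : setT = \bigcup_n `]-oo, n%:R]%classic); last first.
  apply/seteqP; split=> // x _; exists (Num.bound x) => //=.
  by rewrite in_itv/= ltW// ltr_bound.
have nd : nondecreasing_seq (fun n => `]-oo, (n%:R : R)]%classic).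
  by move=> m n mn; apply/subsetPset/subset_itvl; rewrite bnd_simp ler_nat.
have /cvg_lim <- // := @nondecreasing_cvg_mu _ _ _ P (fun n => `]-oo, n%:R]%classic)
  (fun=> measurable_itv _) (bigcup_measurable (fun k _ => measurable_itv _)) nd.
apply: lime_le; last by apply: nearW => n /=; rewrite FE lee_fin ltW// ltNge; apply/negP.
apply: ereal_nondecreasing_is_cvgn => m n mn.
by apply: le_measure; rewrite ?inE//; exact/subsetPset/nd.
Qed.

Let F_small (w : R) : 0 < w -> exists a, F a < w.
Proof.
move=> w0; apply: contrapT => /forallNP H.
have : (w%:E <= P set0)%E; last by rewrite measure0 lee_fin leNgt w0.
rewrite (_ : set0 = \bigcap_n `]-oo, (- n%:R)%R]%classic); last first.
  apply/esym; rewrite -subset0 => t /(_ (Num.bound t) I).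
  by rewrite /= in_itv/= leNgt => /negP; apply; rewrite ltrNl ltrNbound.
have nd : {homo (fun n => `]-oo, (- n%:R : R)]%classic) : n m / (n <= m)%N >-> (m <= n)%O}.
  by move=> m n mn; apply/subsetPset/subset_itvl; rewrite bnd_simp lerN2 ler_nat.
have := @nonincreasing_cvg_mu _ _ _ P (fun n => `]-oo, (- n%:R)%R]%classic).
move=> /(_ _ _ _ nd)/cvg_lim => <- //.
- apply: lime_ge.
    apply: ereal_nonincreasing_is_cvgn => m n mn.
    by apply: le_measure; rewrite ?inE//; exact/subsetPset/nd.
  by apply: nearW => n /=; rewrite FE lee_fin leNgt; apply/negP.
- by rewrite (le_lt_trans (probability_le1 _ _))// ltry.
- exact: bigcap_measurable.
Qed.

(** Outside the open unit interval the set may be empty or unbounded below; the default 0 is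
    invisible because [unif01] has no mass there. *)
Definition quantile (w : R) : R :=
  if w \in `]0, 1[%classic then inf [set a | w <= fine (P `]-oo, a]%classic)] else 0.

(** Right continuity of the distribution function makes the infimum attained. This Galois
    correspondence yields both the monotonicity of the quantile and its law. *)
Lemma quantile_le (w a : R) : 0 < w < 1 ->
  (quantile w <= a) = (w <= fine (P `]-oo, a]%classic)).
Proof.
move=> w01; rewrite /quantile mem_set/=; last by rewrite in_itv.
case/andP: w01 => w0 w1.
have [b wb] := F_large w1; have [c cw] := F_small w0.
have lb : has_lbound [set a | w <= F a].
  exists c => y /= wy; rewrite leNgt; apply/negP => yc.
  by have := lt_le_trans cw wy; rewrite ltNge F_nd// ltW.
apply/idP/idP => [ia|wa]; last by apply: ge_inf.
apply: (F_right) => n.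
have [||e /= we] := @inf_adherent R [set a | w <= F a] n.+1%:R^-1.
- by rewrite invr_gt0.
- by split=> //; exists b.
move=> /ltW elt; apply: le_trans we _; apply: F_nd; apply: le_trans elt _.
by rewrite lerD2r.
Qed.

Lemma quantile_nd : {in `]0, 1[%classic &, {homo quantile : x y / x <= y}}.
Proof.
move=> x y; rewrite !inE/= !in_itv/= => x01 y01 xy.
by rewrite quantile_le// (le_trans xy)// -quantile_le.
Qed.

Lemma measurable_quantile : measurable_fun setT quantile.
Proof.
apply: measurable_nondecreasing01; first exact: quantile_nd.
by move=> x /negbTE xN; rewrite /quantile xN.
Qed.

Lemma quantile_law (A : set R) : measurable A ->
  P A = pushforward (@unif01 R) quantile A.
Proof.
have mq := measurable_quantile.
pose m := pushforward (@unif01 R) quantile.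
move: A; apply: (@measure_unique _ R R (@ocitv R)
  (fun k => `]-k%:R, k%:R]%classic) erefl _ _ _ P m) => //.
- exact: ocitvI.
- by move=> k; exact: is_ocitv.
- apply/seteqP; split=> // x _; exists (Num.bound x) => //=.
  by rewrite in_itv/= ltrNl ltrNbound/= ltW// ltr_bound.
- move=> _ [[a b] _ /= <-].
  have [ba|ab] := leP b a; first by rewrite set_itv_ge ?measure0// bnd_simp -leNgt.
  transitivity (F b - F a)%:E.
    have : `]a, b]%classic = `]-oo, b] `\` `]-oo, a] => [|->].
      by rewrite -[RHS]setCK setCD setCitvl setUC -[LHS]setCK setCitv.
    have sab : `]-oo, a] `<=` `]-oo, b] by apply: subset_itvl; rewrite bnd_simp ltW.
    rewrite measureD//=.
      by rewrite EFinB -!FE setIidr.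
    by rewrite (le_lt_trans (probability_le1 _ _))// ltry.
  have F01 := F_nd (ltW ab).
  have leb_itv b1 b2 : lebesgue_measure [set` Interval (BSide b1 (F a)) (BSide b2 (F b))]
      = (F b - F a)%:E.
    rewrite lebesgue_measure_itv/=; case: ifPn => //; rewrite lte_fin -leNgt => h.
    by have -> : F b = F a; [apply/eqP; rewrite eq_le h F01|rewrite subrr].
  have mI : measurable (quantile @^-1` `]a, b] `&` `]0, 1[).
    apply: measurableI => //; rewrite -[X in measurable X]setTI.
    exact: mq.
  rewrite /m /pushforward/= /unif01 /mrestr; apply/eqP; rewrite eq_le; apply/andP; split.
    rewrite -(leb_itv false true); apply: le_measure; rewrite ?inE//.
    move=> w /= /[!in_itv]/= /andP[Faw wFb']; have wFb := ltW wFb'.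
    have w01 : 0 < w < 1.
      by rewrite (le_lt_trans (F_ge0 a) Faw) (lt_le_trans wFb' (F_le1 b)).
    by rewrite (quantile_le b w01) ltNge (quantile_le a w01) -ltNge Faw wFb.
  rewrite -(leb_itv false false); apply: le_measure; rewrite ?inE//.
  move=> w [/= /[!in_itv]/= /andP[Faw wFb] w01].
  by rewrite -(quantile_le b w01) wFb andbT ltNge -(quantile_le a w01) -ltNge.
- by move=> k; rewrite (le_lt_trans (probability_le1 _ _))// ltry.
Qed.

Lemma Rintegral_quantile (f : R -> R) (K : R) : measurable_fun setT f ->
  (forall x, `|f x| <= K) -> \int[P]_r f r = \int[@unif01 R]_w f (quantile w).
Proof.
move=> mf fK; rewrite /Rintegral; congr fine.
have mq : measurable_fun (setT : set (measurableTypeR R)) (quantile : _ -> R) := measurable_quantile.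
have i0 : (@unif01 R).-integrable setT ((EFin \o f) \o quantile).
  exact: (@bounded_integrable _ (measurableTypeR R) R (@unif01 R) (f \o quantile) K (measurableT_comp mf mq) (fun x => fK _)).
rewrite -[RHS](@integral_pushforward _ _ _ _ _ _ mq (@unif01 R) setT (EFin \o f)) //.
  by apply: eq_measure_integral => A mA _; first [exact: (quantile_law mA) | exact: (esym (quantile_law mA))].
exact/measurable_EFinP.
Qed.

End quantile.

Lemma pushforward_probability {R : realType} d (T : measurableType d)
    (P : probability T R) (f : T -> R) : measurable_fun setT f ->
  exists nu : probability R R, forall g : R -> R, measurable_fun setT g -> (exists K, forall x, `|g x| <= K) ->
    \int[nu]_r g r = \int[P]_w g (f w).
Proof.
move=> mf; pose X : {RV P >-> R} := mfun_Sub (mem_set mf).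
exists (distribution P X) => g mg [K gK]; rewrite /Rintegral; congr fine.
rewrite (@integral_pushforward _ _ _ _ _ _ _ P setT (EFin \o g)) //.
- exact/measurable_EFinP.
- exact: (@bounded_integrable _ T R P (g \o X) K (measurableT_comp mg mf) (fun x => gK _)).
Qed.

Lemma continuous_measurable {R : realType} (f : R -> R) : continuous f -> measurable_fun setT f.
Proof. exact: continuous_measurable_fun. Qed.

(* The quantile functions converge at rational levels along a subsequence, hence off the countably
   many jumps of their monotone limit, whose law under the uniform measure is the limit law. *)
Lemma helly {R : realType} {J : countType} (mu : nat -> J -> probability R R) :
  (forall j e, 0 < e -> exists K : R, forall n, (mu n j (~` (`[(- K)%R, K]%classic : set R)) <= e%:E)%E) ->
  exists2 phi : nat -> nat, (forall n, (phi n < phi n.+1)%N) &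
  exists nu : J -> probability R R, forall j (f : R -> R),
    continuous f -> bounded_fun_R f ->
    \int[mu (phi n) j]_r f r @[n --> \oo] --> \int[nu j]_r f r.
Proof.
move=> tight.
have qbnd (jq : J * rat) : exists C : R, forall n, `|quantile (mu n jq.1) (ratr jq.2)| <= C.
  case: jq => j r /=; set w : R := ratr r.
  have [/[dup] w01 /[!inE]/= /[!in_itv]/= /andP[w0 w1]|wN] := boolP (w \in `]0, 1[%classic); last first.
    by exists 0 => n; rewrite /quantile (negbTE wN) normr0.
  (* If less than half of the distance from the level [w] to 0 and 1 lies outside [[-K, K]], the
     quantile at [w] cannot leave that interval by more than 1, whatever [n] is. *)
  have m0 : 0 < Num.min w (1 - w) by rewrite lt_min w0 subr_gt0 w1.
  have [K HK] := tight j (Num.min w (1 - w) / 2) ltac:(by rewrite divr_gt0).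
  have mw : Num.min w (1 - w) / 2 < w by rewrite (@lt_le_trans _ _ (Num.min w (1 - w)))// ?ge_min ?lexx//; lra.
  have mw1 : Num.min w (1 - w) / 2 < 1 - w by rewrite (@lt_le_trans _ _ (Num.min w (1 - w)))// ?ge_min ?lexx ?orbT//; lra.
  exists (`|K| + 1) => n.
  have F := HK n; rewrite ler_norml; apply/andP; split.
    rewrite leNgt; apply/negP => /ltW; rewrite quantile_le ?w0//.
    rewrite -lee_fin fineK ?fin_num_measure// => H.
    have : (w%:E <= (Num.min w (1 - w) / 2)%:E)%E; last by rewrite lee_fin leNgt mw.
    apply: le_trans H (le_trans _ F); apply: le_measure; rewrite ?inE//.
      exact: measurableC.
    move=> y /=; rewrite !in_itv/= => yK; apply/negP; rewrite negb_and -!ltNge.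
    apply/orP; left; have := ler_norm K; lra.
  rewrite quantile_le ?w0// -lee_fin fineK ?fin_num_measure//.
  rewrite -[X in mu n j X]setCK probability_setC; last exact: measurableC.
  have H : (mu n j (~` `]-oo, (`|K| + 1)%R]%classic) <= (Num.min w (1 - w) / 2)%:E)%E.
    apply: le_trans _ F; apply: le_measure; rewrite ?inE; [exact: measurableC|exact: measurableC|].
    move=> y /=; rewrite !in_itv/= => /negP; rewrite -ltNge => yK; apply/negP; rewrite negb_and -!ltNge.
    apply/orP; right; have := ler_norm K; lra.
  rewrite (@le_trans _ _ (1 - (Num.min w (1 - w) / 2)%:E)%E)//; last exact: leeB.
  rewrite lee_fin; lra.
have [C HC] := choice qbnd.
pose x n m := if @unpickle (J * rat)%type m is Some (j, q) then quantile (mu n j) (ratr q) else 0.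
have xD n m : `|x n m| <= if @unpickle (J * rat)%type m is Some jq then C jq else 0.
  by rewrite /x; case: unpickle => [[j q]|]; rewrite ?normr0//; exact: (HC (j, q)).
have [phi phiS cphi] := diagonal_subsequence xD.
exists phi => //.
pose l j q := lim (quantile (mu (phi n) j) (ratr q) @[n --> \oo]).
have xl j q : quantile (mu (phi n) j) (ratr q) @[n --> \oo] --> (l j q : R).
  by have := cphi (pickle (j, q)); rewrite /x pickleK.
(* The supremum over smaller rationals makes the limit monotone without asking for convergence at
   irrational levels. *)
pose X j (w : R) : R := if w \in `]0, 1[%classic then sup [set l j q | q in [set q : rat | 0 < (ratr q : R) < w]] else 0 : R.
have q01 (v : R) : v \in `]0, 1[%classic = (0 < v < 1) by apply/idP/idP; rewrite inE/= in_itv.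
have l_nd j q r : 0 < ratr q :> R -> ratr q <= ratr r :> R -> ratr r < 1 :> R -> l j q <= l j r.
  move=> q0 qr r1; apply: (ler_cvg_to (xl j q) (xl j r)); apply: nearW => n.
  by apply: quantile_nd; rewrite ?q01 // ?q0 ?r1 ?(le_lt_trans qr r1)// (lt_le_trans q0 qr).
have lX j q (w : R) : 0 < (ratr q : R) < w -> w < 1 -> l j q <= X j w.
  move=> /andP[q0 qw] w1; rewrite /X q01 (lt_trans q0 qw) w1/=.
  apply: ub_le_sup; last by exists q => //=; rewrite q0.
  have [r] := rat_in_itvoo w1; rewrite in_itv/= => /andP[wr r1].
  exists (l j r) => _ [p /= /andP[p0 pw] <-]; apply: l_nd => //.
  by rewrite ltW// (lt_trans pw).
have Xl j q (w : R) : 0 < w < ratr q -> ratr q < 1 :> R -> X j w <= l j q.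
  move=> /andP[w0 wq] q1; rewrite /X q01 w0 (lt_trans wq q1)/=.
  apply: ge_sup.
    have [r] := rat_in_itvoo w0; rewrite in_itv/= => rw; by exists (l j r), r.
  move=> _ [p /= /andP[p0 pw] <-]; apply: l_nd => //.
  by rewrite ltW// (lt_trans pw).
have Xnd j : {in `]0, 1[%classic &, {homo X j : x y / x <= y}}.
  move=> u v; rewrite !q01 => /andP[u0 u1] /andP[v0 v1]; rewrite le_eqVlt => /predU1P[->//|uv].
  have [r] := rat_in_itvoo uv; rewrite in_itv/= => /andP[ur rv].
  apply: (@le_trans _ _ (l j r)); first by apply: Xl; rewrite ?u0// (lt_trans rv).
  by apply: lX; rewrite ?rv// (lt_trans u0 ur).
have mX j : measurable_fun setT (X j).
  by apply: measurable_nondecreasing01 => // y /negbTE yN; rewrite /X yN.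
(* Levels at which [X j] jumps to the right. Each jump contains a rational and different jumps
   contain different ones, so these levels are countable and negligible for the uniform law. *)
pose E j := [set w : R | 0 < w < 1 /\ exists2 eta, 0 < eta & forall v, w < v < 1 -> X j w + eta <= X j v].
have cE j : countable (E j).
  pose g w := if pselect (exists q : rat, X j w < (ratr q : R) /\ forall v, w < v < 1 -> ratr q < X j v)
    is left h then pickle (projT1 (cid h)) else 0%N.
  have gE w : E j w -> exists q : rat, [/\ g w = pickle q, X j w < ratr q &
      forall v, w < v < 1 -> ratr q < X j v].
    move=> [w01 [eta eta0 H]]; rewrite /g; case: pselect => [h|[]].
      by exists (projT1 (cid h)); have [? ?] := projT2 (cid h).
    have [|q] := @rat_in_itvoo R (X j w) (X j w + eta); first by rewrite ltrDl.
    rewrite in_itv/= => /andP[h1 h2]; exists q; split=> // v /H; exact: lt_le_trans.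
  apply/countable_injP; exists g => u v; rewrite !inE => Eu Ev.
  have [q [-> Xq qX]] := gE _ Eu; have [r [-> Xr rX]] := gE _ Ev.
  move=> /(pcan_inj pickleK) qr; rewrite -qr in Xr rX => {qr r}.
  have [uv|vu|//] := ltgtP u v.
  - have := qX v; rewrite uv (andP Ev.1).2 => /(_ isT) h; by move: (lt_trans Xr h); rewrite ltxx.
  - have := rX u; rewrite vu (andP Eu.1).2 => /(_ isT) h; by move: (lt_trans Xq h); rewrite ltxx.
have cX j w : ~ E j w -> quantile (mu (phi n) j) w @[n --> \oo] --> X j w.
  move=> nE; have [w01|w01] := boolP (0 < w < 1); last first.
    rewrite (_ : (fun n => _) = cst 0); last first.
      by apply/funext => n; rewrite /quantile q01 (negbTE w01).
    by rewrite /X q01 (negbTE w01); exact: cvg_cst.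
  have [w0 w1] := andP w01.
  apply/cvgrPdist_lt => e e0.
  have e20 : 0 < e / 2 by rewrite divr_gt0.
  have [v /andP[wv v1] Xv] : exists2 v, w < v < 1 & X j v < X j w + e / 2.
    apply: contrapT => H; apply: nE; split=> //; exists (e / 2) => // v vw.
    by rewrite leNgt; apply/negP => h; apply: H; exists v.
  have [r] := rat_in_itvoo wv; rewrite in_itv/= => /andP[wr rv].
  have lr : l j r <= X j v by apply: lX => //; rewrite rv (lt_trans w0 wr).
  have [q q0w lq] : exists2 q : rat, 0 < (ratr q : R) < w & X j w - e / 2 < l j q.
    have [|_ [q /= qw <-]] := @sup_adherent R [set l j q | q in [set q : rat | 0 < (ratr q : R) < w]] (e / 2) e20.
      split.
        have [p] := rat_in_itvoo w0; rewrite in_itv/= => pw; by exists (l j p), p.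
      by exists (X j w) => _ [p /= pw <-]; exact: lX.
    by exists q => //; rewrite /X q01 w01.
  have [q0 qw] := andP q0w.
  near=> n.
  have h1 : `|l j r - quantile (mu (phi n) j) (ratr r)| < e / 2.
    by near: n; move/cvgrPdist_lt : (xl j r); exact.
  have h2 : `|l j q - quantile (mu (phi n) j) (ratr q)| < e / 2.
    by near: n; move/cvgrPdist_lt : (xl j q); exact.
  have r1 := lt_trans rv v1.
  have m1 : quantile (mu (phi n) j) w <= quantile (mu (phi n) j) (ratr r).
    by apply: quantile_nd; rewrite ?q01 ?w01// ?(lt_trans w0 wr)// ltW.
  have m2 : quantile (mu (phi n) j) (ratr q) <= quantile (mu (phi n) j) w.
    by apply: quantile_nd; rewrite ?q01 ?w01// ?q0 ?(lt_trans qw w1)// ltW.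
  move: h1 h2; rewrite !ltr_norml => /andP[a1 a2] /andP[b1 b2].
  apply/andP; split; lra.
have /choice[nu Hnu] j := @pushforward_probability R _ _ (@unif01 R) (X j) (mX j).
exists nu => j f cf [K fK].
have mf := continuous_measurable cf.
rewrite Hnu//; last by exists K.
rewrite (_ : (fun n => _) = fun n => \int[@unif01 R]_w f (quantile (mu (phi n) j) w)); last first.
  by apply/funext => n; rewrite (Rintegral_quantile _ mf fK).
apply: (@bounded_convergence _ _ _ _ _ _ K).
- by move=> n; apply: measurableT_comp => //; exact: measurable_quantile.
- exact: (measurableT_comp mf (mX j)).
- by move=> n x0; exact: fK.
- exists (E j); split.
  + exact: countable_measurable.
  + apply/eqP; rewrite eq_le measure_ge0 andbT -(countable_lebesgue_measure0 (cE j)).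
    apply: le_measure; rewrite ?inE; [|exact: countable_measurable|by move=> y []].
    by apply: measurableI => //; exact: countable_measurable.
  + move=> w /= Nw; apply: contrapT => Ew; apply: Nw.
    by apply: continuous_cvg (cX _ _ Ew); exact: cf.
Unshelve. all: by end_near. Qed.

(** * The Choquet-Deny argument *)

Lemma lipschitz_cont {R : realType} (f : R -> R) (L : R) :
  (forall u v, `|f u - f v| <= L * `|u - v|) -> continuous f.
Proof.
move=> fL x; apply/cvgrPdist_lt => e e0.
have L0 : 0 < `|L| + 1 by rewrite ltr_wpDl.
near=> y; apply: le_lt_trans (fL _ _) _.
apply: (@le_lt_trans _ _ ((`|L| + 1) * `|x - y|)).
  by rewrite ler_wpM2r// (le_trans (ler_norm _))// lerDl.
rewrite mulrC -ltr_pdivlMr//; near: y.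
by apply: cvgr_dist_lt => //; rewrite divr_gt0.
Unshelve. all: by end_near. Qed.

Lemma cvgn_le {R : realType} (u : nat -> R) (l c : R) :
  u n @[n --> \oo] --> l -> (forall n, u n <= c) -> l <= c.
Proof. by move=> ul uc; apply: (ler_cvg_to ul (cvg_cst c)); exact: nearW. Qed.

Lemma cvgn_norm_le {R : realType} (u : nat -> R) (l c : R) :
  u n @[n --> \oo] --> l -> (forall n, `|u n| <= c) -> `|l| <= c.
Proof. by move=> ul; apply: cvgn_le; exact: cvg_norm. Qed.

Lemma Rintegral_prob_cst {d} {T : measurableType d} {R : realType} (P : probability T R) (c : R) :
  \int[P]_x c = c.
Proof.
rewrite Rintegral_cst// (_ : fine _ = 1) ?mulr1//.
exact: (congr1 fine (probability_setT P)).
Qed.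

Lemma cvgn_sum {R : realType} {I : finType} (D : pred I) (u : nat -> I -> R) (l : I -> R) :
  (forall i, D i -> u n i @[n --> \oo] --> l i) ->
  \sum_(i | D i) u n i @[n --> \oo] --> \sum_(i | D i) l i.
Proof.
move=> ul; apply: (@cvg_big R I +%R 0 D _ nat \oo (index_enum I) (fun i n => u n i) l) => //.
exact: add_continuous.
Qed.

(** * Support of a law on the line *)

Section support.
Context {R : realType} (P : probability R R).

Definition supp : set R := [set s | forall e, 0 < e -> P `]s - e, s + e[%classic != 0%E].

(** A point outside the support lies in a null interval with rational endpoints, and there are
    countably many of these. *)
Lemma negligible_suppC : P.-negligible (~` supp).
Proof.
pose B (m : nat) : set R := if @unpickle (rat * rat)%type m is Some (p, q) then
  (if P `]ratr p, ratr q[%classic == 0%E then `]ratr p, ratr q[%classic else set0) else set0.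
have NB m : P.-negligible (B m).
  rewrite /B; case: unpickle => [[p q]|]; last exact: negligible_set0.
  case: ifPn => [/eqP h|_]; last exact: negligible_set0.
  by apply/negligibleP.
apply: (@negligibleS _ _ _ P (\bigcup_m B m)); last exact: negligible_bigcup.
move=> s /= Ns.
have [e e0 Pe] : exists2 e, 0 < e & P `]s - e, s + e[%classic = 0%E.
  by apply: contrapT => H; apply: Ns => e e0; apply/eqP => h; apply: H; exists e.
have [p] : exists p : rat, ratr p \in `]s - e, s[ by apply: rat_in_itvoo; rewrite ltrBlDr ltrDl.
have [q] : exists q : rat, ratr q \in `]s, s + e[ by apply: rat_in_itvoo; rewrite ltrDl.
rewrite !in_itv/= => /andP[sq qe] /andP[ep ps].
exists (pickle (p, q)); first exact: I.
rewrite /B pickleK.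
suff -> : P `]ratr p, ratr q[%classic = 0%E by rewrite eqxx /= in_itv/= ps sq.
apply/eqP; rewrite eq_le measure_ge0 andbT -Pe; apply: le_measure; rewrite ?inE//.
by move=> x; rewrite /= !in_itv/= => /andP[px xq]; rewrite (lt_trans ep px) (lt_trans xq qe).
Qed.

Lemma not_negligible_supp : ~ P.-negligible supp.
Proof.
move=> N; have : P.-negligible setT by rewrite -(setUv supp); exact: negligibleU N negligible_suppC.
move=> /negligibleP => /(_ measurableT) h.
have : P setT = 1%E := probability_setT P.
by rewrite h => /eqP; rewrite eq_sym onee_eq0.
Qed.

Lemma supp_nonempty : supp !=set0.
Proof.
apply/set0P/negP => /eqP h; apply: not_negligible_supp; rewrite h; exact: negligible_set0.
Qed.

(** Otherwise every cell of a grid of mesh [eta] holds at most one support point; the support is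
    then countable and, without atoms, null. *)
Lemma supp_close_points (eta : R) : (forall a, P [set a] = 0%E) -> 0 < eta ->
  exists s t, [/\ supp s, supp t, s < t & t < s + eta].
Proof.
move=> P0 eta0; apply: contrapT => H; apply: not_negligible_supp.
pose B (m : nat) : set R := if @unpickle int m is Some z then [set s | supp s /\ Num.floor (s / eta) = z] else set0.
have NB m : P.-negligible (B m).
  rewrite /B; case: unpickle => [z|]; last exact: negligible_set0.
  have [[s [ss fs]]|/forallNP nex] := pselect (exists s, supp s /\ Num.floor (s / eta) = z); last first.
    by apply: (@negligibleS _ _ _ P set0); [move=> s /nex|exact: negligible_set0].
  apply: (@negligibleS _ _ _ P [set s]); last first.
    by apply/negligibleP => //; exact: P0.
  have close s1 s2 : supp s1 -> Num.floor (s1 / eta) = z -> supp s2 -> Num.floor (s2 / eta) = z -> ~ s1 < s2.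
    move=> h1 f1 h2 f2 s12; apply: H; exists s1, s2; split=> //.
    have := floor_itv (s1 / eta); have := floor_itv (s2 / eta); rewrite f1 f2 !intrD.
    move=> /andP[_ a1] /andP[a2 _].
    have : s2 / eta < s1 / eta + 1 by lra.
    by rewrite ltr_pdivrMr// mulrDl divfK ?gt_eqF// mul1r.
  move=> t /= [st ft]; have [ts|st'|//] := ltgtP t s; exfalso.
  - exact: (close t s).
  - exact: (close s t).
apply: (@negligibleS _ _ _ P (\bigcup_m B m)); last exact: negligible_bigcup.
move=> s ss; exists (pickle (Num.floor (s / eta))); first exact: I.
by rewrite /B pickleK.
Qed.

Lemma supp_eq0 (h : R -> R) (K s : R) : continuous h -> (forall x, 0 <= h x) ->
  (forall x, h x <= K) -> \int[P]_x h x = 0 -> supp s -> h s = 0.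
Proof.
move=> ch h0 hK ih ss; apply/eqP; rewrite eq_le h0 andbT leNgt; apply/negP => hs.
have hs2 : 0 < h s / 2 by rewrite divr_gt0.
have /cvgrPdist_lt/(_ _ hs2) := ch s.
move=> /nbhs_ballP[e /= e0 He].
have [mh ih'] : measurable_fun setT h /\ P.-integrable setT (EFin \o h).
  split; first exact: continuous_measurable.
  apply: (@bounded_integrable _ _ _ _ h K); first exact: continuous_measurable.
  by move=> x; rewrite ger0_norm.
have ib : P.-integrable setT (EFin \o (fun x => h s / 2 * \1_(`]s - e, s + e[) x)).
  apply: (@bounded_integrable _ _ _ _ _ (h s / 2)).
    by apply: measurable_funM => //; exact: measurable_indic.
  move=> x; rewrite indicE; case: (_ \in _); rewrite ?mulr1 ?mulr0 ?normr0 ?gtr0_norm//; exact: ltW.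
have := le_Rintegral measurableT ib ih' _.
rewrite ih RintegralZl//; last first.
  apply: (@bounded_integrable _ _ _ _ _ 1); first exact: measurable_indic.
  by move=> x; rewrite indicE; case: (_ \in _); rewrite ?normr1 ?normr0.
rewrite {1}/Rintegral integral_indic// setIT.
have := ss e e0; rewrite -measure_gt0 => p0 H.
have : 0 < h s / 2 * fine (P `]s - e, s + e[%classic).
  by rewrite mulr_gt0// fine_gt0// p0 /= (le_lt_trans (probability_le1 _ _))// ltry.
rewrite ltNge H//= => x _; rewrite indicE; case: (boolP (_ \in _)); rewrite ?mulr0// mulr1 inE/= in_itv/= => /andP[x1 x2].
have xb : ball s e x by rewrite /ball/= ltr_norml; apply/andP; split; lra.
have /= := He x xb; rewrite ltr_norml => /andP[_]; lra.
Qed.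

End support.

Section choquet_deny.
Context {R : realType} {I : finType} (D : pred I) (P : I -> I -> R)
  (lam : I -> R) (nu : I -> probability R R) (i0 : I).
Hypothesis P_ge0 : forall i j, 0 <= P i j.
Hypothesis P_closed : forall i j, D i -> 0 < P i j -> D j.
Hypothesis P_irr : forall i j, D i -> D j -> i != j ->
  clos_trans I (fun a b => 0 < P a b) i j.
Hypothesis lam_gt0 : forall i, D i -> 0 < lam i.
Hypothesis lam_inv : forall j, D j -> lam j = \sum_(i | D i) lam i * P i j.
Hypothesis D_i0 : D i0.
Hypothesis D_other : exists2 i1, D i1 & i0 != i1.
Hypothesis nu_i0 : forall a, nu i0 [set a] = 0%E.

Let Ps k i := lam i * P i k / lam k.

Let Ps_ge0 k i : D k -> D i -> 0 <= Ps k i.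
Proof. by move=> Dk Di; rewrite divr_ge0 ?mulr_ge0// ltW// lam_gt0. Qed.

Let Ps_sum k : D k -> \sum_(i | D i) Ps k i = 1.
Proof. by move=> Dk; rewrite -mulr_suml -lam_inv// divff// gt_eqF// lam_gt0. Qed.

(* Dividing a solution by [lam] turns the convolution equation into a mean value property for the
   reversed chain [Ps]. *)
Definition harmonic C L (q : I -> R -> R) :=
  [/\ forall i u, `|q i u| <= C,
      forall i u v, `|q i u - q i v| <= L * `|u - v| &
      forall k u, D k -> q k u = \sum_(i | D i) Ps k i * \int[nu i]_s q i (u + s)].

Let cq C L q i u : harmonic C L q -> continuous (fun s => q i (u + s)).
Proof.
move=> [_ qL _]; apply: (@lipschitz_cont _ _ (L)) => s t.
by apply: le_trans (qL _ _ _) _; rewrite opprD addrACA subrr add0r.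
Qed.

Let mq C L q i u : harmonic C L q -> measurable_fun setT (fun s : R => q i (u + s)).
Proof. by move=> /cq-/(_ i u); exact: continuous_measurable. Qed.

Let iq C L q i u : harmonic C L q -> (nu i).-integrable setT (EFin \o (fun s => q i (u + s))).
Proof.
move=> h; apply: (@bounded_integrable _ _ _ _ _ C); first exact: mq h.
by case: h.
Qed.

Let harmonic_shift C L q a : harmonic C L q -> harmonic C L (fun i u => q i (u + a)).
Proof.
move=> [qC qL qe]; split=> //.
- by move=> i u v; apply: le_trans (qL _ _ _) _; rewrite opprD addrACA subrr addr0.
- move=> k u Dk; rewrite qe//; apply: eq_bigr => i Di; congr (_ * _).
  by apply: eq_Rintegral => s _; rewrite addrAC.
Qed.

Let harmonic_opp C L q : harmonic C L q -> harmonic C L (fun i u => - q i u).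
Proof.
move=> h; have [qC qL qe] := h; split=> //.
- by move=> i u; rewrite normrN.
- by move=> i u v; rewrite -opprD normrN.
- move=> k u Dk; rewrite qe// -sumrN; apply: eq_bigr => i Di; rewrite -mulrN; congr (_ * _).
  rewrite -mulN1r -RintegralZl//; last exact: iq h.
  by apply: eq_Rintegral => s _; rewrite mulN1r.
Qed.

Let harmonic_lim C L (q : nat -> I -> R -> R) :
  (forall n, harmonic C L (q n)) -> (forall i u, cvgn (fun n => q n i u)) ->
  harmonic C L (fun i u => lim (q n i u @[n --> \oo])).
Proof.
move=> hq cvq; set l := fun i u => _.
have ql i u : q n i u @[n --> \oo] --> (l i u : R) by exact: cvq.
have lC i u : `|l i u| <= C.
  by apply: (cvgn_norm_le (ql i u)) => n; case: (hq n).
have lL i u v : `|l i u - l i v| <= L * `|u - v|.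
  by apply: (cvgn_norm_le (cvgB (ql i u) (ql i v))) => n; case: (hq n) => _ hL _; exact: hL.
split=> // k u Dk; apply: (cvg_unique _ (ql k u)) => //.
rewrite (_ : (fun n => _) = fun n => \sum_(i | D i) Ps k i * \int[nu i]_s q n i (u + s)); last first.
  by apply/funext => n; case: (hq n) => _ _ ->.
apply: cvgn_sum => i Di; apply: cvgMr.
apply: (@bounded_convergence _ _ _ _ _ _ C) => //.
- by move=> n; exact: mq (hq n).
- apply: continuous_measurable; apply: (@lipschitz_cont _ _ (L)) => s t.
  by apply: le_trans (lL _ _ _) _; rewrite opprD addrACA subrr add0r.
- by move=> n x; case: (hq n).
- by apply: aeW => x; exact: ql.
Qed.

(* The set where an increment of a harmonic function attains its maximum [g] is stable under
   the backward steps of the chain. *)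
Definition back_closed (d : I -> R -> R) (g : R) := forall k i u s, D k -> D i ->
  0 < P i k -> supp (nu i) s -> d k u = g -> d i (u + s) = g.

(** Maximum principle. At a maximum, [g] is a convex combination of averages bounded by [g], so each
    average of positive weight equals [g]. Then [g - d i] is continuous and non-negative with
    integral zero, and vanishes on the support. *)
Let harmonic_back C L q a g : harmonic C L q ->
  (forall k u, D k -> q k (u + a) - q k u <= g) ->
  back_closed (fun k u => q k (u + a) - q k u) g.
Proof.
move=> h le_g k i u s Dk Di Pik ss dk.
have ha := harmonic_shift a h.
pose d i s := q i (u + s + a) - q i (u + s).
have id_ j : (nu j).-integrable setT (EFin \o d j).
  have := integrableB measurableT (iq j u ha) (iq j u h).
  by apply: eq_integrable.
have e1 : g = \sum_(j | D j) Ps k j * \int[nu j]_s d j s.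
  rewrite -dk; have [_ _ qe] := h; have [_ _ qae] := ha.
  rewrite qae// [X in _ - X = _]qe// -sumrB; apply: eq_bigr => j Dj.
  by rewrite -mulrBr -RintegralB//; [exact: iq ha|exact: iq h].
have ig j : (nu j).-integrable setT (EFin \o cst g) by exact: finite_measure_integrable_cst.
have id_le j : D j -> \int[nu j]_s d j s <= g.
  move=> Dj; rewrite -[leRHS]mulr1 -[X in _ <= _ * X](_ : fine (nu j setT) = 1); last by rewrite probability_setT.
  rewrite -Rintegral_cst//; exact: (le_Rintegral measurableT (id_ j) (ig j) (fun x _ => le_g _ _ Dj)).
have : \sum_(j | D j) Ps k j * (g - \int[nu j]_s d j s) = 0.
  rewrite (eq_bigr (fun j => Ps k j * g - Ps k j * \int[nu j]_s d j s)); last by move=> j _; rewrite mulrBr.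
  by rewrite sumrB -mulr_suml Ps_sum// mul1r -e1 subrr.
move=> /psumr_eq0P => /(_ _ i Di)/eqP; rewrite mulf_eq0 => /(_ _)/orP[].
- by move=> j Dj; rewrite mulr_ge0 ?Ps_ge0// subr_ge0 id_le.
- by rewrite !mulf_eq0 invr_eq0 !gt_eqF ?lam_gt0.
rewrite subr_eq0 => /eqP gi.
have cd : continuous (d i).
  have [_ qL _] := h; have [_ qaL _] := ha.
  apply: (@lipschitz_cont _ _ (L + L)) => v w.
  have -> : d i v - d i w = (q i (u + v + a) - q i (u + w + a)) -
      (q i (u + v) - q i (u + w)) by rewrite /d; ring.
  rewrite mulrDl; apply: le_trans (ler_normB _ _) _; apply: lerD.
    by apply: le_trans (qaL _ _ _) _; rewrite opprD addrACA subrr add0r.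
  apply: le_trans (qL _ _ _) _.
  by rewrite opprD addrACA subrr add0r.
have : g - d i s = 0.
  apply: (@supp_eq0 _ (nu i) (fun s => g - d i s) (`|g| + (C + C)) s) => //.
  - by move=> x; apply: cvgB; [exact: cvg_cst|exact: cd].
  - by move=> x; rewrite subr_ge0; exact: le_g.
  - move=> x; rewrite lerD ?ler_norm// (le_trans (ler_norm _))// normrN (le_trans (ler_normB _ _))// lerD//; by case: h.
  - by rewrite (RintegralB measurableT (ig i) (id_ i)) -gi (Rintegral_prob_cst (nu i) g) subrr.
by move=> /eqP; rewrite subr_eq0 eq_sym => /eqP.
Qed.

Let clos_D i k : clos_trans I (fun a b => 0 < P a b) i k -> D i -> D k.
Proof. by elim=> [a b ab /P_closed|a b c _ IH1 _ IH2 /IH1/IH2]//; exact. Qed.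

(** The displacement [r] adds one chosen support point per edge of the path. It is fixed before [d]
    and [g], so one shift serves all harmonic functions. *)
Let back_path i k : clos_trans I (fun a b => 0 < P a b) i k -> D i ->
  exists r, forall d g, back_closed d g -> forall u, d k u = g -> d i (u + r) = g.
Proof.
elim=> [a b ab Da|a b c ab IH1 _ IH2 Da].
  have [s ss] := supp_nonempty (nu a).
  exists (s) => d g bc u; apply: bc => //; exact: P_closed ab.
have [r1 H1] := IH1 Da; have [r2 H2] := IH2 (clos_D ab Da).
by exists (r2 + r1) => d g bc u /(H2 _ _ bc)/(H1 _ _ bc); rewrite addrA.
Qed.

(** All loops share [r] and differ only in the last sojourn [s], taken at [i0]. This is what turns
    differences of support points of [nu i0] into periods. *)
Let back_loop : exists r, forall d g, back_closed d g -> forall s, supp (nu i0) s ->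
  forall u, d i0 u = g -> d i0 (u + (r + s)) = g.
Proof.
have [i1 Di1 i01] := D_other.
have [b P0b] : exists b, 0 < P i0 b.
  have /clos_trans_t1n_iff := P_irr D_i0 Di1 i01.
  by case=> [y ? | y z ? _]; exists y.
have Db := P_closed D_i0 P0b.
have [r H] : exists r, forall d g, back_closed d g -> forall u, d i0 u = g -> d b (u + r) = g.
  have [->|bi0] := eqVneq b i0; first by exists 0 => d g _ u; rewrite addr0.
  exact: back_path (P_irr Db D_i0 bi0) Db.
exists r => d g bc s ss u /(H _ _ bc) h.
by rewrite addrA; exact: (bc b i0 _ s).
Qed.

(* The supremum of the increments becomes a maximum after passing to a limit of translates. *)
Let max_attained C L q a : harmonic C L q -> exists g q' k,
  [/\ harmonic C L q', D k, q' k (0 + a) - q' k 0 = g,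
    forall i u, D i -> q' i (u + a) - q' i u <= g &
    forall i u, D i -> q i (u + a) - q i u <= g].
Proof.
move=> h; have [qC qL _] := h.
pose f i u := q i (u + a) - q i u.
have fC i u : f i u <= C + C.
  by rewrite (le_trans (ler_norm _))// (le_trans (ler_normB _ _))// lerD.
have ub i : has_ubound (range (f i)) by exists (C + C) => _ [u _ <-].
pose F i := sup (range (f i)).
case: (@arg_maxP _ _ _ i0 D F D_i0) => k Dk Fk.
have fF i u : D i -> f i u <= F k.
  by move=> Di; apply: le_trans (Fk i Di); apply: ub_le_sup => //; exists u.
have /choice[s sF] (n : nat) : exists u, F k - n.+1%:R^-1 < f k u.
  have n0 : 0 < n.+1%:R^-1 :> R by rewrite invr_gt0.
  have hs : has_sup (range (f k)) by split=> //; exists (f k 0), 0.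
  by have [_ [u _ <-] ?] := sup_adherent n0 hs; exists u.
pose qs n i u := q i (u + s n).
have hqs n : harmonic C L (qs n) by exact: harmonic_shift.
have [phi phiS cphi] := @arzela_ascoli R I qs (fun=> C) (fun=> L)
  (fun n j u => let: And3 h1 _ _ := hqs n in h1 j u)
  (fun n j u v => let: And3 _ h1 _ := hqs n in h1 j u v).
have hl := harmonic_lim (fun n => hqs (phi n)) cphi.
set q' := (fun i u => _) in hl.
have cq' i u : qs (phi n) i u @[n --> \oo] --> (q' i u : R) by exact: cphi.
have cd i u : qs (phi n) i (u + a) - qs (phi n) i u @[n --> \oo] --> q' i (u + a) - q' i u by exact: cvgB.
have le_F i u : D i -> q' i (u + a) - q' i u <= F k.
  move=> Di; apply: (cvgn_le (cd i u)) => n.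
  by rewrite /qs addrAC; exact: fF.
exists (F k), q', k; split=> //.
apply/eqP; rewrite eq_le le_F//=.
apply/ler_addgt0Pr => e e0; rewrite -lerBlDr; apply: (ler_cvg_to (cvg_cst (F k - e)) (cd k 0)).
near=> n.
rewrite /qs !add0r [a + _]addrC.
have h1 : n.+1%:R^-1 < e.
  near: n; have [N _ HN] := near_infty_natSinv_lt (PosNum e0).
  by exists N => // n Nn; exact: HN.
have h2 : (phi n).+1%:R^-1 <= n.+1%:R^-1 :> R.
  by rewrite lef_pV2 ?posrE// ler_nat ltnS subsequence_ge.
have hs := sF (phi n); apply: ltW; apply: lt_trans hs.
by rewrite ltrD2l ltrN2 (le_lt_trans h2 h1).
Unshelve. all: by end_near. Qed.

(* If a maximal increment [g > 0] over [a] recurred at all multiples of [a], the function would grow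
   linearly. *)
Let period_le C L q a : (forall d g, back_closed d g -> forall u, d i0 u = g -> d i0 (u + a) = g) ->
  harmonic C L q -> forall k u, D k -> q k (u + a) <= q k u.
Proof.
move=> loop h k u Dk.
have [g [q' [k' [h' Dk' max' le' le_g]]]] := max_attained a h.
have bc := harmonic_back h' le'.
have [v dv] : exists v, q' i0 (v + a) - q' i0 v = g.
  have [<-|ik] := eqVneq k' i0; first by exists 0.
  have [|r H] := back_path (P_irr D_i0 Dk' _) D_i0; first by rewrite eq_sym.
  by exists (0 + r); exact: (H _ _ bc).
have dm m : q' i0 (v + a *+ m + a) - q' i0 (v + a *+ m) = g.
  elim: m => [|m IH]; first by rewrite mulr0n addr0.
  by rewrite mulrSr addrA; exact: (loop _ _ bc).
have tel m : q' i0 (v + a *+ m) - q' i0 v = g *+ m.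
  elim: m => [|m IH]; first by rewrite !mulr0n addr0 subrr.
  by rewrite mulrSr addrA [RHS]mulrSr -IH -(dm m); ring.
have g_le0 : g <= 0.
  rewrite leNgt; apply/negP => g0.
  have [qC _ _] := h'.
  have := ltr_bound ((C + C) / g); set m := Num.bound _; rewrite ltr_pdivrMr// mulr_natl -(tel m).
  by apply/negP; rewrite -leNgt (le_trans (ler_norm _))// (le_trans (ler_normB _ _))// lerD.
by rewrite -subr_le0 (le_trans (le_g _ _ Dk)).
Qed.

Let period C L q a : (forall d g, back_closed d g -> forall u, d i0 u = g -> d i0 (u + a) = g) ->
  harmonic C L q -> forall k u, D k -> q k (u + a) = q k u.
Proof.
move=> loop h k u Dk; apply/eqP; rewrite eq_le (period_le loop h)//= -lerN2.
exact: (period_le loop (harmonic_opp h)).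
Qed.

(* Differences of support points of [nu i0] are periods; without atoms they are arbitrarily small. *)
Let harmonic_cst C L q : harmonic C L q -> forall k u v, D k -> q k u = q k v.
Proof.
move=> h k u v Dk; have [_ qL _] := h.
have [r loop] := back_loop.
have pr s w : supp (nu i0) s -> q k (w + (r + s)) = q k w.
  by move=> ss; apply: (period _ h) => // d g bc; exact: loop.
apply/eqP; rewrite -subr_eq0 -normr_eq0 eq_le normr_ge0 andbT.
apply/ler_addgt0Pr => e e0; rewrite add0r.
have L0 : 0 < `|L| + 1 by rewrite ltr_wpDl.
have [s [t [ss st lt_st ts]]] := supp_close_points nu_i0 (divr_gt0 e0 L0).
pose p := t - s; have p0 : 0 < p by rewrite subr_gt0.
have pp w : q k (w + p) = q k w.
  by rewrite -(pr s (w + p) ss) -(pr t w st); congr (q k); rewrite /p; ring.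
have pn w (n : nat) : q k (w + p *+ n) = q k w.
  by elim: n => [|n IH]; rewrite ?mulr0n ?addr0// mulrSr addrA pp.
have pz w (z : int) : q k (w + p *~ z) = q k w.
  case: z => n; first exact: pn.
  by rewrite NegzE mulrNz -[LHS](pn _ n.+1) -pmulrn subrK.
(* Moving [v] by a multiple of the small period [p] brings it within [p] of [u], where the Lipschitz
   bound is enough. *)
rewrite -(pz v (Num.floor ((u - v) / p))); set z := Num.floor _.
apply: le_trans (qL _ _ _) _.
have := floor_itv ((u - v) / p); rewrite -/z intrD => /andP[z1 z2].
have : z%:~R * p <= u - v by rewrite -ler_pdivlMr.
have : u - v < (z%:~R + 1) * p by rewrite -ltr_pdivrMr.
rewrite mulrDl mul1r -[p *~ z]mulrzl => a1 a2.
apply: (@le_trans _ _ ((`|L| + 1) * `|u - (v + z%:~R * p)|)).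
  by rewrite ler_wpM2r// (le_trans (ler_norm _))// lerDl.
rewrite mulrC -ler_pdivlMr// ger0_norm; last lra.
move: ts; rewrite /p in a1 *; lra.
Qed.

Lemma choquet_deny (C L : R) (g : I -> R -> R) :
  (forall i u, `|g i u| <= C) -> (forall i u v, `|g i u - g i v| <= L * `|u - v|) ->
  (forall k u, D k -> g k u = \sum_(i | D i) P i k * \int[nu i]_s g i (u + s)) ->
  exists c, forall k u, D k -> g k u = lam k * c.
Proof.
move=> gC gL ge.
(* A crude common bound for all [(lam i)^-1]; it keeps [g / lam] bounded and Lipschitz. *)
pose m := \sum_(i | D i) (lam i)^-1.
pose q i u := if D i then g i u / lam i else 0.
have m0 i : D i -> (lam i)^-1 <= m.
  move=> Di; rewrite /m (bigD1 i)//= lerDl; apply: sumr_ge0 => j /andP[Dj _].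
  by rewrite invr_ge0 ltW// lam_gt0.
have C0 : 0 <= C by exact: le_trans (normr_ge0 _) (gC i0 0).
have m_ge0 : 0 <= m by apply: le_trans (m0 i0 D_i0); rewrite invr_ge0 ltW// lam_gt0.
have L0 : 0 <= L by have := le_trans (normr_ge0 _) (gL i0 1 0); rewrite subr0 normr1 mulr1.
have h : harmonic (C * m) (L * m) q.
  split.
  - move=> i u; rewrite /q; case: ifPn => Di; last by rewrite normr0 mulr_ge0.
    rewrite normrM ler_pM// ger0_norm ?m0// invr_ge0 ltW// lam_gt0//.
  - move=> i u v; rewrite /q; case: ifPn => Di; last by rewrite subrr normr0 !mulr_ge0.
    rewrite -mulrBl normrM mulrAC ler_pM// ger0_norm ?m0// invr_ge0 ltW// lam_gt0//.
  - move=> k u Dk; rewrite /q Dk ge// mulr_suml; apply: eq_bigr => i Di.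
    rewrite Di RintegralZr//; last first.
      apply: (@bounded_integrable _ _ _ _ _ C) => //.
      apply: continuous_measurable; apply: (@lipschitz_cont _ _ (L)) => s t.
      by apply: le_trans (gL _ _ _) _; rewrite opprD addrACA subrr add0r.
    rewrite /Ps; have := gt_eqF (lam_gt0 Di); have := gt_eqF (lam_gt0 Dk).
    by move=> n1 n2; field; rewrite n1 n2.
have qcst := harmonic_cst h.
(* Once [q] is constant in [u], it is harmonic for the finite reversed chain; its maximum spreads
   along the edges and irreducibility makes it constant in the state. *)
case: (@arg_maxP _ _ _ i0 D (fun i => q i 0) D_i0) => k Dk qk.
have {}qk i : D i -> q i 0 <= q k 0 by move=> Di; exact: qk.
exists (q k 0) => j u Dj.
suff : q j 0 = q k 0.
  move=> <-; rewrite -(qcst j u 0 Dj) /q Dj mulrC divfK// gt_eqF// lam_gt0//.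
have step a b : D a -> D b -> 0 < P a b -> q b 0 = q k 0 -> q a 0 = q k 0.
  move=> Da Db ab qb; apply/eqP; rewrite eq_le qk//= -subr_le0 subr_le0.
  have [_ _ qe] := h.
  have : \sum_(i | D i) Ps b i * (q k 0 - q i 0) = 0.
    rewrite (eq_bigr (fun j => Ps b j * q k 0 - Ps b j * q j 0)); last by move=> i _; rewrite mulrBr.
    rewrite sumrB -mulr_suml Ps_sum// mul1r -qb [X in X - _]qe//.
    apply/eqP; rewrite subr_eq0; apply/eqP; apply: eq_bigr => i Di; congr (_ * _).
    transitivity (\int[nu i]_s (cst (q i 0) s)).
      by apply: eq_Rintegral => s _; exact: qcst.
    exact: Rintegral_prob_cst.
  move=> /psumr_eq0P => /(_ _ a Da)/eqP; rewrite mulf_eq0 => /(_ _)/orP[].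
  - by move=> i Di; rewrite mulr_ge0 ?Ps_ge0// subr_ge0; exact: qk.
  - by rewrite !mulf_eq0 invr_eq0 !gt_eqF ?lam_gt0.
  - by rewrite subr_eq0 => /eqP ->.
have [->//|jk] := eqVneq j k.
have path a b : clos_trans I (fun a b => 0 < P a b) a b -> D a -> q b 0 = q k 0 -> q a 0 = q k 0.
  elim=> {a b} [a b ab Da|a b c ab IH1 _ IH2 Da] qb.
    exact: step Da (P_closed Da ab) ab qb.
  by apply: IH1 => //; apply: IH2 => //; exact: clos_D ab Da.
exact: path (P_irr Dj Dk jk) Dj _.
Qed.

End choquet_deny.

(** * The Markov property along the renewal filtration *)

Lemma adde_cancel {R : realDomainType} (a b c : \bar R) :
  a \is a fin_num -> (a + b = a + c -> b = c)%E.
Proof.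
move=> fa e; have := congr1 (fun z => z - a)%E e.
by rewrite ![(a + _)%E]addeC !addeK.
Qed.

Lemma measure_bigcupT {d} {T : measurableType d} {R : realType} (mu : {measure set T -> \bar R})
    (F : nat -> set T) : (forall k, measurable (F k)) -> trivIset setT F ->
  (mu (\bigcup_k F k) = \sum_(0 <= k <oo) mu (F k))%E.
Proof.
move=> mF tF; rewrite measure_bigcup//.
by apply: eq_eseriesl => k; rewrite in_setT.
Qed.

Section kernel_snd.
Context {R : realType} {dS : measure_display} {S : measurableType dS}
  (Q : R.-pker S ~> (S * R)%type).

(** The parameter space gains a real coordinate, ignored by the kernel, so that an integrand may
    depend on the elapsed time while the integral stays measurable in both. *)
Definition kernel_snd (q : R * S) : {measure set (S * R) -> \bar R} := Q q.2.

Let measurable_kernel_snd U : measurable U -> measurable_fun setT (kernel_snd ^~ U).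
Proof. by move=> mU; exact: (measurableT_comp (measurable_kernel Q U mU) measurable_snd). Qed.

HB.instance Definition _ := isKernel.Build _ _ _ _ _ kernel_snd measurable_kernel_snd.

Let kernel_snd_prob q : kernel_snd q setT = 1%E.
Proof. exact: prob_kernel. Qed.

HB.instance Definition _ := Kernel_isProbability.Build _ _ _ _ _ kernel_snd kernel_snd_prob.

Lemma measurable_kernel_integral (f : R * (S * R) -> \bar R) :
  (forall p, (0 <= f p)%E) -> measurable_fun setT f ->
  measurable_fun setT (fun q : R * S => \int[Q q.2]_p f (q.1, p))%E.
Proof.
move=> f0 mf.
apply: (measurable_fun_integral_sfinite_kernel (fun z : (R * S) * (S * R) => f (z.1.1, z.2)) kernel_snd) => //.
apply: measurableT_comp => //; apply/measurable_fun_pair; last exact: measurable_snd.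
exact: (measurableT_comp measurable_fst measurable_fst).
Qed.

End kernel_snd.

Section natural_filtration.
Context {R : realType} {dS : measure_display} {S : measurableType dS}
  {dO : measure_display} {O : measurableType dO}
  (Pr : probability O R) (Q : R.-pker S ~> (S * R)%type) (x : S)
  (Y : nat -> O -> S * R).
Hypothesis HY : is_MRchain Pr Q x Y.

Let mY n : measurable_fun setT (Y n).
Proof. by case: HY. Qed.

(** These are the events for which [is_MRchain] prescribes probabilities; they are stable under
    intersection, which is what Dynkin's lemma requires. *)
Definition cylinders (n : nat) : set (set O) :=
  [set \bigcap_(k in `I_n.+1) (Y k @^-1` B k) | B in [set B | forall k, measurable (B k)]].

Definition past (n : nat) : set (set O) := <<s cylinders n >>.

Definition adapted {d'} {T : measurableType d'} (n : nat) (f : O -> T) :=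
  forall C, measurable C -> past n (f @^-1` C).

Lemma cylinders_setI n : setI_closed (cylinders n).
Proof.
move=> _ _ [B mB <-] [C mC <-]; exists (fun k => B k `&` C k).
  by move=> k; exact: measurableI.
by rewrite -bigcapI; apply: eq_bigcapr => k _; rewrite preimage_setI.
Qed.

Lemma past_setT n : past n setT.
Proof.
apply: sub_sigma_algebra; exists (fun=> setT) => //.
by apply/seteqP; split=> // w _ k _.
Qed.

Lemma past_setC n D : past n D -> past n (~` D).
Proof. by move=> pD; rewrite -setTD; exact: sigma_algebraCD. Qed.

Lemma past_setI n D E : past n D -> past n E -> past n (D `&` E).
Proof.
move=> pD pE; rewrite -[D `&` E]setCK setCI -bigcup2E; apply: past_setC.
apply: sigma_algebra_bigcup => -[|[|i]] /=; rewrite /bigcup2 /=.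
- exact: past_setC.
- exact: past_setC.
- exact: sigma_algebra0.
Qed.

Lemma past_measurable n D : past n D -> measurable D.
Proof.
move: D; apply: smallest_sub.
  split=> [|A mA|F mF]; [exact: measurable0|by rewrite setTD; exact: measurableC|].
  exact: bigcup_measurable.
move=> _ [B mB <-]; apply: bigcap_measurable; first by exists 0%N.
by move=> k _; rewrite -[X in measurable X]setTI; exact: mY.
Qed.

Lemma past_cylinder n (B : nat -> set (S * R)) : (forall k, measurable (B k)) ->
  past n (\bigcap_(k in `I_n.+1) (Y k @^-1` B k)).
Proof. by move=> mB; apply: sub_sigma_algebra; exists B. Qed.

Lemma adapted_coordinate n k : (k <= n)%N -> adapted n (Y k).
Proof.
move=> kn C mC.
have -> : Y k @^-1` C = \bigcap_(j in `I_n.+1) (Y j @^-1` (if j == k then C else setT)).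
  apply/seteqP; split => w /=.
    by move=> Ckw j _; case: eqP => // ->.
  by move=> /(_ k) /=; rewrite ltnS eqxx; exact.
by apply: past_cylinder => j; case: ifP.
Qed.

Lemma adapted_comp d1 d2 (T1 : measurableType d1) (T2 : measurableType d2) n
    (f : O -> T1) (g : T1 -> T2) :
  measurable_fun setT g -> adapted n f -> adapted n (g \o f).
Proof.
move=> mg af C mC; rewrite comp_preimage; apply: af.
by rewrite -[X in measurable X]setTI; exact: mg.
Qed.

Lemma adapted_pair d1 d2 (T1 : measurableType d1) (T2 : measurableType d2) n
    (f : O -> T1) (g : O -> T2) :
  adapted n f -> adapted n g -> adapted n (fun w => (f w, g w)).
Proof.
move=> af ag C; rewrite measurable_prod_measurableType; move: C; apply: smallest_sub.
  split=> [|A mA|F mF].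
  - by rewrite /= preimage_set0; exact: sigma_algebra0.
  - by rewrite /= setTD preimage_setC; exact: past_setC.
  - by rewrite /= preimage_bigcup; exact: sigma_algebra_bigcup.
move=> _ [A mA] [B mB] <- /=.
have -> : (fun w => (f w, g w)) @^-1` (A `*` B) = f @^-1` A `&` g @^-1` B by [].
by apply: past_setI; [exact: af|exact: ag].
Qed.

Lemma adapted_sumT n : adapted n (sumT Y n).
Proof.
suff H j : (j <= n.+1)%N -> adapted n (fun w => \sum_(m < j) (Y m w).2) by exact: H.
elim: j => [_|j IH jn].
  rewrite (_ : (fun w => _) = cst 0); last by apply/funext => w; rewrite big_ord0.
  by move=> C mC; rewrite preimage_cst; case: ifP => _; [exact: past_setT|exact: sigma_algebra0].
have -> : (fun w => \sum_(m < j.+1) (Y m w).2) =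
    (fun p : R * (S * R) => p.1 + p.2.2) \o (fun w => (\sum_(m < j) (Y m w).2, Y j w)).
  by apply/funext => w; rewrite /= big_ord_recr.
apply: adapted_comp.
  apply: measurable_funD; first exact: measurable_fst.
  exact: (measurableT_comp measurable_snd measurable_snd).
by apply: adapted_pair; [exact: IH (ltnW jn)|exact: adapted_coordinate].
Qed.

Lemma adapted_measurable d' (T : measurableType d') n (f : O -> T) :
  adapted n f -> measurable_fun setT f.
Proof. by move=> af _ C mC; rewrite setTI; exact: past_measurable (af _ mC). Qed.

Lemma measurable_sumT n : measurable_fun setT (sumT Y n).
Proof. exact: adapted_measurable (adapted_sumT (n := n)). Qed.

Let mQ n B : measurable B -> measurable_fun setT (fun w => Q (Y n w).1 B).
Proof.
move=> mB; apply: (measurableT_comp (measurable_kernel Q B mB)).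
exact: measurableT_comp measurable_fst (mY n).
Qed.

Local Open Scope ereal_scope.

(** For cylinders this is [is_MRchain]. Both sides are finite measures in [D], so the identity
    extends to the generated sigma-algebra. *)
Lemma markov_set n D B : past n D -> measurable B ->
  Pr (D `&` Y n.+1 @^-1` B) = \int[Pr]_(w in D) Q (Y n w).1 B.
Proof.
move=> + mB.
have mYB : measurable (Y n.+1 @^-1` B) by rewrite -[X in measurable X]setTI; exact: mY.
pose L := [set D | measurable D /\ Pr (D `&` Y n.+1 @^-1` B) = \int[Pr]_(w in D) Q (Y n w).1 B].
have cylL : cylinders n `<=` L.
  move=> _ [C mC <-]; split.
    by apply: past_measurable; exact: past_cylinder.
  case: HY => _ _ /(_ n (fun k => if (k <= n)%N then C k else B)).
  have -> : \bigcap_(k in `I_n.+2) Y k @^-1` (if (k <= n)%N then C k else B) =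
      (\bigcap_(k in `I_n.+1) Y k @^-1` C k) `&` Y n.+1 @^-1` B.
    apply/seteqP; split=> w /=.
      move=> H; split; last by have /= := H n.+1 (ltnSn _); rewrite ltnn.
      by move=> k /= kn; have /= := H k (ltnW kn); rewrite -ltnS kn.
    move=> [H HB] k /=; rewrite ltnS leq_eqVlt => /predU1P[->|kn]; first by rewrite ltnn.
    by rewrite -ltnS kn; exact: H.
  have -> : \bigcap_(k in `I_n.+1) Y k @^-1` (if (k <= n)%N then C k else B) =
      \bigcap_(k in `I_n.+1) Y k @^-1` C k.
    by apply: eq_bigcapr => k /=; rewrite ltnS => ->.
  by rewrite ltnn; apply => k; case: ifP.
have LT : L setT.
  by apply: cylL; exists (fun=> setT) => //; apply/seteqP; split=> // w _ k _.
have dL : dynkin L.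
  split=> //.
  - move=> A [mA eA]; have [_ eT] := LT; split; first exact: measurableC.
    have mAC := measurableC mA.
    have h1 : Pr (A `&` Y n.+1 @^-1` B) + Pr (~` A `&` Y n.+1 @^-1` B) = Pr (Y n.+1 @^-1` B).
      rewrite -measureU; [|exact: measurableI|exact: measurableI|].
        by rewrite -setIUl setUv setTI.
      by rewrite setIACA setICr set0I.
    have h2 : \int[Pr]_(w in A) Q (Y n w).1 B + \int[Pr]_(w in ~` A) Q (Y n w).1 B =
        \int[Pr]_w Q (Y n w).1 B.
      rewrite -ge0_integral_setU//; first by rewrite setUv.
        by rewrite setUv; exact: mQ.
      by apply/disj_setPCl.
    have fin : Pr (A `&` Y n.+1 @^-1` B) \is a fin_num by rewrite fin_num_measure//; exact: measurableI.
    apply: (adde_cancel fin).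
    by rewrite h1 [in RHS]eA h2 -eT setTI.
  - move=> F tF HF; split; first by apply: bigcup_measurable => k _; exact: (HF k).1.
    rewrite setI_bigcupl measure_bigcupT//; last 2 first.
    + by move=> k; apply: measurableI => //; exact: (HF k).1.
    + by apply: trivIset_setIr.
    rewrite ge0_integral_bigcup//.
    + by apply: eq_eseriesr => k _; exact: (HF k).2.
    + by move=> k; exact: (HF k).1.
    + by apply: measurable_funTS; exact: mQ.
rewrite /past -(setI_closed_g_dynkin_g_sigma_algebra (@cylinders_setI n)).
have : <<d cylinders n >> `<=` L by apply: smallest_sub.
by move=> sub /sub[].
Qed.

Import HBNNSimple.

Section joint.
Context (n : nat) (D : set O) (Z : O -> R).
Hypotheses (pD : past n D) (aZ : adapted n Z).

Let mD : measurable D. Proof. exact: past_measurable pD. Qed.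
Let mZ : measurable_fun setT Z. Proof. exact: adapted_measurable aZ. Qed.
Let mZY : measurable_fun setT (fun w => (Z w, Y n.+1 w)).
Proof. exact/measurable_fun_pair. Qed.
Let mX : measurable_fun setT (fun w => (Y n w).1).
Proof. exact: measurableT_comp measurable_fst (mY n). Qed.

Let mK (f : R * (S * R) -> \bar R) : (forall p, 0 <= f p) -> measurable_fun setT f ->
  measurable_fun setT (fun w => \int[Q (Y n w).1]_p f (Z w, p)).
Proof.
move=> f0 mf.
have mZX : measurable_fun setT (fun w => (Z w, (Y n w).1)) by exact/measurable_fun_pair.
exact: (measurableT_comp (measurable_kernel_integral Q f0 mf) mZX).
Qed.

Let integral_section (E : set (R * (S * R))) w : measurable E ->
  \int[Q (Y n w).1]_p (\1_E (Z w, p))%:E = Q (Y n w).1 (xsection E (Z w)).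
Proof.
move=> mE; rewrite -[in RHS](setIT (xsection E (Z w))) -integral_indic//; last exact: measurable_xsection.
apply: eq_integral => p _; rewrite !indicE.
by rewrite mem_xsection.
Qed.

Let mXS E : measurable E -> measurable_fun setT (fun w => Q (Y n w).1 (xsection E (Z w))).
Proof.
move=> mE; apply: (eq_measurable_fun (fun w => \int[Q (Y n w).1]_p (\1_E (Z w, p))%:E)).
  by move=> w _; rewrite integral_section.
by apply: (mK (f := fun p => (\1_E p)%:E)) => //; exact/measurable_EFinP/measurable_indic.
Qed.

(** On a rectangle the condition on [Z] can be absorbed into the past event, which reduces to
    [markov_set]; a second Dynkin argument reaches all sets of the product. *)
Lemma markov_section E : measurable E ->
  Pr (D `&` (fun w => (Z w, Y n.+1 w)) @^-1` E) =
  \int[Pr]_(w in D) Q (Y n w).1 (xsection E (Z w)).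
Proof.
have mpre (F : set (R * (S * R))) : measurable F -> measurable ((fun w => (Z w, Y n.+1 w)) @^-1` F).
  by move=> mF; rewrite -[X in measurable X]setTI; exact: mZY.
have rect A B : measurable A -> measurable B ->
    Pr (D `&` (fun w => (Z w, Y n.+1 w)) @^-1` (A `*` B)) =
    \int[Pr]_(w in D) Q (Y n w).1 (xsection (A `*` B) (Z w)).
  move=> mA mB.
  have -> : D `&` (fun w => (Z w, Y n.+1 w)) @^-1` (A `*` B) =
    (D `&` Z @^-1` A) `&` Y n.+1 @^-1` B by rewrite -setIA.
  rewrite markov_set//; last by apply: past_setI => //; exact: aZ.
  rewrite integral_mkcondr; apply: eq_integral => w _.
  rewrite /restrict; case: ifPn => h; last first.
    by rewrite notin_xsectionX ?measure0//; move: h; rewrite !notin_setE.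
  by rewrite in_xsectionX//; move: h; rewrite !inE.
have eT := rect _ _ measurableT measurableT; rewrite setXTT in eT.
move=> mE; have : <<s [set A `*` B | A in measurable & B in measurable] >> E.
  by rewrite -measurable_prod_measurableType.
move: E mE => E _; move: E; apply: (@dynkin_induction _ _ _ _ (measurable_prod_measurableType R (S * R)%type)) => //.
- move=> _ _ [A mA [B mB <-]] [A' mA' [B' mB' <-]].
  exists (A `&` A'); first exact: measurableI.
  by exists (B `&` B'); [exact: measurableI|rewrite setXI].
- by move=> _ [A mA [B mB <-]]; exact: rect.
- move=> E mE eE; have mEC := measurableC mE.
  have h1 : Pr (D `&` (fun w => (Z w, Y n.+1 w)) @^-1` E) +
      Pr (D `&` (fun w => (Z w, Y n.+1 w)) @^-1` (~` E)) = Pr (D `&` (fun w => (Z w, Y n.+1 w)) @^-1` setT).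
    rewrite -measureU.
    + by rewrite -setIUr -preimage_setU setUv.
    + by apply: measurableI => //; exact: mpre.
    + by apply: measurableI => //; exact: mpre.
    + by apply/seteqP; split=> w //= -[[_ a] [_ b]]; exact: b.
  have h2 : \int[Pr]_(w in D) Q (Y n w).1 (xsection E (Z w)) +
      \int[Pr]_(w in D) Q (Y n w).1 (xsection (~` E) (Z w)) =
      \int[Pr]_(w in D) Q (Y n w).1 (xsection setT (Z w)).
    rewrite -ge0_integralD//; last 2 first.
    + by apply: measurable_funTS; exact: mXS.
    + by apply: measurable_funTS; exact: mXS.
    apply: eq_integral => w _; rewrite -measureU.
    + by congr (Q _ _); apply/seteqP; split=> p; rewrite /xsection/= !inE//= => _; exact: EM.
    + exact: measurable_xsection.
    + exact: measurable_xsection.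
    + by apply/seteqP; split=> p //; rewrite /xsection/= !inE/= => -[].
  have fin : Pr (D `&` (fun w => (Z w, Y n.+1 w)) @^-1` E) \is a fin_num.
    by rewrite fin_num_measure//; apply: measurableI => //; exact: mpre.
  by apply: (adde_cancel fin); rewrite h1 [in RHS]eE h2 -eT.
- move=> F mF tF eF.
  rewrite preimage_bigcup setI_bigcupr measure_bigcupT//; last 2 first.
  + by move=> k; apply: measurableI => //; exact: mpre.
  + move=> i j _ _ [w [[_ a] [_ b]]]; apply: (tF i j I I).
    by exists (Z w, Y n.+1 w).
  transitivity (\int[Pr]_(w in D) \sum_(0 <= k <oo) Q (Y n w).1 (xsection (F k) (Z w))).
    rewrite integral_nneseries//; first by apply: eq_eseriesr => k _; exact: eF.
    by move=> k; apply: measurable_funTS; exact: mXS.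
  apply: eq_integral => w _; rewrite xsection_bigcup measure_bigcupT//.
  + by move=> k; exact: measurable_xsection.
  + exact: trivIset_xsection.
Qed.

(** Simple functions and monotone convergence on both sides. In the applications [Z] is the elapsed
    time [sumT Y n], which is adapted but not a function of the last step. *)
Lemma markov_integral (f : R * (S * R) -> \bar R) : (forall p, 0 <= f p) -> measurable_fun setT f ->
  \int[Pr]_(w in D) f (Z w, Y n.+1 w) = \int[Pr]_(w in D) \int[Q (Y n w).1]_p f (Z w, p).
Proof.
move=> f0 mf.
pose k_ := nnsfun_approx measurableT mf.
have fk q : f q = limn (fun m => (k_ m q)%:E).
  by apply/esym/cvg_lim => //; exact: (cvg_nnsfun_approx measurableT mf (fun x _ => f0 x)).
have ndk q : {homo (fun m => (k_ m q)%:E) : a b / (a <= b)%N >-> a <= b}.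
  by move=> a b ab; rewrite lee_fin; exact/lefP/nd_nnsfun_approx.
have mkY m : measurable_fun setT (fun w => (k_ m (Z w, Y n.+1 w))%:E).
  by apply/measurable_EFinP; exact: (measurableT_comp _ mZY).
have mkQ m w : measurable_fun setT (fun p => (k_ m (Z w, p))%:E).
  by apply/measurable_EFinP/measurableT_comp.
have mkK m : measurable_fun setT (fun w => \int[Q (Y n w).1]_p (k_ m (Z w, p))%:E).
  by apply: (mK (f := fun p => (k_ m p)%:E)) => [p|]; [rewrite lee_fin|exact/measurable_EFinP].
transitivity (limn (fun m => \int[Pr]_(w in D) (k_ m (Z w, Y n.+1 w))%:E)).
  rewrite -monotone_convergence//.
  - by apply: eq_integral => w _; exact: fk.
  - by move=> m; apply: measurable_funTS.
  - by move=> m w _; rewrite lee_fin.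
transitivity (limn (fun m => \int[Pr]_(w in D) \int[Q (Y n w).1]_p (k_ m (Z w, p))%:E)); last first.
  rewrite -monotone_convergence//.
  - apply: eq_integral => w _; rewrite -monotone_convergence//.
    + by apply: eq_integral => p _; rewrite -fk.
    + by move=> m p _; rewrite lee_fin.
  - by move=> m; apply: measurable_funTS.
  - by move=> m w _; apply: integral_ge0 => p _; rewrite lee_fin.
  - move=> w _ a b ab; apply: ge0_le_integral => //.
    + by move=> p _; rewrite lee_fin.
    + by move=> p _; exact: ndk.
congr (lim (_ @ \oo)); apply/funext => m.
pose t r (q : R * (S * R)) : \bar R := (r * \1_(k_ m @^-1` [set r]) q)%:E.
have kE q : (k_ m q)%:E = \sum_(r \in range (k_ m)) t r q.
  by rewrite fimfunE -fsumEFin.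
have t0 r q : 0 <= t r q by rewrite /t EFinM; exact: nnfun_muleindic_ge0.
have mt r : measurable_fun setT (t r).
  by apply/measurable_EFinP; apply: measurable_funM => //; exact: measurable_indic.
have mtK r : measurable_fun setT (fun w => \int[Q (Y n w).1]_p t r (Z w, p)) by exact: mK.
transitivity (\sum_(r \in range (k_ m)) \int[Pr]_(w in D) t r (Z w, Y n.+1 w)).
  rewrite -ge0_integral_fsum//.
  - by apply: eq_integral => w _; exact: kE.
  - by move=> r; apply: measurable_funTS; exact: (measurableT_comp (mt r) mZY).
transitivity (\sum_(r \in range (k_ m)) \int[Pr]_(w in D) \int[Q (Y n w).1]_p t r (Z w, p)); last first.
  rewrite -ge0_integral_fsum//.
  - apply: eq_integral => w _; rewrite -ge0_integral_fsum//.
    + by apply: eq_integral => p _; rewrite -kE.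
    + by move=> r; apply: measurableT_comp.
  - by move=> r; apply: measurable_funTS.
  - by move=> r w _; apply: integral_ge0.
apply: eq_fsbigr => r _; have [r0|r0] := ltP r 0%R.
  have z q : t r q = 0 by rewrite /t preimage_nnfun0// indicE in_set0 mulr0.
  by rewrite !integral0_eq// => w _; rewrite integral0_eq.
have mE : measurable (k_ m @^-1` [set r]) by [].
rewrite /t; under eq_integral do rewrite EFinM.
rewrite ge0_integralZl//; last first.
  by apply: measurable_funTS; apply/measurable_EFinP; apply: (measurableT_comp _ mZY); exact: measurable_indic.
under [RHS]eq_integral => w _.
  under eq_integral do rewrite EFinM.
  rewrite ge0_integralZl//; last by apply/measurable_EFinP/measurableT_comp => //; exact: measurable_indic.
  rewrite integral_section//; over.
rewrite ge0_integralZl//; last by apply: measurable_funTS; exact: mXS.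
congr (_ * _); rewrite -markov_section//.
rewrite [in RHS]setIC -integral_indic//.
by rewrite -[X in measurable X]setTI; exact: mZY.
Qed.

End joint.

End natural_filtration.

(** * The killed renewal measure *)

Lemma measurable_TD {R : realType} {dS : measure_display} {S : measurableType dS} (A : set S) :
  measurable A -> measurable (TD A : set (S * R)).
Proof. by move=> mA; apply: measurableX. Qed.

Lemma integral_prob_cst {d} {T : measurableType d} {R : realType} (P : probability T R) (c : \bar R) :
  (\int[P]_x c = c)%E.
Proof.
rewrite (integral_cst P measurableT c) -[RHS]mule1; congr (_ * _)%E.
exact: probability_setT.
Qed.

Lemma measurable_fun_mem {d} {T : measurableType d} (B : set T) : measurable B ->
  measurable_fun setT (fun t => t \in B).
Proof.
move=> mB; apply: (measurable_fun_bool true); rewrite setTI.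
by have -> : (fun t => t \in B) @^-1` [set true] = B by apply/seteqP; split=> t /=; [move/set_mem|move/mem_set].
Qed.

Section renewal.
Context {R : realType} {dS : measure_display} {S : measurableType dS}
  {dO : measure_display} {O : measurableType dO}
  (Pr : probability O R) (Q : R.-pker S ~> (S * R)%type) (x : S)
  (Y : nat -> O -> S * R) (A : set S).
Hypothesis HY : is_MRchain Pr Q x Y.
Hypothesis mA : measurable A.
Hypothesis Ax : A x.

Let mY n : measurable_fun setT (Y n).
Proof. by case: HY. Qed.

Let mTDA : measurable (TD A : set (S * R)). Proof. exact: measurable_TD. Qed.

(** [TD A] also requires non-negative sojourns, so that renewal times are ordered along every path
    that is still alive. *)
Definition alive (n : nat) : set O := \bigcap_(k in `I_n.+1) (Y k @^-1` TD A).

Definition state (n : nat) (w : O) : S * R := ((Y n w).1, sumT Y n w).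

Local Open Scope ereal_scope.

Definition renewal_step (f : S * R -> \bar R) (q : S * R) : \bar R :=
  \int[Q q.1]_(p in TD A) f (p.1, (q.2 + p.2)%R).

(** Integral of [f] against the space-time Green measure of the chain killed outside [A]. *)
Definition renewal_sum (f : S * R -> \bar R) : \bar R :=
  \sum_(0 <= n <oo) \int[Pr]_(w in alive n) f (state n w).

Lemma past_alive n : past Y n (alive n).
Proof. exact: past_cylinder. Qed.

Lemma measurable_alive n : measurable (alive n).
Proof. exact: (past_measurable HY (past_alive (n:=n))). Qed.

Lemma alive0 : alive 0%N = setT.
Proof.
apply/seteqP; split=> // w _ k /=; rewrite ltnS leqn0 => /eqP ->.
by case: HY => _ -> _; split=> //=; rewrite in_itv/= lexx.
Qed.

Lemma aliveS n : alive n.+1 = alive n `&` Y n.+1 @^-1` TD A.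
Proof.
apply/seteqP; split=> w /=.
  by move=> H; split; [move=> k /= kn; apply: H => /=; exact: ltnW|exact: (H n.+1 (ltnSn _))].
by move=> [H HA] k /=; rewrite ltnS leq_eqVlt => /predU1P[->//|]; exact: H.
Qed.

Lemma sumTS n w : sumT Y n.+1 w = (sumT Y n w + (Y n.+1 w).2)%R.
Proof. by rewrite /sumT big_ord_recr. Qed.

Lemma state0 w : state 0%N w = (x, 0%R).
Proof. by case: HY => _ Y0 _; rewrite /state /sumT big_ord_recr big_ord0 /= Y0/= add0r. Qed.

Lemma alive_state n w : alive n w -> A (state n w).1 /\ (0 <= (state n w).2)%R.
Proof.
move=> al; split; first by have [] := al n (ltnSn n).
rewrite /state/= /sumT; apply: sumr_ge0 => k _.
by have [_] := al k (ltn_ord k); rewrite /= in_itv/= andbT.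
Qed.

Lemma measurable_state n : measurable_fun setT (state n).
Proof.
apply/measurable_fun_pair; first exact: measurableT_comp measurable_fst (mY n).
exact: measurable_sumT HY n.
Qed.

Let mfstate (f : S * R -> \bar R) n : measurable_fun setT f -> measurable_fun (alive n) (fun w => f (state n w)).
Proof.
by move=> mf; apply: measurable_funTS; exact: measurableT_comp mf (measurable_state n).
Qed.

Lemma measurable_renewal_step f : (forall q, 0 <= f q) -> measurable_fun setT f ->
  measurable_fun setT (renewal_step f).
Proof.
move=> f0 mf.
pose g (p : R * (S * R)) := if p.2 \in TD A then f (p.2.1, (p.1 + p.2.2)%R) else 0.
have mg : measurable_fun setT g.
  apply: measurable_fun_if => //.
  - exact: (measurableT_comp (measurable_fun_mem mTDA) measurable_snd).
  - apply: measurable_funTS; apply: measurableT_comp => //; apply/measurable_fun_pair.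
      exact: measurableT_comp measurable_fst measurable_snd.
    apply: measurable_funD; first exact: measurable_fst.
    exact: measurableT_comp measurable_snd measurable_snd.
have g0 p : 0 <= g p by rewrite /g; case: ifP.
have -> : renewal_step f = (fun q => \int[Q q.2]_p g (q.1, p)) \o (fun q => (q.2, q.1)).
  apply/funext => q; rewrite /renewal_step integral_mkcond/=.
  by apply: eq_integral => p _; rewrite /g /restrict /=.
apply: measurableT_comp; first exact: measurable_kernel_integral.
by apply/measurable_fun_pair; [exact: measurable_snd|exact: measurable_fst].
Qed.

Lemma renewal_step_ge0 f : (forall q, 0 <= f q) -> forall q, 0 <= renewal_step f q.
Proof. by move=> f0 q; exact: integral_ge0. Qed.

Lemma renewal_stepP n f : (forall q, 0 <= f q) -> measurable_fun setT f ->
  \int[Pr]_(w in alive n.+1) f (state n.+1 w) =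
  \int[Pr]_(w in alive n) renewal_step f (state n w).
Proof.
move=> f0 mf.
pose g (p : R * (S * R)) := if p.2 \in TD A then f (p.2.1, (p.1 + p.2.2)%R) else 0.
have mg : measurable_fun setT g.
  apply: measurable_fun_if => //.
  - exact: (measurableT_comp (measurable_fun_mem mTDA) measurable_snd).
  - apply: measurable_funTS; apply: measurableT_comp => //; apply/measurable_fun_pair.
      exact: measurableT_comp measurable_fst measurable_snd.
    apply: measurable_funD; first exact: measurable_fst.
    exact: measurableT_comp measurable_snd measurable_snd.
have g0 p : 0 <= g p by rewrite /g; case: ifP.
rewrite aliveS integral_mkcondr.
transitivity (\int[Pr]_(w in alive n) g (sumT Y n w, Y n.+1 w)).
  apply: eq_integral => w _; rewrite /g /restrict/= /state sumTS.
  have -> : (w \in Y n.+1 @^-1` TD A) = (Y n.+1 w \in TD A) by apply/idP/idP; rewrite !inE.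
  by [].
rewrite (markov_integral HY (past_alive (n:=n)) (@adapted_sumT _ _ _ _ _ Y n) g0 mg).
apply: eq_integral => w _; rewrite /renewal_step [RHS]integral_mkcond/=.
by apply: eq_integral => p _; rewrite /g /restrict /=.
Qed.

Lemma renewal_sum_ge0 f : (forall q, 0 <= f q) -> 0 <= renewal_sum f.
Proof. by move=> f0; apply: nneseries_ge0 => n _ _; exact: integral_ge0. Qed.

Lemma renewal_equation f : (forall q, 0 <= f q) -> measurable_fun setT f ->
  renewal_sum f = f (x, 0%R) + renewal_sum (renewal_step f).
Proof.
move=> f0 mf; rewrite /renewal_sum nneseries_recl//; last by move=> n _; exact: integral_ge0.
congr (_ + _).
  rewrite alive0; transitivity (\int[Pr]_w cst (f (x, 0%R)) w).
    by apply: eq_integral => w _; rewrite state0.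
  exact: integral_prob_cst.
rewrite -(@nneseries_addn R _ 1%N); last by move=> n; exact: integral_ge0.
by apply: eq_eseriesr => n _; rewrite addn1 renewal_stepP.
Qed.

Lemma le_renewal_sum (f g : S * R -> \bar R) : (forall q, 0 <= f q) -> measurable_fun setT f ->
  measurable_fun setT g ->
  (forall y (s : R), A y -> (0 <= s)%R -> f (y, s) <= g (y, s)) -> renewal_sum f <= renewal_sum g.
Proof.
move=> f0 mf mg fg; apply: lee_nneseries => n _.
  by move=> _; exact: integral_ge0.
apply: ge0_le_integral => //.
- exact: measurable_alive.
- exact: mfstate.
- exact: mfstate.
- by move=> w /alive_state[? ?]; exact: fg.
Qed.

Lemma renewal_sumD f g : (forall q, 0 <= f q) -> measurable_fun setT f ->
  (forall q, 0 <= g q) -> measurable_fun setT g ->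
  renewal_sum (fun q => f q + g q) = renewal_sum f + renewal_sum g.
Proof.
move=> f0 mf g0 mg; rewrite /renewal_sum -nneseriesD; last 2 first.
- by move=> n _ _; exact: integral_ge0.
- by move=> n _ _; exact: integral_ge0.
apply: eq_eseriesr => n _; rewrite ge0_integralD//.
- exact: measurable_alive.
- exact: mfstate.
- exact: mfstate.
Qed.

Lemma renewal_sumZl (c : R) f : (0 <= c)%R -> (forall q, 0 <= f q) -> measurable_fun setT f ->
  renewal_sum (fun q => c%:E * f q) = c%:E * renewal_sum f.
Proof.
move=> c0 f0 mf; rewrite /renewal_sum -nneseriesZl; last by move=> n _; exact: integral_ge0.
apply: eq_eseriesr => n _; rewrite ge0_integralZl//.
- exact: measurable_alive.
- exact: mfstate.
Qed.

Lemma renewal_sum_sum (I : Type) (r : seq I) (P : pred I) (f : I -> S * R -> \bar R) :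
  (forall i q, 0 <= f i q) -> (forall i, measurable_fun setT (f i)) ->
  renewal_sum (fun q => \sum_(i <- r | P i) f i q) = \sum_(i <- r | P i) renewal_sum (f i).
Proof.
move=> f0 mf; elim: r => [|i r IH].
  rewrite big_nil /renewal_sum eseries0// => n _ _.
  by rewrite integral0_eq// => w _; rewrite big_nil.
rewrite big_cons -IH; case: ifPn => Pi.
  rewrite -renewal_sumD//.
  - by congr renewal_sum; apply/funext => q; rewrite big_cons Pi.
  - by move=> q; exact: sume_ge0.
  - apply: (eq_measurable_fun (fun q => \sum_(i <- [seq i <- r | P i]) f i q)).
      by move=> q _; rewrite big_filter.
    exact: emeasurable_sum.
by congr renewal_sum; apply/funext => q; rewrite big_cons (negbTE Pi).
Qed.

Lemma renewal_sum_fubini (nu : probability R R) (f : (S * R) * R -> \bar R) :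
  (forall z, 0 <= f z) -> measurable_fun setT f ->
  renewal_sum (fun q => \int[nu]_r f (q, r)) = \int[nu]_r renewal_sum (fun q => f (q, r)).
Proof.
move=> f0 mf.
pose F n (z : O * R) := if z.1 \in alive n then f (state n z.1, z.2) else 0.
have F0 n z : 0 <= F n z by rewrite /F; case: ifP.
have mF n : measurable_fun setT (F n).
  apply: measurable_fun_if => //.
    exact: (measurableT_comp (measurable_fun_mem (measurable_alive n)) measurable_fst).
  apply: measurable_funTS; apply: measurableT_comp => //; apply/measurable_fun_pair => //.
  exact: (measurableT_comp (measurable_state n) measurable_fst).
have FE n r : \int[Pr]_(w in alive n) f (state n w, r) = \int[Pr]_w F n (w, r).
  by rewrite integral_mkcond; apply: eq_integral.
rewrite /renewal_sum integral_nneseries//; last 2 first.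
- move=> n; rewrite (_ : (fun r => _) = (fun r => \int[Pr]_w F n (w, r))).
    exact: measurable_fun_fubini_tonelli_G.
  by apply/funext => r; exact: FE.
- by move=> n r _; exact: integral_ge0.
apply: eq_eseriesr => n _.
transitivity (\int[Pr]_w \int[nu]_r F n (w, r)).
  rewrite integral_mkcond; apply: eq_integral => w _; rewrite /restrict /F/=.
  by case: ifP => //; rewrite integral0.
rewrite fubini_tonelli//.
by apply: eq_integral => r _; rewrite FE.
Qed.

(** Supermartingale argument: the partial sums of [h] plus the expected remaining [V] never exceed
    the initial value of [V], by telescoping along [renewal_stepP]. *)
Lemma renewal_supersolution h V : (forall q, 0 <= h q) -> measurable_fun setT h ->
  (forall q, 0 <= V q) -> measurable_fun setT V ->
  (forall y (s : R), A y -> h (y, s) + renewal_step V (y, s) <= V (y, s)) ->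
  renewal_sum h <= V (x, 0%R).
Proof.
move=> h0 mh V0 mV hV.
have H N : \sum_(0 <= n < N) \int[Pr]_(w in alive n) h (state n w) +
    \int[Pr]_(w in alive N) V (state N w) <= V (x, 0%R).
  elim: N => [|N IH].
    rewrite big_geq// add0e alive0 (_ : \int[Pr]__ _ = \int[Pr]_w cst (V (x, 0%R)) w).
      by rewrite integral_prob_cst.
    by apply: eq_integral => w _; rewrite state0.
  rewrite big_nat_recr//= renewal_stepP// -addeA; apply: le_trans IH.
  have mal := measurable_alive N.
  have m1 := mfstate (n := N) mh; have m2 := mfstate (n := N) (measurable_renewal_step V0 mV).
  have r0 := renewal_step_ge0 V0.
  rewrite leeD2l// -ge0_integralD//; apply: ge0_le_integral => //.
  - by move=> w _; rewrite adde_ge0.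
  - exact: emeasurable_funD.
  - exact: mfstate.
  - by move=> w /alive_state[Aw _]; rewrite /state; exact: hV.
apply: lime_le.
  by apply: is_cvg_nneseries => n _ _; exact: integral_ge0.
apply: nearW => N; apply: le_trans (H N); rewrite leeDl//; exact: integral_ge0.
Qed.

End renewal.

(** * Occupation and exit events *)

Section events.
Context {R : realType} {dS : measure_display} {S : measurableType dS}
  {dO : measure_display} {O : measurableType dO}
  (Pr : probability O R) (Q : R.-pker S ~> (S * R)%type) (x : S)
  (Y : nat -> O -> S * R) (A : set S).
Hypothesis HY : is_MRchain Pr Q x Y.
Hypothesis mA : measurable A.
Hypothesis Ax : A x.
Hypothesis Q_supp : forall y, Q y (TD setT) = 1%E.

Local Open Scope ereal_scope.

Notation alive := (alive Y A).
Notation S_ := (sumT Y).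
Notation rsum := (renewal_sum Pr Y A).

Let mY n : measurable_fun setT (Y n).
Proof. by case: HY. Qed.

Let mS n : measurable_fun setT (S_ n).
Proof. exact: measurable_sumT HY n. Qed.

Let mal n : measurable (alive n).
Proof. exact: measurable_alive HY mA n. Qed.

Let mYpre n (B : set (S * R)) : measurable B -> measurable (Y n @^-1` B).
Proof. by move=> mB; rewrite -[X in measurable X]setTI; exact: mY. Qed.

Let mSpre n (B : set R) : measurable B -> measurable (S_ n @^-1` B).
Proof. by move=> mB; rewrite -[X in measurable X]setTI; exact: mS. Qed.

Let mfst (B : set S) : measurable B -> measurable ([set p | B p.1] : set (S * R)).
Proof. by move=> mB; rewrite -[X in measurable X]setTI; exact: measurable_fst. Qed.

Let msnd (B : set R) : measurable B -> measurable ([set p | B p.2] : set (S * R)).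
Proof. by move=> mB; rewrite -[X in measurable X]setTI; exact: measurable_snd. Qed.

Let sumT_mono n m w : (n <= m)%N -> (forall k, (k <= m)%N -> (0 <= (Y k w).2)%R) ->
  (S_ n w <= S_ m w)%R.
Proof.
elim: m => [|m IH]; first by rewrite leqn0 => /eqP ->.
rewrite leq_eqVlt => /predU1P[->//|nm] Y0.
rewrite (sumTS Y); apply: le_trans (IH nm _) _; first by move=> k km; apply: Y0; exact: leqW.
by rewrite lerDl Y0.
Qed.

Let alive_ge0 m w k : alive m w -> (k <= m)%N -> (0 <= (Y k w).2)%R.
Proof. by move=> al km; have [_] := al k km; rewrite /= in_itv/= andbT. Qed.

(** The kernel draws the sojourn in the present state together with the next state, so this is the
    conditional probability that the sojourn begun at time [q.2] in [q.1] covers [t]. *)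
Definition occupation (B : set S) (t : R) (q : S * R) : \bar R :=
  if (q.1 \in B) && (q.2 <= t)%R then Q q.1 [set p | t < q.2 + p.2]%R else 0.

Let holding B t n : set O :=
  alive n `&` [set w | B (Y n w).1 /\ (S_ n w <= t < S_ n.+1 w)%R].

Let m_late t : measurable ([set z | t < z.1 + z.2.2]%R : set (R * (S * R))).
Proof.
rewrite -[X in measurable X]setTI.
have mf : measurable_fun setT (fun z : R * (S * R) => z.1 + z.2.2)%R.
  apply: measurable_funD; first exact: measurable_fst.
  exact: (measurableT_comp measurable_snd measurable_snd).
have -> : [set z : R * (S * R) | t < z.1 + z.2.2]%R = (fun z : R * (S * R) => z.1 + z.2.2)%R @^-1` `]t, +oo[%classic.
  by apply/seteqP; split=> z /=; rewrite in_itv/= andbT.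
exact: mf.
Qed.

Lemma occupation_ge0 B t q : 0 <= occupation B t q.
Proof. by rewrite /occupation; case: ifP. Qed.

Lemma measurable_occupation B t : measurable B -> measurable_fun setT (occupation B t).
Proof.
move=> mB; apply: measurable_fun_if => //.
  apply: measurable_and; first exact: (measurableT_comp (measurable_fun_mem mB) measurable_fst).
  by apply: measurable_fun_ler => //; exact: measurable_snd.
apply: measurable_funTS.
pose f (z : R * (S * R)) := (\1_[set z : R * (S * R) | t < z.1 + z.2.2]%R z)%:E : \bar R.
apply: (eq_measurable_fun ((fun q => \int[Q q.2]_p f (q.1, p)) \o (fun q => (q.2, q.1)))).
  move=> q _ /=; have mq : measurable ([set p | t < q.2 + p.2]%R : set (S * R)).
    have -> : [set p : S * R | t < q.2 + p.2]%R = xsection [set z | t < z.1 + z.2.2]%R q.2.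
      by apply/seteqP; split=> p; rewrite /xsection/= inE.
    exact: (measurable_xsection q.2 (m_late t)).
  rewrite -[in RHS](setIT [set p | t < q.2 + p.2]%R) -integral_indic//.
apply: measurableT_comp.
  apply: measurable_kernel_integral => //.
    by move=> p; rewrite /f lee_fin.
  by apply/measurable_EFinP; exact: measurable_indic.
by apply/measurable_fun_pair; [exact: measurable_snd|exact: measurable_fst].
Qed.

Let measurable_holding B t n : measurable B -> measurable (holding B t n).
Proof.
move=> mB; apply: measurableI => //.
have -> : [set w | B (Y n w).1 /\ (S_ n w <= t < S_ n.+1 w)%R] =
   Y n @^-1` [set p | B p.1] `&` (S_ n @^-1` `]-oo, t]%classic `&` S_ n.+1 @^-1` `]t, +oo[%classic).
  apply/seteqP; split=> w /=; rewrite !in_itv/= andbT; first by move=> [? /andP[]].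
  by move=> [? [-> ->]].
apply: measurableI; first exact: mYpre (mfst mB).
by apply: measurableI; exact: mSpre.
Qed.

Let Pr_holding B t n : measurable B ->
  Pr (holding B t n) = \int[Pr]_(w in alive n) occupation B t (state Y n w).
Proof.
move=> mB.
pose D := alive n `&` (Y n @^-1` [set p | B p.1] `&` S_ n @^-1` `]-oo, t]%classic).
have pD : past Y n D.
  apply: past_setI; first exact: (past_alive mA (n := n)).
  apply: past_setI; first exact: (adapted_coordinate (leqnn n) (mfst mB)).
  exact: (@adapted_sumT _ _ _ _ _ Y n).
have := markov_section HY pD (@adapted_sumT _ _ _ _ _ Y n) (m_late t).
have -> : D `&` (fun w => (S_ n w, Y n.+1 w)) @^-1` [set z | t < z.1 + z.2.2]%R = holding B t n.
  apply/seteqP; split=> w /=; rewrite /D/= in_itv/= -(sumTS Y).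
    by move=> [[al [Bn Sn]] nS]; split=> //; split=> //; rewrite Sn nS.
  by move=> [al [Bn /andP[Sn nS]]].
move=> ->; rewrite /D integral_mkcondr; apply: eq_integral => w _.
rewrite /restrict /occupation /state/=.
have -> : (w \in Y n @^-1` [set p | B p.1] `&` S_ n @^-1` `]-oo, t]%classic) =
    ((Y n w).1 \in B) && (S_ n w <= t)%R.
  apply/idP/idP; rewrite inE/= in_itv/=.
    by move=> [h ->]; rewrite andbT inE.
  by move=> /andP[/set_mem].
case: ifP => // _; congr (Q _ _); apply/seteqP; split=> p; rewrite /xsection/= inE//.
Qed.

Let trivIset_holding B t : trivIset setT (holding B t).
Proof.
suff H n m w : (n < m)%N -> holding B t n w -> holding B t m w -> False.
  move=> n m _ _ [w [hn hm]]; have [nm|mn|//] := ltngtP n m; exfalso.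
  - exact: H nm hn hm.
  - exact: H mn hm hn.
move=> nm [_ [_ /andP[_ a]]] [al [_ /andP[b _]]].
have := sumT_mono nm (fun k km => alive_ge0 al km).
by rewrite leNgt (le_lt_trans b a).
Qed.

Lemma renewal_occupation B t : measurable B ->
  rsum (occupation B t) = Pr (\bigcup_n holding B t n).
Proof.
move=> mB; rewrite measure_bigcupT//; last by move=> n; exact: measurable_holding.
by apply: eq_eseriesr => n _; exact/esym/Pr_holding.
Qed.

Lemma measurable_Xt_in B t : measurable B -> measurable [set w | Xt_in Y t B w].
Proof.
move=> mB.
have -> : [set w | Xt_in Y t B w] = \bigcup_n (Y n @^-1` [set p | B p.1] `&`
    (S_ n @^-1` `]-oo, t]%classic `&` S_ n.+1 @^-1` `]t, +oo[%classic)).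
  apply/seteqP; split=> w /=.
    by move=> [n [/andP[a b] c]]; exists n => //=; rewrite !in_itv/= a b.
  by move=> [n _ /= [c]]; rewrite !in_itv/= andbT => -[a b]; exists n; rewrite a b.
apply: bigcup_measurable => n _; apply: measurableI; first exact: mYpre (mfst mB).
by apply: measurableI; exact: mSpre.
Qed.

(** The infimum runs over uncountably many times. It is at most [t] exactly when, for every [m],
    some sojourn outside [A] of positive length meets [[0, t + 1/(m+1))], and this involves
    countably many conditions. *)
Lemma measurable_exit_time t : measurable [set w | exit_time Y A w <= t%:E].
Proof.
pose E m n := [set w | [/\ ~ A (Y n w).1, (S_ n w < S_ n.+1 w)%R, (0 < S_ n.+1 w)%R,
  (S_ n w < t + m.+1%:R^-1)%R & (0 < t + m.+1%:R^-1)%R]].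
have -> : [set w | exit_time Y A w <= t%:E] = \bigcap_m \bigcup_n E m n.
  apply/seteqP; split=> w /=.
    move=> et m _.
    have : exit_time Y A w < (t + m.+1%:R^-1)%:E.
      by apply: le_lt_trans et _; rewrite lte_fin ltrDl invr_gt0.
    move=> /ereal_inf_lt[_ [r [r0 [n [/andP[Sr rS] NA]]] <-]]; rewrite lte_fin => rt.
    exists n => //; split=> //.
    - exact: le_lt_trans Sr rS.
    - exact: le_lt_trans r0 rS.
    - exact: le_lt_trans Sr rt.
    - exact: le_lt_trans r0 rt.
  move=> H; apply/lee_addgt0Pr => e e0.
  have [m me] : exists m : nat, (m.+1%:R^-1 < e)%R.
    have [N _ HN] := near_infty_natSinv_lt (PosNum e0); exists N; exact: HN (leqnn N).
  have [n _ [NA h1 h2 h3 h4]] := H m I.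
  apply: (@le_trans _ _ (Num.max (S_ n w) 0%R)%:E).
    apply: ereal_inf_lbound; exists (Num.max (S_ n w) 0%R) => //; split.
      by rewrite le_max lexx orbT.
    by exists n; split=> //; rewrite le_max lexx/= gt_max h1.
  rewrite lee_fin ge_max; apply/andP; split; apply: ltW.
    by apply: lt_trans h3 _; rewrite ltrD2l.
  by apply: lt_trans h4 _; rewrite ltrD2l.
apply: bigcap_measurable; first by exists 0%N.
move=> m _; apply: bigcup_measurable => n _.
have [h4|h4] := pselect (0 < t + m.+1%:R^-1)%R; last first.
  rewrite (_ : E m n = set0)//; by apply/seteqP; split=> w // [].
have -> : E m n = Y n @^-1` [set p | (~` A) p.1] `&` ((fun w => S_ n.+1 w - S_ n w)%R @^-1` (`]0%R, +oo[%classic : set R) `&`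
   (S_ n.+1 @^-1` (`]0%R, +oo[%classic : set R) `&` S_ n @^-1` `]-oo, (t + m.+1%:R^-1)%R[%classic)).
  apply/seteqP; split=> w /=; rewrite !in_itv/= !andbT subr_gt0.
    by move=> [].
  by move=> [? [? []]].
apply: measurableI; first by apply: mYpre; apply: mfst; exact: measurableC.
apply: measurableI.
  rewrite -[X in measurable X]setTI; apply: (measurable_funB (mS n.+1) (mS n)) => //.
by apply: measurableI; exact: mSpre.
Qed.

(** Sojourns are non-negative only almost surely; this null event is split off from the pathwise
    inclusions below. *)
Let negative := \bigcup_k Y k @^-1` [set p | `]-oo, 0%R[%classic p.2].

Let measurable_negative : measurable negative.
Proof. by apply: bigcup_measurable => k _; apply: mYpre; apply: msnd. Qed.

Let Pr_negative : Pr negative = 0.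
Proof.
apply/eqP; rewrite eq_le measure_ge0 andbT.
apply: le_trans (@measure_sigma_subadditive _ _ _ Pr _ (fun k => Y k @^-1` [set p | `]-oo, 0%R[%classic p.2]) _ _ _) _.
- by move=> k; apply: mYpre; apply: msnd.
- by [].
- exact: subset_refl.
rewrite eseries0// => -[|n] _ _.
  rewrite (_ : _ @^-1` _ = set0) ?measure0//; apply/seteqP; split=> w //=.
  by case: HY => _ -> _ /=; rewrite in_itv/= ltxx.
have mneg : measurable ([set p | `]-oo, 0%R[%classic p.2] : set (S * R)) by exact: msnd.
transitivity (Pr (setT `&` Y n.+1 @^-1` [set p | `]-oo, 0%R[%classic p.2])); first by rewrite setTI.
rewrite (markov_set HY (@past_setT _ _ _ _ _ Y n) mneg); apply: integral0_eq => w _.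
apply/eqP; rewrite eq_le measure_ge0 andbT -(@leeD2lE _ 1%E)// adde0 -{1}(Q_supp (Y n w).1).
rewrite -measureU//; last 2 first.
- exact: measurable_TD.
- by apply/seteqP; split=> p //= [[_ /=]]; rewrite !in_itv/= andbT => /le_lt_trans h /h; rewrite ltxx.
rewrite -(@prob_kernel _ _ _ _ _ Q (Y n w).1); apply: le_measure; rewrite ?inE//.
by apply: measurableU => //; exact: measurable_TD.
Qed.

Let exited t n : set O := alive n `&`
  (Y n.+1 @^-1` [set p | (~` A) p.1] `&` (Y n.+1 @^-1` [set p | `[0%R, +oo[%classic p.2] `&` S_ n.+1 @^-1` `]-oo, t]%classic)).

Let past_exited t n : past Y n.+1 (exited t n).
Proof.
apply: past_setI.
  have -> : alive n = \bigcap_(k in `I_n.+2) (Y k @^-1` (if (k <= n)%N then TD A else setT)).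
    apply/seteqP; split=> w /= H k /=.
      by move=> _; case: ifP => // kn; exact: H.
    by move=> kn; have /= := H k (ltnW kn); rewrite -ltnS kn.
  by apply: past_cylinder => k; case: ifP => // _; exact: measurable_TD.
apply: past_setI; first by apply: (adapted_coordinate (leqnn n.+1)); apply: mfst; exact: measurableC.
apply: past_setI; first by apply: (adapted_coordinate (leqnn n.+1)); exact: msnd.
exact: (@adapted_sumT _ _ _ _ _ Y n.+1).
Qed.

Let mexited t n : measurable (exited t n).
Proof. exact: (past_measurable HY (@past_exited t n)). Qed.

(* [exit_time] ignores visits of zero duration, so an exit is only seen with probability at least
   one half, when the first sojourn outside [A] has positive length. *)
Let Pr_exited t : (forall y, ~ A y -> (2^-1)%:E <= Q y [set p | (0 < p.2)%R]) -> (0 <= t)%R ->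
  Pr (\bigcup_n exited t n) <= 2%:E * Pr [set w | exit_time Y A w <= t%:E].
Proof.
move=> half t0.
have mpos : measurable ([set p | `]0%R, +oo[%classic p.2] : set (S * R)) by exact: msnd.
pose ex' n := exited t n `&` Y n.+2 @^-1` [set p | `]0%R, +oo[%classic p.2].
have mex' n : measurable (ex' n) by exact: (measurableI _ _ (mexited t n) (mYpre _ mpos)).
have le2 n : Pr (exited t n) <= 2%:E * Pr (ex' n).
  rewrite /ex' (markov_set HY (@past_exited t n) mpos).
  apply: (@le_trans _ _ (2%:E * \int[Pr]_(w in exited t n) (2^-1)%:E)).
    by rewrite integral_cst// muleA -EFinM divff// mul1e.
  apply: lee_wpmul2l => //; apply: ge0_le_integral => //.
  - apply: measurable_funTS; apply: (measurableT_comp (measurable_kernel Q _ mpos)).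
    exact: measurableT_comp measurable_fst (mY n.+1).
  - move=> w [_ [NA _]].
    rewrite (_ : [set p | _] = [set p : S * R | (0 < p.2)%R]); first exact: half.
    by apply/seteqP; split=> p /=; rewrite in_itv/= andbT.
have tex' : trivIset setT ex'.
  suff H n m w : (n < m)%N -> exited t n w -> exited t m w -> False.
    move=> n m _ _ [w [[hn _] [hm _]]]; have [nm|mn|//] := ltngtP n m; exfalso.
    - exact: H nm hn hm.
    - exact: H mn hm hn.
  by move=> nm [_ [NA _]] [al _]; apply: NA; have [] := al n.+1 nm.
apply: le_trans (@measure_sigma_subadditive _ _ _ Pr _ (exited t) _ _ _) _ => //.
  exact: bigcup_measurable.
apply: (@le_trans _ _ (\sum_(0 <= n <oo) 2%:E * Pr (ex' n))).
  by apply: lee_nneseries => [n _ _|n _]; [exact: measure_ge0|exact: le2].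
rewrite nneseriesZl//; apply: lee_wpmul2l => //.
rewrite -measure_bigcupT//; apply: le_measure; rewrite ?inE.
- exact: bigcup_measurable.
- exact: measurable_exit_time.
move=> w [n _ [[al [NA [/= Y0 St]]] /= Y1]].
rewrite in_itv/= andbT in Y0; rewrite in_itv/= in St; rewrite in_itv/= andbT in Y1.
apply: (@le_trans _ _ (S_ n.+1 w)%:E); last by rewrite lee_fin.
apply: ereal_inf_lbound; exists (S_ n.+1 w) => //; split.
  by rewrite (sumTS Y) addr_ge0//; have [_] := alive_state al.
exists n.+1; split=> //; by rewrite lexx/= [ltRHS](sumTS Y) ltrDl.
Qed.

(** A path found in [B] at time [t] is either in a sojourn reached alive, or was killed at an
    earlier renewal and so left [A] by time [t]. *)
Lemma le_Pr_Xt_in B t : measurable B -> B `<=` A -> (0 <= t)%R ->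
  (forall y, ~ A y -> (2^-1)%:E <= Q y [set p | (0 < p.2)%R]) ->
  Pr [set w | Xt_in Y t B w] <= rsum (occupation B t) + 2%:E * Pr [set w | exit_time Y A w <= t%:E].
Proof.
move=> mB BA t0 half; rewrite renewal_occupation//.
apply: le_trans (leeD (lexx _) (Pr_exited half t0)).
rewrite -[leRHS]adde0 -Pr_negative.
have mh : measurable (\bigcup_n holding B t n) by apply: bigcup_measurable => n _; exact: measurable_holding.
have me : measurable (\bigcup_n exited t n) by apply: bigcup_measurable => n _; exact: mexited.
apply: le_trans (leeD (measureU2 _ mh me) (lexx _)).
apply: le_trans (measureU2 _ (measurableU _ _ mh me) measurable_negative).
apply: le_measure; rewrite ?inE.
- exact: measurable_Xt_in.
- by apply: measurableU => //; exact: measurableU.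
move=> w [n [/andP[Sn nS] Bn]].
have [Nw|Nw] := pselect (negative w); first by right.
have Yp k : (0 <= (Y k w).2)%R.
  by rewrite leNgt; apply/negP => h; apply: Nw; exists k => //=; rewrite in_itv.
left.
have [al|nal] := pselect (alive n w); first by left; exists n => //; split=> //; rewrite /= Sn nS.
right.
have ex : exists k, ~~ `[< alive k w >] by exists n; apply/asboolPn.
case: (ex_minnP ex) => -[|k] /asboolPn Nk kmin.
  by exfalso; apply: Nk; rewrite (alive0 HY Ax).
have alk : alive k w by apply: contrapT => h; have := kmin k (introN (asboolP _) h); rewrite ltnn.
have kn : (k.+1 <= n)%N by apply: kmin; exact/asboolPn.
exists k => //; split=> //; split.
  move=> /= Ak; apply: Nk; rewrite aliveS; split=> //; split=> //=.
  by rewrite in_itv/= andbT.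
split; rewrite /= in_itv/= ?andbT//.
by apply: le_trans Sn; apply: sumT_mono.
Qed.

Lemma ge_Pr_Xt_in B t : measurable B ->
  rsum (occupation B t) <= Pr [set w | Xt_in Y t B w].
Proof.
move=> mB; rewrite renewal_occupation//; apply: le_measure; rewrite ?inE.
- by apply: bigcup_measurable => n _; exact: measurable_holding.
- exact: measurable_Xt_in.
by move=> w [n _ [_ [Bn Sn]]]; exists n.
Qed.

(** Up to null events a path either leaves [A] by time [t] or has a sojourn in [A] covering [t]. The
    remaining case, infinitely many renewals before [t], is null because their expected number is
    finite. *)
Lemma Pr_survival t : (0 <= t)%R ->
  (forall y, ~ A y -> (2^-1)%:E <= Q y [set p | (0 < p.2)%R]) ->
  rsum (fun q => (\1_`]-oo, t] q.2)%:E) < +oo ->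
  1 <= rsum (occupation A t) + 2%:E * Pr [set w | exit_time Y A w <= t%:E].
Proof.
move=> t0 half fin; rewrite renewal_occupation//.
apply: le_trans (leeD (lexx _) (Pr_exited half t0)).
pose early n := alive n `&` S_ n @^-1` `]-oo, t]%classic.
have mea n : measurable (early n) by apply: measurableI => //; exact: mSpre.
have Pearly : Pr (\bigcap_n early n) = 0.
  apply/eqP; rewrite eq_le measure_ge0 andbT.
  have me : measurable (\bigcap_n early n) by exact: bigcap_measurable.
  have H n : Pr (\bigcap_n early n) <= \int[Pr]_(w in alive n) (\1_`]-oo, t] (state Y n w).2)%:E.
    rewrite (_ : (\int[Pr]_(w in alive n) _) = Pr (early n)).
      by apply: le_measure; rewrite ?inE// => w; exact.
    rewrite /early setIC -integral_indic//; exact: mSpre.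
  set p := Pr _ in H *; set T := rsum _ in fin.
  have T0 : 0 <= T by apply: renewal_sum_ge0 => q; rewrite lee_fin.
  have pfin : p \is a fin_num by rewrite fin_num_measure.
  have Tfin : T \is a fin_num by rewrite ge0_fin_numE.
  have HN N : (fine p *+ N <= fine T)%R.
    rewrite -lee_fin (fineK Tfin).
    apply: le_trans (nneseries_lim_ge N _); last by move=> k _ _; apply: integral_ge0 => w _; rewrite lee_fin.
    rewrite (_ : (fine p *+ N = \sum_(0 <= k < N) fine p)%R); last by rewrite sumr_const_nat subn0.
    rewrite -sumEFin; apply: lee_sum => k _; rewrite fineK//; exact: H.
  rewrite -(fineK pfin) lee_fin leNgt; apply/negP => p0.
  have := ltr_bound (fine T / fine p); rewrite ltr_pdivrMr// mulr_natl.
  by rewrite ltNge HN.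
have mh : measurable (\bigcup_n holding A t n) by apply: bigcup_measurable => n _; exact: measurable_holding.
have me : measurable (\bigcup_n exited t n) by apply: bigcup_measurable => n _; exact: mexited.
have me0 : measurable (\bigcap_n early n) by exact: bigcap_measurable.
have mb := measurableU _ _ me0 measurable_negative.
have Pb : Pr (\bigcap_n early n `|` negative) = 0.
  apply/eqP; rewrite eq_le measure_ge0 andbT; apply: le_trans (measureU2 _ me0 measurable_negative) _.
  by rewrite [X in X + _]Pearly [X in _ + X]Pr_negative adde0.
rewrite -[leRHS]adde0 -Pb.
apply: le_trans (leeD (measureU2 _ mh me) (lexx _)).
apply: le_trans (measureU2 _ (measurableU _ _ mh me) mb).
rewrite -(probability_setT Pr); apply: le_measure; rewrite ?inE//.
  by apply: measurableU => //; exact: measurableU.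
move=> w _.
have [Nw|Nw] := pselect (negative w); first by right; right.
have [H|/existsNP[n0 Hn0]] := pselect (forall n, early n w); first by right; left => n _; exact: H.
left.
have ex : exists k, ~~ `[< early k w >] by exists n0; apply/asboolPn.
case: (ex_minnP ex) => -[|k] /asboolPn Nk kmin.
  exfalso; apply: Nk; split; first by rewrite (alive0 HY Ax).
  by have := state0 HY w => -[_ /= ->]; rewrite in_itv.
have [alk /= Sk] : early k w by apply: contrapT => h; have := kmin k (introN (asboolP _) h); rewrite ltnn.
rewrite in_itv/= in Sk.
have [Ak _] := alive_state alk.
have [St|St] := leP (S_ k.+1 w) t; last by left; exists k => //; split=> //; split=> //; rewrite Sk.
have Tk : (0 <= (Y k.+1 w).2)%R.
  by rewrite leNgt; apply/negP => h; apply: Nw; exists k.+1 => //=; rewrite in_itv.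
right; exists k => //; split=> //; split; last by split=> /=; rewrite in_itv/= ?andbT.
move=> Ak1; apply: Nk; split; last by rewrite /= in_itv.
by rewrite aliveS; split=> //; split=> //=; rewrite in_itv/= andbT.
Qed.

End events.

(** * Tent functions *)

Section clamp.
Context {R : realType}.
Implicit Types x y : R.

Definition clamp x : R := if x <= 0 then 0 else if 1 <= x then 1 else x.

Lemma clamp_ge0 x : 0 <= clamp x.
Proof. by rewrite /clamp; case: (leP x 0); case: (leP 1 x); lra. Qed.

Lemma clamp_le1 x : clamp x <= 1.
Proof. by rewrite /clamp; case: (leP x 0); case: (leP 1 x); lra. Qed.

Lemma clamp0 x : x <= 0 -> clamp x = 0.
Proof. by rewrite /clamp => ->. Qed.

Lemma clamp1 x : 1 <= x -> clamp x = 1.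
Proof. by rewrite /clamp; case: (leP x 0); case: (leP 1 x); lra. Qed.

Lemma clamp_nd x y : x <= y -> clamp x <= clamp y.
Proof.
by rewrite /clamp; case: (leP x 0); case: (leP 1 x); case: (leP y 0); case: (leP 1 y); lra.
Qed.

Lemma clamp_lip x y : `|clamp x - clamp y| <= `|x - y|.
Proof.
wlog xy : x y / x <= y.
  by move=> H; have [/H//|/ltW/H] := leP x y; rewrite distrC [X in _ <= X]distrC.
rewrite !ler0_norm ?subr_le0 ?clamp_nd//.
by move: xy; rewrite /clamp; case: (leP x 0); case: (leP 1 x); case: (leP y 0); case: (leP 1 y); lra.
Qed.

(** The hat function on [[-1, 1]], written as a difference so that sums of integer translates
    telescope to a partition of unity. *)
Definition tent x : R := clamp (x + 1) - clamp x.

Lemma tent_ge0 x : 0 <= tent x.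
Proof. by rewrite subr_ge0 clamp_nd// lerDl. Qed.

Lemma tent_le1 x : tent x <= 1.
Proof. by rewrite /tent; have := clamp_le1 (x + 1); have := clamp_ge0 x; lra. Qed.

Lemma tent_lip x y : `|tent x - tent y| <= 2 * `|x - y|.
Proof.
have -> : tent x - tent y = (clamp (x + 1) - clamp (y + 1)) - (clamp x - clamp y) by rewrite /tent; ring.
apply: le_trans (ler_normB _ _) _; rewrite mulrDl mul1r; apply: lerD (clamp_lip _ _).
by apply: le_trans (clamp_lip _ _) _; rewrite opprD addrACA subrr addr0.
Qed.

Lemma tent_left x : x <= -1 -> tent x = 0.
Proof. by move=> h; rewrite /tent !clamp0 ?subrr//; lra. Qed.

Lemma tent_right x : 1 <= x -> tent x = 0.
Proof. by move=> h; rewrite /tent !clamp1 ?subrr//; lra. Qed.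

Lemma tent_neq0 x : tent x != 0 -> -1 < x < 1.
Proof.
move=> h; apply/andP; split; rewrite ltNge; apply: contra h => h; first by rewrite tent_left.
by rewrite tent_right.
Qed.

Lemma sum_tent x J : \sum_(j < J) tent (x - j%:R) = clamp (x + 1) - clamp (x + 1 - J%:R).
Proof.
elim: J => [|J IH]; first by rewrite big_ord0 subr0 subrr.
rewrite big_ord_recr/= IH /tent -natr1 [x - J%:R + 1]addrAC.
have -> : x + 1 - (J%:R + 1) = x - J%:R by ring.
by rewrite subrKA.
Qed.

(** Discrete layer-cake formula: it converts sums of smoothed tails into a truncated mean. *)
Lemma sum_clamp x J : 0 <= x -> \sum_(j < J) clamp (x - j%:R) = Num.min x J%:R.
Proof.
move=> x0; elim: J => [|J IH]; first by rewrite big_ord0 min_r.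
rewrite big_ord_recr/= IH -natr1; move: (J%:R) => j.
by rewrite /clamp; case: (leP x j); case: (leP x (j + 1)); case: (leP (x - j) 0); case: (leP 1 (x - j)); lra.
Qed.

End clamp.

(** * A Lyapunov function for the limit chain *)

Section lyapunov.
Context {R : realType} {I : finType} (D : pred I) (P : I -> I -> R) (i0 : I).
Hypothesis P_ge0 : forall i j, 0 <= P i j.
Hypothesis P_sum : forall i, D i -> \sum_(j | D j) P i j = 1.
Hypothesis P_closed : forall i j, D i -> 0 < P i j -> D j.
Hypothesis P_irr : forall i, D i -> i != i0 -> clos_trans I (fun a b => 0 < P a b) i i0.

Fixpoint reach (n : nat) (i : I) : bool :=
  if n is m.+1 then [exists j, [&& D j, 0 < P i j & reach m j]] else i == i0.

Let reach_ex i : D i -> exists n, reach n i.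
Proof.
have H a b : clos_trans I (fun a b => 0 < P a b) a b -> D a -> (exists n, reach n b) -> exists n, reach n a.
  elim=> {a b} [a b ab Da [n rn]|a b c ab IH1 bc IH2 Da rc].
    by exists n.+1 => /=; apply/existsP; exists b; rewrite ab rn (P_closed Da ab).
  apply: IH1 => //; apply: IH2 => //.
  elim: ab Da => {a b c bc rc} [a b ab /P_closed|a b d _ IH1' _ IH2' /IH1'/IH2']//; exact.
move=> Di; have [->|ii0] := eqVneq i i0; first by exists 0%N => /=.
by apply: H (P_irr Di ii0) Di _; exists 0%N => /=.
Qed.

(* The expected value of [kappa ^ dist] at the next step is at least twice its present value
   away from [i0] when [kappa] is less than half of every positive transition probability. *)
Lemma lyapunov : exists (W : I -> R) (c : R), [/\ 0 < c,
  forall i, 0 <= W i <= 1 & forall i, D i -> i != i0 -> \sum_(j | D j) P i j * W j <= W i - c].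
Proof.
pose dist i := if pselect (exists n, reach n i) is left h then ex_minn h else 0%N.
have distP i : D i -> i != i0 -> exists j, [/\ D j, 0 < P i j & (dist j < dist i)%N].
  move=> Di ii0; rewrite {2}/dist; case: pselect => [h|[]]; last exact: reach_ex.
  case: ex_minnP => -[/= /eqP|n]; first by move=> e; rewrite e eqxx in ii0.
  move=> /= /existsP[j /and3P[Dj Pij rj]] _; exists j; split=> //.
  rewrite /dist; case: pselect => [h'|[]]; last by exists n.
  by case: ex_minnP => m _ /(_ n rj).
have P_le1 i j : D i -> D j -> P i j <= 1.
  by move=> Di Dj; rewrite -(P_sum Di) (bigD1 j)//= lerDl sumr_ge0.
(* A product of numbers in [(0, 1]] is a lower bound for each factor. In the same way [c] below
   takes the sum of all distances as exponent, so it is at most every [k ^+ dist i]. *)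
pose p := \prod_(x : I * I | [&& D x.1, D x.2 & 0 < P x.1 x.2]) P x.1 x.2.
have p0 : 0 < p by apply: prodr_gt0 => x /and3P[].
have p_le i j : D i -> D j -> 0 < P i j -> p <= P i j.
  move=> Di Dj Pij; rewrite /p (bigD1 (i, j))/= ?Di ?Dj//= ler_piMr//.
  by apply: prodr_ile1 => x; rewrite P_ge0/= => /andP[/and3P[Dx1 Dx2 _] _]; exact: P_le1.
pose k := Num.min 1 (p / 2).
have k0 : 0 < k by rewrite lt_min ltr01 divr_gt0.
have k1 : k <= 1 by rewrite ge_min lexx.
have k2 : 2 * k <= p by rewrite mulrC -ler_pdivlMr// ge_min lexx orbT.
have kd i : 0 < k ^+ dist i by rewrite exprn_gt0.
pose c := k ^+ (\sum_i dist i).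
exists (fun i => 1 - k ^+ dist i), c; split.
- by rewrite exprn_gt0.
- move=> i; rewrite subr_ge0 exprn_ile1// ?(ltW k0)//=.
  by rewrite lerBlDr lerDl ltW.
move=> i Di ii0; have [j [Dj Pij dj]] := distP i Di ii0.
have -> : \sum_(j | D j) P i j * (1 - k ^+ dist j) = 1 - \sum_(j | D j) P i j * k ^+ dist j.
  by rewrite -[X in X - _](P_sum Di) -sumrB; apply: eq_bigr => l _; rewrite mulrBr mulr1.
have c_le : c <= k ^+ dist i.
  rewrite /c; apply: ler_wiXn2l; rewrite ?(ltW k0)//.
  by rewrite (bigD1 i)//= leq_addr.
have h1 : P i j * k ^+ dist j <= \sum_(j | D j) P i j * k ^+ dist j.
  by rewrite (bigD1 j)//= lerDl sumr_ge0// => l _; rewrite mulr_ge0// ltW.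
have h2 : 2 * k ^+ dist i <= P i j * k ^+ dist j.
  apply: (@le_trans _ _ (2 * (k * k ^+ dist j))).
    rewrite ler_pM2l// -exprS; apply: ler_wiXn2l; rewrite ?(ltW k0)//.
  by rewrite mulrA ler_pM2r//; apply: le_trans k2 _; exact: p_le.
lra.
Qed.

End lyapunov.

(** * Uniform bounds on the renewal measure *)

Lemma measurable_TD_gt {R : realType} {dS} {S : measurableType dS} (r : R) :
  measurable [set p : S * R | r < p.2].
Proof.
rewrite (_ : [set _ | _] = snd @^-1` (`]r, +oo[%classic : set R)).
  by rewrite -[X in measurable X]setTI; exact: measurable_snd.
by apply/seteqP; split=> p /=; rewrite in_itv/= andbT.
Qed.

Lemma measurable_tail {R : realType} (T r0 : R) : 1 < r0 ->
  measurable_fun setT (fun s : R => if r0 < T - s then (T - s) ^- 2 else 0).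
Proof.
move=> r1.
apply: measurable_fun_if => //; first by apply: measurable_fun_ltr => //; apply: measurable_funB.
rewrite setTI (_ : _ @^-1` _ = `]-oo, T - r0[%classic); last first.
  by apply/seteqP; split=> s /=; rewrite in_itv/= => h; lra.
apply: measurable_nondecreasing_in => //; first exact: interval_is_interval.
move=> a b /set_mem /=; rewrite in_itv/= => ar /set_mem /=; rewrite in_itv/= => br ab.
by rewrite lef_pV2 ?posrE ?exprn_gt0//; try lra; rewrite lerXn2r// ?nnegrE; lra.
Qed.

Section unit_bound.
Context {R : realType} {dS : measure_display} {S : measurableType dS}
  {dO : measure_display} {O : measurableType dO}
  (Pr : probability O R) (Q : R.-pker S ~> (S * R)%type) (x : S)
  (Y : nat -> O -> S * R) (A : set S).
Hypothesis HY : is_MRchain Pr Q x Y.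
Hypothesis mA : measurable A.
Hypothesis Ax : A x.
Local Notation rsum := (renewal_sum Pr Y A).

Let mTDA : measurable (TD A : set (S * R)). Proof. exact: measurable_TD. Qed.

Lemma measurable_comp_snd (f : R -> R) : measurable_fun setT f ->
  measurable_fun setT (fun q : S * R => f q.2).
Proof. by move=> mf; apply: measurableT_comp mf measurable_snd. Qed.

Lemma measurable_window (a b : R) :
  measurable_fun setT (fun q : S * R => (\1_`[a, b] q.2 : R)%:E).
Proof.
apply/measurable_EFinP; apply: (@measurable_comp_snd (\1_`[a, b])).
exact: measurable_indic.
Qed.

(* The supersolution is [v e^{theta r} / c] in the last unit of time [r = a + 1 - s <= 1],
   frozen at its maximum before. *)
Lemma renewal_unit_bound (v : S -> R) (L theta c a : R) :
  measurable_fun setT v -> (forall y, 0 <= v y <= L) -> 0 <= theta -> 0 < c ->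
  (forall y, A y ->
    (\int[Q y]_(p in TD A) (v p.1 * expR (- (theta * p.2)))%:E <= (v y - c)%:E)%E) ->
  (rsum (fun q => (\1_`[a, a + 1] q.2)%:E) <= (L * expR theta / c)%:E)%E.
Proof.
move=> mv vL th0 c0 drift.
have L0 : 0 <= L by have /andP[] := vL x; exact: le_trans.
pose W (y : S) (s : R) := v y * expR (theta * (a + 1 - s)) / c.
pose V (q : S * R) := if q.2 < a then L * expR theta / c else W q.1 q.2.
have W0 y s : 0 <= W y s.
  by rewrite /W !mulr_ge0// ?expR_ge0// ?invr_ge0 ?(ltW c0)//; have /andP[] := vL y.
have B0 : 0 <= L * expR theta / c by rewrite !mulr_ge0// ?expR_ge0// invr_ge0 ltW.
have V0 q : 0 <= V q by rewrite /V; case: ifP.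
have V_le q : V q <= L * expR theta / c.
  rewrite /V; case: ltP => // aq; rewrite /W ler_pM2r ?invr_gt0//.
  apply: ler_pM; rewrite ?expR_ge0//; first by have /andP[] := vL q.1.
    by have /andP[] := vL q.1.
  by rewrite ler_expR -[leRHS]mulr1 ler_wpM2l//; lra.
have mW : measurable_fun setT (fun q : S * R => W q.1 q.2).
  apply: measurable_funM => //; apply: measurable_funM.
    by apply: measurableT_comp mv measurable_fst.
  apply: (@measurable_comp_snd (fun s => expR (theta * (a + 1 - s)))).
  apply: measurableT_comp => //; apply: measurable_funM => //.
  exact: measurable_funB.
have mV : measurable_fun setT V.
  apply: measurable_fun_if => //; last exact: measurable_funS mW.
  by apply: measurable_fun_ltr => //; exact: measurable_snd.
apply: (@le_trans _ _ (V (x, 0))%:E); last by rewrite lee_fin.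
apply: (renewal_supersolution HY mA Ax (V := fun q => (V q)%:E)).
- by move=> q; rewrite lee_fin.
- exact: measurable_window.
- by move=> q; rewrite lee_fin.
- exact/measurable_EFinP.
move=> y s Ay; rewrite /renewal_step/=.
have mVs : measurable_fun (TD A) (fun p : S * R => (V (p.1, s + p.2))%:E).
  apply/measurable_EFinP; apply: (@measurable_funS _ _ _ _ setT) => //.
  apply: measurableT_comp mV _; apply/measurable_fun_pairP; split=> /=; first exact: measurable_fst.
  by apply: measurable_funD => //; exact: measurable_snd.
have mvexp : measurable_fun (TD A) (fun p : S * R => (v p.1 * expR (- (theta * p.2)))%:E).
  apply/measurable_EFinP; apply: (@measurable_funS _ _ _ _ setT) => //.
  apply: measurable_funM; first by apply: measurableT_comp mv measurable_fst.
  apply: (@measurable_comp_snd (fun s => expR (- (theta * s)))).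
  by apply: measurableT_comp => //; apply: measurableT_comp => //; exact: measurable_funM.
have [sa|as_] := ltP s a.
  have -> : (\1_`[a, a + 1] s : R) = 0 by rewrite indicE mem_setE in_itv/= [a <= s]leNgt sa.
  rewrite add0e {2}/V/= sa.
  apply: (@le_trans _ _ (\int[Q y]_(p in TD A) (L * expR theta / c)%:E)%E).
    apply: ge0_le_integral => //.
    - by move=> p _; rewrite lee_fin.
    - by move=> p _; rewrite lee_fin.
  rewrite integral_cst// -[leRHS]mule1 lee_pmul//.
  by rewrite -(@prob_kernel _ _ _ _ _ Q y); apply: le_measure; rewrite ?inE//.
have -> : (\int[Q y]_(p in TD A) (V (p.1, s + p.2))%:E =
    (expR (theta * (a + 1 - s)) / c)%:E * \int[Q y]_(p in TD A) (v p.1 * expR (- (theta * p.2)))%:E)%E.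
  rewrite -ge0_integralZl//.
  - apply: eq_integral => p /set_mem[_ /=]; rewrite in_itv/= andbT => p2.
    rewrite -EFinM /V/= ltNge (le_trans as_)/= ?lerDl// /W; congr EFin.
    rewrite (_ : theta * (a + 1 - (s + p.2)) = theta * (a + 1 - s) - theta * p.2); last by ring.
    by rewrite expRD; ring.
  - by move=> p _; rewrite lee_fin mulr_ge0 ?expR_ge0//; have /andP[] := vL p.1.
  - by rewrite lee_fin mulr_ge0 ?expR_ge0// invr_ge0 ltW.
apply: le_trans (leeD (lexx _) (lee_wpmul2l _ (drift y Ay))) _.
  by rewrite lee_fin mulr_ge0 ?expR_ge0// invr_ge0 ltW.
rewrite -EFinM -EFinD lee_fin {1}/V/= ltNge as_/= /W.
set E := expR _; rewrite (_ : E / c * (v y - c) = v y * E / c - E); last first.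
  by field; rewrite gt_eqF.
(* The drift [c], divided by [c] and multiplied by the exponential, yields exactly the gain [E]. It
   pays for the indicator because [E >= 1] for [s <= a + 1]. *)
have : \1_`[a, a + 1] s <= E :> R.
  rewrite indicE mem_setE in_itv/= as_/=; case: (leP s (a + 1)) => sa; last exact: expR_ge0.
  by apply: le_trans (expR_ge1Dx _); rewrite lerDl mulr_ge0// subr_ge0.
lra.
Qed.

Context (U : R).
Hypothesis unit_bound : forall a, (rsum (fun q => (\1_`[a, a + 1] q.2)%:E) <= U%:E)%E.

Lemma renewal_window_bound (a : R) (n : nat) :
  (rsum (fun q => (\1_`[a, a + n%:R] q.2)%:E) <= (U * n.+1%:R)%:E)%E.
Proof.
apply: (@le_trans _ _ (rsum (fun q => \sum_(j <- index_iota 0 n.+1) (\1_`[a + j%:R, a + j%:R + 1] q.2)%:E)%E)).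
  apply: (le_renewal_sum HY mA).
  - by move=> q; rewrite lee_fin.
  - exact: measurable_window.
  - by apply: emeasurable_sum => j; exact: measurable_window.
  move=> y s _ _ /=; rewrite sumEFin lee_fin [leLHS]indicE mem_setE in_itv/=.
  have [as_|] := leP a s; last by rewrite sumr_ge0.
  have [sn|] := leP s (a + n%:R); last by rewrite sumr_ge0.
  have [j jn js] : exists2 j, (j <= n)%N & a + j%:R <= s <= a + j%:R + 1.
    exists (Num.trunc (s - a)).
      rewrite -(ler_nat R); apply: le_trans (_ : s - a <= _); last by lra.
      by rewrite truncn_le subr_ge0.
    have := @truncn_itv R (s - a); rewrite subr_ge0 as_ => /(_ isT).
    by rewrite -natr1; lra.
  rewrite (bigD1_seq j) ?iota_uniq ?mem_index_iota//=.
  by rewrite indicE mem_setE in_itv/= js lerDl sumr_ge0.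
rewrite (renewal_sum_sum HY mA); last 2 first.
- by move=> j q; rewrite lee_fin.
- by move=> j; exact: measurable_window.
rewrite (@le_trans _ _ (\sum_(j <- index_iota 0 n.+1) U%:E)%E)//; first exact: lee_sum.
by rewrite sumEFin big_const_seq count_predT size_iota subn0 iter_addr_0 mulr_natr.
Qed.

(** Going back from [T - r0] in unit windows, the integrand is at most [(r0 + j)^-2] on the j-th
    one, whose mass is at most [U]; the series is compared with the telescoping differences of
    [1 / (r0 - 1 + j)]. *)
Lemma renewal_tail_bound (T r0 : R) : 1 < r0 ->
  (rsum (fun q => (if r0 < T - q.2 then (T - q.2) ^- 2 else 0)%:E) <= (U / (r0 - 1))%:E)%E.
Proof.
move=> r1.
have mf : measurable_fun setT (fun q : S * R => (if r0 < T - q.2 then (T - q.2) ^- 2 else 0)%:E).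
  apply/measurable_EFinP.
  apply: (@measurable_comp_snd (fun s => if r0 < T - s then (T - s) ^- 2 else 0)).
  exact: measurable_tail.
have U0 : 0 <= U.
  by rewrite -lee_fin; apply: le_trans (unit_bound 0); apply: renewal_sum_ge0 => // q; rewrite lee_fin.
(* Renewal times are non-negative, so finitely many windows reach back far enough. *)
pose J := (Num.trunc `|T|).+1.
have TJ : T < J%:R by apply: le_lt_trans (ler_norm _) _; exact: truncnS_gt.
pose u j : R := (r0 + j%:R) ^- 2.
have u0 j : 0 <= u j by rewrite invr_ge0 sqr_ge0.
apply: (@le_trans _ _ (rsum (fun q => \sum_(j <- index_iota 0 J)
    ((u j)%:E * (\1_`[T - r0 - j%:R - 1, T - r0 - j%:R - 1 + 1] q.2)%:E))%E)).
  apply: (le_renewal_sum HY mA) => //.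
  - by move=> q; rewrite lee_fin; case: ifP => // _; rewrite invr_ge0 sqr_ge0.
  - apply: emeasurable_sum => j; apply: emeasurable_funM => //; exact: measurable_window.
  move=> y s _ s0 /=; under [leRHS]eq_bigr do rewrite -EFinM.
  rewrite sumEFin lee_fin; case: ifPn => [rs|_]; last by apply: sumr_ge0 => j _; rewrite mulr_ge0.
  have rs0 : 0 <= T - s - r0 by lra.
  pose j := Num.trunc (T - s - r0).
  have /andP[j1 j2] : j%:R <= T - s - r0 < j.+1%:R by exact: truncn_itv.
  have jJ : (j < J)%N by rewrite -(ltr_nat R); lra.
  rewrite -natr1 in j2.
  rewrite (bigD1_seq j) ?iota_uniq ?mem_index_iota//=.
  rewrite indicE mem_setE in_itv/= (_ : _ <= s <= _); last by lra.
  rewrite mulr1 -[leLHS]addr0 lerD ?sumr_ge0// => [|l _]; last by rewrite mulr_ge0.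
  rewrite /u lef_pV2 ?posrE ?exprn_gt0//; [|by have := ler0n R j; lra|by lra].
  by rewrite lerXn2r ?nnegrE//; have := ler0n R j; lra.
rewrite (renewal_sum_sum HY mA); last 2 first.
- by move=> j q; rewrite mule_ge0// lee_fin.
- by move=> j; apply: emeasurable_funM => //; exact: measurable_window.
apply: (@le_trans _ _ (\sum_(j <- index_iota 0 J) (u j * U)%:E)%E).
  apply: lee_sum => j _; rewrite (renewal_sumZl HY mA)//.
  - by rewrite EFinM lee_wpmul2l// lee_fin.
  - exact: measurable_window.
rewrite sumEFin lee_fin -mulr_suml mulrC ler_wpM2l//.
suff H n : \sum_(j <- index_iota 0 n) u j <= (r0 - 1)^-1 - (r0 - 1 + n%:R)^-1.
  by apply: le_trans (H J) _; rewrite lerBlDr lerDl invr_ge0; have := ler0n R J; lra.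
elim: n => [|n IH]; first by rewrite big_geq// addr0 subrr.
rewrite big_nat_recr//=; apply: le_trans (lerD IH (lexx _)) _.
rewrite -addrA lerD2l /u -natr1; have := ler0n R n; move: (n%:R) => z z0.
rewrite [leLHS]addrC -subr_ge0.
rewrite (_ : _ - _ = ((r0 + z) ^+ 2 * (r0 - 1 + z))^-1); first by rewrite invr_ge0 mulr_ge0// ?sqr_ge0//; lra.
by field; apply/andP; split; lra.
Qed.

End unit_bound.

(** * Drift of the Lyapunov function *)

Lemma conditional_probability {d} {T : measurableType d} {R : realType}
    (mu : {measure set T -> \bar R}) (D : set T) (p : R) (a : T) :
  measurable D -> mu D = p%:E -> 0 < p ->
  exists P : probability T R, forall f : T -> R, measurable_fun setT f ->
    (exists K, forall x, `|f x| <= K) -> \int[P]_x f x = p^-1 * \int[mu]_(x in D) f x.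
Proof.
move=> mD muD p0.
(* The Dirac mass is the default of [mnormalize] for a null restriction, excluded here by
   [0 < p]. *)
pose P : probability T R := mnormalize (mrestr mu mD) (dirac a : probability T R).
have PE U : P U = ((p^-1)%:E * mu (U `&` D))%E.
  rewrite /P /= /mnormalize/= /mrestr setTI muD eqe gt_eqF//= muleC.
  by [].
have PD : P (~` D) = 0%E by rewrite PE setICl measure0 mule0.
have P_ge0 (f : T -> \bar R) : measurable_fun setT f -> (forall x, 0 <= f x)%E ->
    (\int[P]_x f x = (p^-1)%:E * \int[mu]_(x in D) f x)%E.
  move=> mf f0; rewrite (ge0_negligible_integral (measurableC mD) measurableT mf (fun x _ => f0 x) PD) setTD setCK.
  have p1 : 0 <= p^-1 by rewrite invr_ge0 ltW.
  rewrite (eq_measure_integral (mscale (NngNum p1) mu)).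
    by rewrite ge0_integral_mscale//; exact: measurable_funTS.
  by move=> U mU UD; rewrite [LHS]PE setIidl.
exists P => f mf [K fK].
have K0 : 0 <= K by apply: le_trans (fK a).
have muDfin : (mu D < +oo)%E by rewrite muD ltry.
have iD (g : T -> R) M : measurable_fun setT g -> (forall x, `|g x| <= M) -> mu.-integrable D (EFin \o g).
  move=> mg gM; apply: measurable_bounded_integrable => //; first exact: measurable_funTS.
  by exists M; split; [exact: num_real|move=> z Mz x _; exact: le_trans (gM x) (ltW Mz)].
have iP (g : T -> R) M : measurable_fun setT g -> (forall x, `|g x| <= M) -> P.-integrable setT (EFin \o g).
  exact: bounded_integrable.
(* Adding the bound [K] reduces the signed case to the non-negative one, where the identity is
   known. *)
have : \int[P]_x (f x + K) = p^-1 * \int[mu]_(x in D) (f x + K).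
  rewrite /Rintegral P_ge0.
  - rewrite fineM//; apply: integrable_fin_num => //; apply: (iD _ (K + K)).
      exact: measurable_funD.
    by move=> z; apply: le_trans (ler_normD _ _) _; rewrite lerD// ger0_norm.
  - by apply/measurable_EFinP; exact: measurable_funD.
  - by move=> x; rewrite lee_fin -lerBlDr sub0r; have := fK x; rewrite ler_norml => /andP[].
have cK (x : T) : `|cst K x| <= K by rewrite ger0_norm.
rewrite !RintegralD//=; last 4 first.
- exact: iD fK.
- exact: (iD (cst K) K).
- exact: iP fK.
- exact: (iP (cst K) K).
rewrite Rintegral_prob_cst (_ : \int[mu]_(x in D) K = K * p); last first.
  by rewrite Rintegral_cst// muD.
by rewrite mulrDr mulrCA mulVf ?gt_eqF// mulr1 => /addIr.
Qed.

Section partition.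
Context {R : realType} {dS : measure_display} {S : measurableType dS} {I : finType}
  (D : pred I) (Sp : I -> set S).
Hypothesis mSp : forall i, measurable (Sp i).
Hypothesis disj : forall i j, i != j -> Sp i `&` Sp j = set0.

Lemma class_unique i j y : Sp i y -> Sp j y -> i = j.
Proof.
by move=> iy jy; apply/eqP; apply/negP => /negP /disj e; have : (Sp i `&` Sp j) y by []; rewrite e.
Qed.

Lemma measurable_class_union : measurable (\bigcup_(i in [set i | D i]) Sp i).
Proof. by apply: fin_bigcup_measurable => // i _. Qed.

Lemma integral_TD_union (mu : {measure set (S * R) -> \bar R}) (f : S * R -> \bar R) :
  measurable_fun setT f -> (forall p, TD setT p -> 0 <= f p)%E ->
  (\int[mu]_(p in TD (\bigcup_(i in [set i | D i]) Sp i)) f p =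
   \sum_(i | D i) \int[mu]_(p in TD (Sp i)) f p)%E.
Proof.
move=> mf f0.
have -> : TD (\bigcup_(i in [set i | D i]) Sp i) =
    \big[setU/set0]_(i <- enum D) (TD (Sp i) : set (S * R)).
  rewrite -bigcup_seq; apply/seteqP; split=> [p [[i Di ip] p2]|p [i + [ip p2]]].
    by exists i => //=; rewrite mem_enum.
  by rewrite /= mem_enum => Di; split=> //; exists i.
rewrite ge0_integral_bigsetU.
- by rewrite big_enum.
- by move=> i; exact: measurable_TD.
- exact: enum_uniq.
- by apply: sub_trivIset (_ : trivIset setT _) => //; apply/trivIsetP => i j _ _ /disj ij;
     apply/seteqP; split=> // p [[ip _] [jp _]]; have : (Sp i `&` Sp j) p.1 by []; rewrite ij.
- exact: measurable_funTS.
- move=> p; rewrite -bigcup_seq => -[i _ [_ p2]]; exact: f0.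
Qed.

End partition.

Section drift.
Context {R : realType} {dS : measure_display} {S : measurableType dS}
  (Q : R.-pker S ~> (S * R)%type) (y : S).
Hypothesis Q_supp : Q y (TD setT) = 1%E.

Let mTD : measurable (TD setT : set (S * R)). Proof. exact: measurable_TD. Qed.

Lemma measurable_snd_pow n : measurable_fun setT (fun p : S * R => p.2 ^+ n).
Proof. by apply: (@measurable_comp_snd _ _ _ (fun s => s ^+ n)); exact: exprn_measurable. Qed.

Lemma measurable_snd_exp (theta : R) : measurable_fun setT (fun p : S * R => expR (- (theta * p.2))).
Proof.
apply: (@measurable_comp_snd _ _ _ (fun s => expR (- (theta * s)))).
by apply: measurableT_comp => //; apply: measurableT_comp => //; exact: measurable_funM.
Qed.

(** Integrate [exp(-u) + u <= 1 + u^2], which follows from [exp(-u) <= 1/(1+u)]. The first-order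
    gain is [theta / 2], and the choice of [theta] makes the second-order loss [theta^2 * C] exactly
    half of it. *)
Lemma laplace_bound (C theta : R) : 0 < C -> theta = (4 * C)^-1 ->
  ((2^-1)%:E <= \int[Q y]_(p in TD setT) (p.2)%:E)%E ->
  (\int[Q y]_(p in TD setT) (p.2 ^+ 2)%:E <= C%:E)%E ->
  (\int[Q y]_(p in TD setT) (expR (- (theta * p.2)))%:E <= (1 - theta / 4)%:E)%E.
Proof.
move=> C0 thE m1 m2.
have th0 : 0 < theta by rewrite thE invr_gt0 mulr_gt0.
have mE := measurable_snd_exp theta.
have pos (p : S * R) : TD setT p -> 0 <= p.2 by case=> _ /=; rewrite in_itv/= andbT.
have mS : measurable_fun (TD setT) (fun p : S * R => (theta%:E * (p.2)%:E)%E).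
  by apply: emeasurable_funM => //; apply/measurable_EFinP; apply: measurable_funTS; exact: measurable_snd.
have mS2 : measurable_fun (TD setT) (fun p : S * R => ((theta ^+ 2)%:E * (p.2 ^+ 2)%:E)%E).
  by apply: emeasurable_funM => //; apply/measurable_EFinP; apply: measurable_funTS; exact: measurable_snd_pow.
have H : (\int[Q y]_(p in TD setT) ((expR (- (theta * p.2)))%:E + theta%:E * (p.2)%:E) <=
    \int[Q y]_(p in TD setT) (1 + (theta ^+ 2)%:E * (p.2 ^+ 2)%:E))%E.
  apply: ge0_le_integral => //.
  - by move=> p /pos p0; rewrite -EFinM -EFinD lee_fin addr_ge0 ?expR_ge0// mulr_ge0// ltW.
  - by apply: emeasurable_funD => //; apply/measurable_EFinP; exact: measurable_funTS.
  - exact: emeasurable_funD.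
  move=> p /pos p0; rewrite -!EFinM -!EFinD lee_fin.
  have u0 : 0 <= theta * p.2 by rewrite mulr_ge0// ltW.
  rewrite -exprMn; move: (theta * p.2) u0 => u u0.
  rewrite expRN; have u1 : 0 < 1 + u by lra.
  apply: (@le_trans _ _ ((1 + u)^-1 + u)).
    by rewrite lerD2r lef_pV2 ?posrE ?expR_gt0 ?expR_ge1Dx.
  rewrite -(ler_pM2r u1) mulrDl mulVf ?gt_eqF//.
  by have := mulr_ge0 u0 (sqr_ge0 u); lra.
have mE' : measurable_fun (TD setT) (fun p : S * R => (expR (- (theta * p.2)))%:E).
  by apply/measurable_EFinP; exact: measurable_funTS.
have mI n : measurable_fun (TD setT) (fun p : S * R => (p.2 ^+ n)%:E).
  by apply/measurable_EFinP; apply: measurable_funTS; exact: measurable_snd_pow.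
have p_exp (p : S * R) : TD setT p -> (0 <= (expR (- (theta * p.2)))%:E)%E by move=> _; rewrite lee_fin expR_ge0.
have p_s (p : S * R) : TD setT p -> (0 <= (p.2)%:E)%E by move=> h; rewrite lee_fin; exact: pos.
have p_s2 (p : S * R) : TD setT p -> (0 <= (p.2 ^+ 2)%:E)%E by move=> _; rewrite lee_fin sqr_ge0.
have p_ts (p : S * R) : TD setT p -> (0 <= theta%:E * (p.2)%:E)%E.
  by move=> /p_s ?; rewrite mule_ge0// lee_fin ltW.
have p_ts2 (p : S * R) : TD setT p -> (0 <= (theta ^+ 2)%:E * (p.2 ^+ 2)%:E)%E.
  by move=> /p_s2 ?; rewrite mule_ge0// lee_fin sqr_ge0.
have th0e : (0 <= theta%:E)%E by rewrite lee_fin ltW.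
have th2e : (0 <= (theta ^+ 2)%:E)%E by rewrite lee_fin sqr_ge0.
rewrite (ge0_integralD _ mTD p_exp mE' p_ts mS) in H.
rewrite (ge0_integralD _ mTD (fun _ _ => lee01) (measurable_cst _) p_ts2 mS2) in H.
rewrite (ge0_integralZl _ mTD (mI 1%N) p_s th0e) (ge0_integralZl _ mTD (mI 2%N) p_s2 th2e) in H.
rewrite integral_cst//= mul1e Q_supp in H.
have {}H : (\int[Q y]_(p in TD setT) (expR (- (theta * p.2)))%:E + (theta / 2)%:E <= (1 + theta / 4)%:E)%E.
  apply: (le_trans (le_trans _ H)).
    by rewrite leeD2l// EFinM lee_wpmul2l// lee_fin ltW.
  rewrite EFinD leeD2l//; apply: le_trans (lee_wpmul2l _ m2) _; first by rewrite lee_fin sqr_ge0.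
  rewrite -EFinM lee_fin expr2 -mulrA ler_wpM2l ?(ltW th0)//.
  by rewrite thE invfM mulfVK// gt_eqF.
rewrite -leeBrDr// in H; apply: (le_trans H).
by rewrite -EFinB lee_fin; lra.
Qed.

Context {I : finType} (D : pred I) (Sp : I -> set S).
Hypothesis mSp : forall i, measurable (Sp i).
Hypothesis disj : forall i j, i != j -> Sp i `&` Sp j = set0.
Local Notation A := (\bigcup_(i in [set i | D i]) Sp i).

Definition class_fun (V : I -> R) (z : S) : R := \sum_(i | D i) V i * \1_(Sp i) z.

Lemma class_funE V i z : D i -> Sp i z -> class_fun V z = V i.
Proof.
move=> Di iz; rewrite /class_fun (bigD1 i)//= indicE mem_set// mulr1 big1 ?addr0// => j /andP[_ ji].
by rewrite indicE memNset ?mulr0// => jz; move: ji; rewrite (class_unique disj jz iz) eqxx.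
Qed.

Lemma class_fun_out V z : ~ A z -> class_fun V z = 0.
Proof.
move=> Az; rewrite /class_fun big1// => i Di; rewrite indicE memNset ?mulr0// => iz.
by apply: Az; exists i.
Qed.

Lemma measurable_class_fun V : measurable_fun setT (class_fun V).
Proof.
rewrite (_ : class_fun V = fun z => \sum_(i <- enum D) V i * \1_(Sp i) z).
  by apply: measurable_sum => i; apply: measurable_funM => //; exact: measurable_indic.
by apply/funext => z; rewrite big_enum.
Qed.

Lemma Pk_fin B : measurable B -> Q y (TD B) = (Pk Q y B)%:E.
Proof.
move=> mB; rewrite /Pk fineK// ge0_fin_numE//.
apply: (@le_lt_trans _ _ 1%E); last exact: ltry.
rewrite -(@prob_kernel _ _ _ _ _ Q y); apply: le_measure; rewrite ?inE//; exact: measurable_TD.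
Qed.

Lemma Pk_sum_le1 : \sum_(j | D j) Pk Q y (Sp j) <= 1.
Proof.
rewrite -lee_fin -sumEFin.
have := @integral_TD_union _ _ _ _ D Sp mSp disj (Q y) (cst 1%E) (measurable_cst _) (fun _ _ => lee01).
rewrite integral_cst ?mul1e; last by apply: measurable_TD; exact: measurable_class_union.
rewrite (eq_bigr (fun i => (Pk Q y (Sp i))%:E)) => [<-|i _]; last first.
  by rewrite integral_cst ?mul1e ?Pk_fin//; exact: measurable_TD.
rewrite -Q_supp; apply: le_measure; rewrite ?inE//.
  by apply: measurable_TD; exact: measurable_class_union.
by move=> p [_ ?]; split.
Qed.

(** Away from [i0] the discount can only help and [W] falls by [c]. At [i0] the sum of the [W j] may
    be as large as 1, but the discount removes [L * theta / 4] from the constant part [L], which is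
    at least [1 + c]. *)
Lemma drift_bound (W : I -> R) (L theta c : R) i0 i : D i -> Sp i y -> 0 <= L -> 0 <= theta ->
  (forall j, 0 <= W j <= 1) ->
  (i != i0 -> \sum_(j | D j) Pk Q y (Sp j) * W j <= W i - c) ->
  (i = i0 -> (\int[Q y]_(p in TD setT) (expR (- (theta * p.2)))%:E <= (1 - theta / 4)%:E)%E) ->
  1 + c <= L * (theta / 4) ->
  (\int[Q y]_(p in TD A) (class_fun (fun j => L + W j) p.1 * expR (- (theta * p.2)))%:E <=
    (class_fun (fun j => L + W j) y - c)%:E)%E.
Proof.
move=> Di iy L0 th0 W01 Hi Hi0 Lc.
have mE := measurable_snd_exp theta.
have mA : measurable A by exact: measurable_class_union.
have V0 z : 0 <= class_fun (fun j => L + W j) z.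
  by apply: sumr_ge0 => j _; rewrite mulr_ge0// addr_ge0//; have /andP[] := W01 j.
rewrite (integral_TD_union D mSp disj) //; last 2 first.
- apply/measurable_EFinP; apply: measurable_funM => //.
  by apply: measurableT_comp (measurable_class_fun _) measurable_fst.
- by move=> p _; rewrite lee_fin mulr_ge0// expR_ge0.
have mEj j : measurable_fun (TD (Sp j)) (fun p : S * R => (expR (- (theta * p.2)))%:E).
  by apply/measurable_EFinP; exact: measurable_funTS.
have E1 : (\int[Q y]_(p in TD setT) (expR (- (theta * p.2)))%:E <= 1)%E.
  apply: (@le_trans _ _ (\int[Q y]_(p in TD setT) (cst 1 p))%E); last first.
    by rewrite integral_cst// mul1e Q_supp.
  apply: ge0_le_integral => //.
  - by apply/measurable_EFinP; exact: measurable_funTS.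
  - by move=> p [_ /=]; rewrite in_itv/= andbT => p2; rewrite lee_fin -expR0 ler_expR oppr_le0 mulr_ge0.
pose E := fine (\int[Q y]_(p in TD setT) (expR (- (theta * p.2)))%:E).
have E0 : (0 <= \int[Q y]_(p in TD setT) (expR (- (theta * p.2)))%:E)%E.
  by apply: integral_ge0 => p _; rewrite lee_fin expR_ge0.
have EE : (\int[Q y]_(p in TD setT) (expR (- (theta * p.2)))%:E = E%:E)%E.
  by rewrite fineK// ge0_fin_numE//; apply: le_lt_trans E1 (ltry _).
have H : (\sum_(j | D j) \int[Q y]_(p in TD (Sp j))
      (class_fun (fun j => L + W j) p.1 * expR (- (theta * p.2)))%:E <=
    (L * E)%:E + (\sum_(j | D j) Pk Q y (Sp j) * W j)%:E)%E.
  apply: (@le_trans _ _ (\sum_(j | D j) (L%:E * (\int[Q y]_(p in TD (Sp j)) (expR (- (theta * p.2)))%:E) +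
      (Pk Q y (Sp j) * W j)%:E))%E).
    apply: lee_sum => j Dj; have /andP[Wj0 _] := W01 j.
    have -> : (\int[Q y]_(p in TD (Sp j)) (class_fun (fun j => L + W j) p.1 * expR (- (theta * p.2)))%:E =
        (L + W j)%:E * \int[Q y]_(p in TD (Sp j)) (expR (- (theta * p.2)))%:E)%E.
      rewrite -ge0_integralZl//.
      - by apply: eq_integral => p /set_mem[pj _]; rewrite (class_funE _ Dj pj) EFinM.
      - exact: measurable_TD.
      - by rewrite lee_fin addr_ge0.
    rewrite EFinD ge0_muleDl ?lee_fin// leeD2l// mulrC EFinM lee_wpmul2l ?lee_fin//.
    rewrite -Pk_fin// -[leRHS]mul1e -integral_cst; last exact: measurable_TD.
    apply: ge0_le_integral => //.
    - exact: measurable_TD.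
    - by move=> p [_ /=]; rewrite in_itv/= andbT => p2; rewrite lee_fin -expR0 ler_expR oppr_le0 mulr_ge0.
  rewrite big_split/= sumEFin leeD2r// EFinM -EE -ge0_sume_distrr; last first.
    by move=> j _; apply: integral_ge0 => p _; rewrite lee_fin expR_ge0.
  rewrite lee_wpmul2l ?lee_fin// -(integral_TD_union D mSp disj); last 2 first.
  - exact/measurable_EFinP.
  - by move=> p _; rewrite lee_fin expR_ge0.
  apply: ge0_subset_integral => //.
  - exact: measurable_TD.
  - by apply/measurable_EFinP; exact: measurable_funTS.
  - by move=> p [_ ?]; split.
apply: (le_trans H); rewrite -EFinD lee_fin (class_funE _ Di iy).
have E1' : E <= 1 by rewrite -lee_fin -EE.
have [ii0|ii0] := eqVneq i i0; last first.
  have := Hi ii0; have := ler_wpM2l L0 E1'; lra.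
have := Hi0 ii0; rewrite EE lee_fin => /(ler_wpM2l L0).
have : \sum_(j | D j) Pk Q y (Sp j) * W j <= 1.
  apply: le_trans Pk_sum_le1; apply: ler_sum => j _; rewrite ler_piMr//.
    exact: fine_ge0.
  by have /andP[] := W01 j.
have /andP[] := W01 i; lra.
Qed.

End drift.

(** * Real-valued renewal functionals *)

Section renewal_functional.
Context {R : realType} {dS : measure_display} {S : measurableType dS}
  {dO : measure_display} {O : measurableType dO}
  (Pr : probability O R) (Q : R.-pker S ~> (S * R)%type) (x : S)
  (Y : nat -> O -> S * R) (A : set S) (U : R).
Hypothesis HY : is_MRchain Pr Q x Y.
Hypothesis mA : measurable A.
Hypothesis Ax : A x.
Local Notation rsum := (renewal_sum Pr Y A).
Hypothesis unit_bound : forall a, (rsum (fun q => (\1_`[a, (a + 1)%R] q.2)%:E) <= U%:E)%E.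

(** [fine] sends an infinite sum to 0; the predicate [tame] below marks the functions for which the
    real value is faithful. *)
Definition renewal_fun (f : S * R -> R) : R := fine (rsum (EFin \o f)).

Definition tame (f : S * R -> R) : Prop :=
  [/\ measurable_fun setT f, forall q, 0 <= f q & (rsum (EFin \o f) < +oo)%E].

Local Notation G := renewal_fun.

Lemma renewal_funE f : tame f -> rsum (EFin \o f) = (G f)%:E.
Proof.
case=> mf f0 ff; rewrite /G fineK// ge0_fin_numE//.
by apply: renewal_sum_ge0 => q; rewrite lee_fin.
Qed.

Lemma renewal_fun_ge0 f : (forall q, 0 <= f q) -> 0 <= G f.
Proof. by move=> f0; apply: fine_ge0; apply: renewal_sum_ge0 => q; rewrite lee_fin. Qed.

Let mE (f : S * R -> R) : measurable_fun setT f -> measurable_fun setT (EFin \o f).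
Proof. by move=> mf; exact/measurable_EFinP. Qed.

Lemma renewal_fun_leE f c : tame f -> (rsum (EFin \o f) <= c%:E)%E -> G f <= c.
Proof. by move=> tf; rewrite renewal_funE// lee_fin. Qed.

Lemma tame_le (f g : S * R -> R) : measurable_fun setT f -> (forall q, 0 <= f q) -> tame g ->
  (forall y (s : R), A y -> 0 <= s -> f (y, s) <= g (y, s)) -> tame f.
Proof.
move=> mf f0 [mg g0 gfin] fg; split=> //; apply: le_lt_trans gfin.
by apply: (le_renewal_sum HY mA) => //; exact: mE.
Qed.

Lemma renewal_fun_le f g : tame f -> tame g ->
  (forall y (s : R), A y -> 0 <= s -> f (y, s) <= g (y, s)) -> G f <= G g.
Proof.
move=> tf tg fg; rewrite -lee_fin -!renewal_funE//.
have [mf f0 _] := tf; have [mg g0 _] := tg.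
by apply: (le_renewal_sum HY mA) => //; exact: mE.
Qed.

Let rsumD f g : tame f -> tame g -> rsum (EFin \o (fun q => f q + g q)) = (G f + G g)%:E.
Proof.
move=> tf tg; have [mf f0 _] := tf; have [mg g0 _] := tg.
rewrite EFinD -!renewal_funE//; apply: (renewal_sumD HY mA (f := EFin \o f) (g := EFin \o g)); try exact: mE.
- by move=> q; rewrite lee_fin.
- by move=> q; rewrite lee_fin.
Qed.

Lemma tameD f g : tame f -> tame g -> tame (fun q => f q + g q).
Proof.
move=> tf tg; have [mf f0 _] := tf; have [mg g0 _] := tg; split.
- exact: measurable_funD.
- by move=> q; rewrite addr_ge0.
- by rewrite rsumD// ltry.
Qed.

Lemma renewal_funD f g : tame f -> tame g -> G (fun q => f q + g q) = G f + G g.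
Proof. by move=> tf tg; rewrite {1}/G rsumD. Qed.

Let rsumZ c f : 0 <= c -> tame f -> rsum (EFin \o (fun q => c * f q)) = (c * G f)%:E.
Proof.
move=> c0 tf; have [mf f0 _] := tf.
rewrite EFinM -renewal_funE//; apply: (renewal_sumZl HY mA (f := EFin \o f)) => //; exact: mE.
Qed.

Lemma tameZ c f : 0 <= c -> tame f -> tame (fun q => c * f q).
Proof.
move=> c0 tf; have [mf f0 _] := tf; split.
- exact: measurable_funM.
- by move=> q; rewrite mulr_ge0.
- by rewrite rsumZ// ltry.
Qed.

Lemma renewal_funZ c f : 0 <= c -> tame f -> G (fun q => c * f q) = c * G f.
Proof. by move=> c0 tf; rewrite {1}/G rsumZ. Qed.

Lemma tame0 : tame (fun _ => 0).
Proof.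
split=> //; rewrite (_ : rsum _ = 0%E) ?ltry//.
apply: eseries0 => n _ _; exact: integral0.
Qed.

Lemma tame_sum (J : Type) (r : seq J) (f : J -> S * R -> R) :
  (forall j, tame (f j)) -> tame (fun q => \sum_(j <- r) f j q).
Proof.
move=> tf; elim: r => [|j r IH].
  by rewrite (_ : (fun _ => _) = fun _ => 0); [exact: tame0|by apply/funext => q; rewrite big_nil].
rewrite (_ : (fun _ => _) = fun q => f j q + \sum_(j <- r) f j q); first exact: tameD.
by apply/funext => q; rewrite big_cons.
Qed.

Lemma renewal_fun_sum (J : Type) (r : seq J) (f : J -> S * R -> R) :
  (forall j, tame (f j)) -> G (fun q => \sum_(j <- r) f j q) = \sum_(j <- r) G (f j).
Proof.
move=> tf; elim: r => [|j r IH].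
  rewrite big_nil /G (_ : rsum _ = 0%E)//; apply: eseries0 => n _ _.
  by under eq_integral do rewrite /= big_nil; exact: integral0.
rewrite (_ : (fun _ => _) = fun q => f j q + \sum_(j <- r) f j q).
  by rewrite renewal_funD ?big_cons ?IH//; exact: tame_sum.
by apply/funext => q; rewrite big_cons.
Qed.

Lemma tame_window a k : tame (fun q => \1_`[a, a + k%:R] q.2).
Proof.
split=> //.
- by apply: (@measurable_comp_snd _ _ _ (\1_`[a, a + k%:R])); exact: measurable_indic.
- exact: le_lt_trans (renewal_window_bound HY mA unit_bound a k) (ltry _).
Qed.

Lemma renewal_fun_window a k : G (fun q => \1_`[a, a + k%:R] q.2) <= U * k.+1%:R.
Proof.
apply: renewal_fun_leE; first exact: tame_window.
exact: (renewal_window_bound HY mA unit_bound a k).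
Qed.

Lemma U_ge0 : 0 <= U.
Proof.
by rewrite -lee_fin; apply: le_trans (unit_bound 0); apply: renewal_sum_ge0 => // q; rewrite lee_fin.
Qed.

Lemma tame_bounded (f : S * R -> R) K a k : measurable_fun setT f -> (forall q, 0 <= f q) -> 0 <= K ->
  (forall y (s : R), A y -> 0 <= s -> f (y, s) <= K * \1_`[a, a + k%:R] s) ->
  tame f /\ G f <= K * (U * k.+1%:R).
Proof.
move=> mf f0 K0 fK.
have tw : tame (fun q => K * \1_`[a, a + k%:R] q.2) by apply: tameZ => //; exact: tame_window.
have tf : tame f by apply: tame_le tw _.
split=> //; apply: le_trans (renewal_fun_le tf tw fK) _.
rewrite renewal_funZ//; last exact: tame_window.
by rewrite ler_wpM2l// renewal_fun_window.
Qed.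

Let mtail T r0 : 1 < r0 -> measurable_fun setT (fun q : S * R => if r0 < T - q.2 then (T - q.2) ^- 2 else 0).
Proof.
move=> r1; apply: (@measurable_comp_snd _ _ _ (fun s => if r0 < T - s then (T - s) ^- 2 else 0)).
exact: measurable_tail.
Qed.

Lemma tame_tail T r0 : 1 < r0 ->
  tame (fun q => if r0 < T - q.2 then (T - q.2) ^- 2 else 0).
Proof.
move=> r1; split; first exact: mtail.
  by move=> q; case: ifP => // _; rewrite invr_ge0 sqr_ge0.
exact: le_lt_trans (renewal_tail_bound HY mA unit_bound T r1) (ltry _).
Qed.

Lemma renewal_fun_tail T r0 : 1 < r0 ->
  G (fun q => if r0 < T - q.2 then (T - q.2) ^- 2 else 0) <= U / (r0 - 1).
Proof.
move=> r1; apply: renewal_fun_leE; first exact: tame_tail.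
exact: (renewal_tail_bound HY mA unit_bound T r1).
Qed.

Lemma renewal_fun_fubini (nu : probability R R) (f : (S * R) * R -> R) K :
  measurable_fun setT f -> (forall z, 0 <= f z <= 1) ->
  (forall r, tame (fun q => f (q, r)) /\ G (fun q => f (q, r)) <= K) ->
  measurable_fun setT (fun r => G (fun q => f (q, r))) ->
  tame (fun q => \int[nu]_r f (q, r)) /\
  G (fun q => \int[nu]_r f (q, r)) = \int[nu]_r G (fun q => f (q, r)).
Proof.
move=> mf f01 tK mG.
have f0 z : 0 <= f z by have /andP[] := f01 z.
have fE q : (\int[nu]_r (f (q, r))%:E)%E = (\int[nu]_r f (q, r))%:E.
  rewrite /Rintegral fineK//; apply: integrable_fin_num => //; apply: (@bounded_integrable _ _ _ nu _ 1).
    by apply: measurableT_comp mf _; exact: measurable_pair1.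
  by move=> r; have /andP[? ?] := f01 (q, r); rewrite ger0_norm.
have E : rsum (EFin \o (fun q => \int[nu]_r f (q, r))) = (\int[nu]_r (G (fun q => f (q, r)))%:E)%E.
  have := @renewal_sum_fubini _ _ _ _ _ Pr Q x Y A HY mA nu (EFin \o f).
  have -> : (fun q => \int[nu]_r (EFin \o f) (q, r))%E = EFin \o (fun q => \int[nu]_r f (q, r)).
    by apply/funext => q; rewrite /= -fE.
  move=> ->.
  - by apply: eq_integral => r _; rewrite -(renewal_funE (tK r).1).
  - by move=> z; rewrite lee_fin.
  - exact/measurable_EFinP.
split; last by rewrite {1}/G E.
split.
- apply/measurable_EFinP; rewrite (_ : _ \o _ = fun q => (\int[nu]_r (f (q, r))%:E)%E).
    apply: (@measurable_fun_fubini_tonelli_F _ _ _ _ _ nu (EFin \o f)).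
      exact/measurable_EFinP.
    by move=> z; rewrite lee_fin.
  by apply/funext => q; rewrite fE.
- by move=> q; apply: Rintegral_ge0.
- rewrite E; apply: (@le_lt_trans _ _ (\int[nu]_r (cst K%:E r))%E); last by rewrite integral_prob_cst ltry.
  apply: ge0_le_integral => //.
  + by move=> r _; rewrite lee_fin renewal_fun_ge0.
  + exact/measurable_EFinP.
  + by move=> r _; rewrite lee_fin; exact: (tK r).2.
Qed.

End renewal_functional.

(** * The forward renewal equation *)

Section bump.
Context {R : realType} {dS : measure_display} {S : measurableType dS}
  {dO : measure_display} {O : measurableType dO}
  (Pr : probability O R) (Q : R.-pker S ~> (S * R)%type) (x : S)
  (Y : nat -> O -> S * R) (U : R)
  {I : finType} (D : pred I) (Sp : I -> set S).
Hypothesis mSp : forall i, measurable (Sp i).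
Hypothesis disj : forall i j, i != j -> Sp i `&` Sp j = set0.
Local Notation A := (\bigcup_(i in [set i | D i]) Sp i).
Hypothesis HY : is_MRchain Pr Q x Y.
Hypothesis Ax : A x.
Local Notation rsum := (renewal_sum Pr Y A).
Local Notation G := (renewal_fun Pr Y A).
Local Notation tame := (tame Pr Y A).
Hypothesis unit_bound : forall a, (rsum (fun q => (\1_`[a, (a + 1)%R] q.2)%:E) <= U%:E)%E.
Context (phi : R -> R) (L t : R).
Hypothesis phi_ge0 : forall r, 0 <= phi r.
Hypothesis phi_le1 : forall r, phi r <= 1.
Hypothesis phi_lip : forall r s, `|phi r - phi s| <= L * `|r - s|.
Hypothesis phi_supp : forall r, phi r != 0 -> -1 <= r <= 1.

Let mA : measurable A. Proof. exact: measurable_class_union. Qed.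
Let L0 : 0 <= L.
Proof. by have := phi_lip 0 1; rewrite sub0r normrN normr1 mulr1; apply: le_trans. Qed.
Let mphi : measurable_fun setT phi. Proof. exact: continuous_measurable (lipschitz_cont phi_lip). Qed.

Definition bump (i : I) (u : R) (q : S * R) : R := \1_(Sp i) q.1 * phi (t - u - q.2).

Lemma bump_ge0 i u q : 0 <= bump i u q. Proof. by rewrite mulr_ge0. Qed.

Lemma measurable_bump i u : measurable_fun setT (bump i u).
Proof.
apply: measurable_funM.
  by apply: measurableT_comp measurable_fst; exact: measurable_indic.
apply: (@measurable_comp_snd _ _ _ (fun s => phi (t - u - s))).
by apply: measurableT_comp mphi _; exact: measurable_funB.
Qed.

Let window u (s : R) : R := \1_`[t - u - 1, t - u - 1 + 2%:R] s.

Let windowE u s : window u s = (-1 <= t - u - s <= 1)%R%:R.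
Proof.
rewrite /window indicE mem_setE in_itv/=; congr (_%:R); congr nat_of_bool.
by apply/idP/idP => ?; lra.
Qed.

Let bump_window i u y s : bump i u (y, s) <= window u s.
Proof.
rewrite windowE /bump/=; have [|/negP h] := boolP (-1 <= t - u - s <= 1).
  by move=> _; rewrite mulr_ile1// indicE lern1 leq_b1.
by rewrite (_ : phi _ = 0) ?mulr0//; apply/eqP; apply: contra_notT h; exact: phi_supp.
Qed.

Lemma tame_bump_le i u : tame (bump i u) /\ G (bump i u) <= 3 * U.
Proof.
have := tame_bounded HY mA unit_bound (measurable_bump i u) (@bump_ge0 i u) ler01
  (a := t - u - 1) (k := 2%N).
rewrite mul1r mulrC; apply=> y s _ _; rewrite mul1r; exact: bump_window.
Qed.

Let tame_bump i u : tame (bump i u). Proof. exact: (tame_bump_le i u).1. Qed.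

(** The two bumps differ by at most [L * |u - v|], and only on two windows of length 2, each of
    renewal mass at most [3 * U]. *)
Lemma bump_lip i u v : `|G (bump i u) - G (bump i v)| <= 6 * L * U * `|u - v|.
Proof.
wlog H : u v / G (bump i v) <= G (bump i u).
  move=> H; case/orP: (le_total (G (bump i v)) (G (bump i u))) => /H//.
  by rewrite distrC [X in _ <= _ * X]distrC.
rewrite ger0_norm ?subr_ge0//.
have tw w : tame (fun q => window w q.2) by exact: (tame_window HY mA unit_bound).
have tww : tame (fun q => window u q.2 + window v q.2) by exact: (tameD HY mA (tw u) (tw v)).
have c0 : 0 <= L * `|u - v| by rewrite mulr_ge0.
have : G (bump i u) <= G (fun q => bump i v q + (L * `|u - v|) * (window u q.2 + window v q.2)).
  apply: (renewal_fun_le HY mA) => //.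
    by apply: (tameD HY mA) => //; exact: (tameZ HY mA).
  move=> y s _ _; rewrite -lerBlDl /bump/= -mulrBr.
  have [uv0|] := boolP ((phi (t - u - s) == 0) && (phi (t - v - s) == 0)).
    case/andP: uv0 => /eqP -> /eqP ->; rewrite subrr mulr0 mulr_ge0// addr_ge0//; by rewrite windowE.
  have w1 w : phi (t - w - s) != 0 -> window w s = 1 by rewrite windowE => /phi_supp ->.
  have w0 w : 0 <= window w s by rewrite windowE.
  rewrite negb_and => h; apply: (@le_trans _ _ (L * `|u - v| * 1)); last first.
    rewrite ler_wpM2l//; have := w0 u; have := w0 v.
    by case/orP: h => /w1 ->; lra.
  rewrite mulr1; apply: le_trans (ler_norm _) _; rewrite normrM -[leRHS]mul1r ler_pM//.
    by rewrite indicE normr_nat lern1 leq_b1.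
  apply: le_trans (phi_lip _ _) _; rewrite (_ : _ - _ - _ = v - u); last by ring.
  by rewrite distrC.
rewrite (renewal_funD HY mA)//; last exact: (tameZ HY mA).
rewrite (renewal_funZ HY mA)// (renewal_funD HY mA)//.
have gw w : G (fun q => window w q.2) <= U * 3 by exact: (renewal_fun_window HY mA unit_bound).
move=> h; rewrite lerBlDl; apply: (le_trans h); rewrite lerD2l.
apply: le_trans (ler_wpM2l c0 (lerD (gw u) (gw v))) _.
by rewrite le_eqVlt; apply/orP; left; apply/eqP; ring.
Qed.

Let bump_step k u (q : S * R) : D k ->
  renewal_step Q A (EFin \o bump k u) q = momT Q q.1 (Sp k) (fun z => phi (t - u - q.2 - z)).
Proof.
move=> Dk; rewrite /renewal_step (integral_TD_union D mSp disj); last 2 first.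
- apply/measurable_EFinP; apply: measurableT_comp (measurable_bump k u) _.
  apply/measurable_fun_pairP; split=> /=; first exact: measurable_fst.
  by apply: measurable_funD => //; exact: measurable_snd.
- by move=> p _; rewrite lee_fin bump_ge0.
rewrite (bigD1 k)//= big1 ?adde0 => [|i /andP[Di ik]].
  apply: eq_integral => p /set_mem[pk _]; rewrite /bump/= indicE mem_set// mul1r.
  by congr (phi _)%:E; ring.
apply: integral0_eq => p [pi _]; rewrite /bump/= indicE memNset ?mul0r// => pk.
by move: ik; rewrite (class_unique disj pi pk) eqxx.
Qed.

(* The error allowed in the one-step law is uniform on a window of length [N] and of Chebyshev type
   beyond it, where uniform closeness to the limit law is not available. *)
Lemma forward_equation (P : I -> I -> R) (nu : I -> probability R R) (eta C : R) (N : nat) k u :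
  D k -> (forall i, 0 <= P i k) -> 0 <= eta -> 0 <= C -> (3 < N)%N ->
  (forall i y r, D i -> Sp i y ->
    `|fine (momT Q y (Sp k) (fun z => phi (r - z))) - P i k * \int[nu i]_z phi (r - z)| <=
    eta * \1_`[-1, -1 + N%:R] r + C * (if N%:R - 2 < r - 1 then (r - 1) ^- 2 else 0)) ->
  `|G (bump k u) - \sum_(i | D i) P i k * \int[nu i]_z G (bump i (u + z))| <=
    phi (t - u) + eta * (U * N.+1%:R) + C * (U / (N%:R - 3)).
Proof.
move=> Dk P0 eta0 C0 N3 H.
have N3' : 3 < N%:R :> R by rewrite ltr_nat.
(* Exact expectation of the bump at the next renewal. Below, [approx] replaces the kernel by the
   limit law, at the cost of [err]. *)
pose st (q : S * R) := fine (momT Q q.1 (Sp k) (fun z => phi (t - u - q.2 - z))).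
have st0 q : 0 <= st q by apply: fine_ge0; apply: integral_ge0 => p _; rewrite lee_fin.
have stE : renewal_step Q A (EFin \o bump k u) = EFin \o st.
  apply/funext => q; rewrite bump_step//= /st fineK// ge0_fin_numE; last first.
    by apply: integral_ge0 => p _; rewrite lee_fin.
  apply: (@le_lt_trans _ _ (\int[Q q.1]_(p in TD (Sp k)) (cst 1%E p))%E).
    apply: ge0_le_integral => //.
    - exact: measurable_TD.
    - by move=> p _; rewrite lee_fin.
    - apply/measurable_EFinP; apply: measurable_funTS.
      apply: (@measurable_comp_snd _ _ _ (fun s => phi (t - u - q.2 - s))).
      by apply: measurableT_comp mphi _; exact: measurable_funB.
    - by move=> p _; rewrite lee_fin.
  by rewrite integral_cst ?mul1e; [rewrite Pk_fin// ltry|exact: measurable_TD].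
have b0 q : (0 <= (EFin \o bump k u) q)%E by rewrite lee_fin bump_ge0.
have mb : measurable_fun setT (EFin \o bump k u) by apply/measurable_EFinP; exact: measurable_bump.
have RE := renewal_equation HY mA Ax b0 mb; rewrite stE in RE.
have tst : tame st.
  split=> //.
  - by apply/measurable_EFinP; rewrite -stE; exact: measurable_renewal_step.
  - apply: le_lt_trans (_ : (rsum (EFin \o bump k u) < +oo)%E); last by case: (tame_bump k u).
    by rewrite RE leeDr.
have GE : G (bump k u) = bump k u (x, 0) + G st.
  by rewrite {1}/renewal_fun RE (renewal_funE tst) -EFinD.
pose approx (q : S * R) := \sum_(i <- enum D) P i k * \int[nu i]_z bump i (u + z) q.
have mGb i : measurable_fun setT (fun r => G (bump i (u + r))).
  apply: continuous_measurable; apply: (@lipschitz_cont _ _ (6 * L * U)) => r s.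
  by have := bump_lip i (u + r) (u + s); rewrite (_ : u + r - (u + s) = r - s)//; ring.
have fub i : tame (fun q => \int[nu i]_z bump i (u + z) q) /\
    G (fun q => \int[nu i]_z bump i (u + z) q) = \int[nu i]_z G (bump i (u + z)).
  apply: (@renewal_fun_fubini _ _ _ _ _ Pr Q x Y A HY mA (nu i) (fun z => bump i (u + z.2) z.1) (3 * U)).
  - apply: measurable_funM.
      apply: measurableT_comp (_ : measurable_fun setT (fst \o fst)); first exact: measurable_indic.
      by apply: measurableT_comp => //; exact: measurable_fst.
    apply: measurableT_comp mphi _; apply: measurable_funB.
      by apply: measurable_funB => //; apply: measurable_funD => //; exact: measurable_snd.
    by apply: measurableT_comp.
  - by move=> z; rewrite bump_ge0/= mulr_ile1// indicE lern1 leq_b1.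
  - by move=> r; exact: (tame_bump_le i (u + r)).
  - exact: (mGb i).
have tapi i := tameZ HY mA (P0 i) (fub i).1.
have tap : tame approx by exact: (tame_sum HY mA (enum D) tapi).
have Gap : G approx = \sum_(i | D i) P i k * \int[nu i]_z G (bump i (u + z)).
  rewrite (renewal_fun_sum HY mA (enum D) tapi) big_enum/=; apply: eq_bigr => i _.
  by rewrite (renewal_funZ HY mA (P0 i) (fub i).1) (fub i).2.
(* With [r = t - u - q.2], [win] and [tail] are the two error terms of the hypothesis read as
   functions of the renewal time. *)
pose win (q : S * R) : R := \1_`[t - u + 1 - N%:R, t - u + 1 - N%:R + N%:R] q.2.
pose tail (q : S * R) : R := if N%:R - 2 < t - u - 1 - q.2 then (t - u - 1 - q.2) ^- 2 else 0.
have r1 : 1 < N%:R - 2 :> R by lra.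
have twin : tame win by exact: (tame_window HY mA unit_bound).
have ttail : tame tail by exact: (tame_tail HY mA unit_bound).
pose err (q : S * R) := eta * win q + C * tail q.
have twin' := tameZ HY mA eta0 twin.
have ttail' := tameZ HY mA C0 ttail.
have terr : tame err by exact: (tameD HY mA twin' ttail').
have Gerr : G err <= eta * (U * N.+1%:R) + C * (U / (N%:R - 3)).
  rewrite (renewal_funD HY mA twin' ttail').
  rewrite (renewal_funZ HY mA eta0 twin) (renewal_funZ HY mA C0 ttail); apply: lerD; apply: ler_wpM2l => //.
    exact: (renewal_fun_window HY mA unit_bound).
  apply: le_trans (renewal_fun_tail HY mA unit_bound _ r1) _.
  by rewrite (_ : N%:R - 2 - 1 = N%:R - 3)//; ring.
have key y (s : R) : A y -> `|st (y, s) - approx (y, s)| <= err (y, s).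
  move=> [i Di iy]; have := H i y (t - u - s) Di iy.
  rewrite /err /win /tail /st/=.
  have -> : approx (y, s) = P i k * \int[nu i]_z phi (t - u - s - z).
    rewrite /approx big_enum/= (bigD1 i)//= big1 => [|j /andP[_ ji]].
      rewrite addr0; congr (_ * _); apply: eq_Rintegral => z _; rewrite /bump/= indicE mem_set// mul1r.
      by congr phi; ring.
    rewrite (_ : \int[nu j]_z _ = 0) ?mulr0//.
    rewrite -(Rintegral_prob_cst (nu j) 0); apply: eq_Rintegral => z _.
    rewrite /bump/= indicE memNset ?mul0r// => jy.
    by move: ji; rewrite (class_unique disj jy iy) eqxx.
  congr (_ <= _ * _ + _ * _); last by rewrite (_ : t - u - s - 1 = t - u - 1 - s)//; ring.
  rewrite !indicE !mem_setE !in_itv/=; congr (_%:R); congr nat_of_bool.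
  by apply/idP/idP => ?; lra.
have h1 : G st <= G approx + G err.
  rewrite -(renewal_funD HY mA tap terr).
  apply: (renewal_fun_le HY mA tst (tameD HY mA tap terr)) => y s Ay _.
  by have := key y s Ay; rewrite ler_norml; lra.
have h2 : G approx <= G st + G err.
  rewrite -(renewal_funD HY mA tst terr).
  apply: (renewal_fun_le HY mA tap (tameD HY mA tst terr)) => y s Ay _.
  by have := key y s Ay; rewrite ler_norml; lra.
have h3 : 0 <= bump k u (x, 0) <= phi (t - u).
  rewrite bump_ge0/= /bump/= subr0 -[leRHS]mul1r ler_wpM2r// indicE lern1 leq_b1//.
by rewrite -Gap GE ler_norml; lra.
Qed.

End bump.

(** * Limits of renewal densities *)

Lemma cvg0_subsequence {R : realType} (psi : nat -> nat) (X : nat -> R) :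
  (forall n, (psi n < psi n.+1)%N) ->
  (forall e, 0 < e -> \forall n \near \oo, `|X n| <= e) -> X (psi n) @[n --> \oo] --> (0 : R).
Proof.
move=> psiS H; apply/cvgr0Pnorm_le => e e0; have [N _ HN] := H e e0.
exists N => // n Nn; exact: (HN _ (leq_trans Nn (subsequence_ge psiS n))).
Qed.

Lemma cvgn_close {R : realType} (u v : nat -> R) (l l' : R) :
  u n @[n --> \oo] --> l -> v n @[n --> \oo] --> l' ->
  u n - v n @[n --> \oo] --> (0 : R) -> l = l'.
Proof.
move=> ul vl uv; apply/eqP; rewrite -subr_eq0; apply/eqP.
exact: (cvg_unique (@Rhausdorff R) (cvgB ul vl) uv).
Qed.

Section truncated_moment.
Context {R : realType} {dS : measure_display} {S : measurableType dS}
  (Q : R.-pker S ~> (S * R)%type) (y : S) (B : set S).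
Hypothesis mB : measurable B.

Let mTDB : measurable (TD B : set (S * R)). Proof. exact: measurable_TD. Qed.

Lemma kernel_le1 (E : set (S * R)) : measurable E -> (Q y E <= 1)%E.
Proof.
by move=> mE; rewrite -(@prob_kernel _ _ _ _ _ Q y); apply: le_measure; rewrite ?inE.
Qed.

Lemma momT_integrable (f : R -> R) (K : R) : measurable_fun setT f -> (forall r, `|f r| <= K) ->
  (Q y).-integrable (TD B) (fun p : S * R => (f p.2)%:E).
Proof.
move=> mf fK; apply: (measurable_bounded_integrable (f := fun p : S * R => f p.2)) => //.
- by apply: le_lt_trans (kernel_le1 mTDB) (ltry _).
- by apply: measurable_funTS; exact: measurable_comp_snd.
- by exists K; split; [exact: num_real|move=> M KM p _; exact: le_trans (fK _) (ltW KM)].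
Qed.

Lemma momT_dist (f g : R -> R) (K d : R) : measurable_fun setT f -> measurable_fun setT g ->
  (forall r, `|f r| <= K) -> (forall r, `|g r| <= K) -> (forall r, `|f r - g r| <= d) ->
  `|fine (momT Q y B f) - fine (momT Q y B g)| <= d.
Proof.
move=> mf mg fK gK fg.
have d0 : 0 <= d by apply: le_trans (fg 0).
have iF := momT_integrable mf fK; have iG := momT_integrable mg gK.
have -> : fine (momT Q y B f) - fine (momT Q y B g) = \int[Q y]_(p in TD B) (f p.2 - g p.2).
  by rewrite RintegralB.
have mfg := measurable_funB mf mg.
have iFG := momT_integrable mfg fg.
apply: le_trans (le_normr_Rintegral mTDB iFG) _.
apply: (@le_trans _ _ (\int[Q y]_(p in TD B) (cst d p))).
  apply: le_Rintegral => //.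
  - exact: integrable_norm iFG.
  - by apply: (momT_integrable (f := cst d) (K := d)) => // r; rewrite ger0_norm.
  - by move=> p _; exact: fg.
rewrite Rintegral_cst// -[leRHS]mulr1 ler_wpM2l//.
by rewrite -[leRHS]/(fine 1%:E) fine_le// ?kernel_le1// ge0_fin_numE//; apply: le_lt_trans (kernel_le1 mTDB) (ltry _).
Qed.

Lemma momT_le (f g : R -> R) (K : R) : measurable_fun setT f -> measurable_fun setT g ->
  (forall r, `|f r| <= K) -> (forall r, `|g r| <= K) -> (forall r, 0 <= r -> f r <= g r) ->
  fine (momT Q y B f) <= fine (momT Q y B g).
Proof.
move=> mf mg fK gK fg; apply: le_Rintegral => //.
- exact: momT_integrable fK.
- exact: momT_integrable gK.
- by move=> p [_ /=]; rewrite in_itv/= andbT; exact: fg.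
Qed.

Lemma momT0 (f : R -> R) : (forall r, 0 <= r -> f r = 0) -> fine (momT Q y B f) = 0.
Proof.
move=> f0; rewrite /momT integral0_eq// => p [_ /=]; rewrite in_itv/= andbT => p2.
by rewrite f0.
Qed.

Lemma momT_chebyshev (f : R -> R) (C r : R) : measurable_fun setT f -> 0 < r -> (forall z, 0 <= f z) ->
  (forall z, 0 <= z -> f z <= z ^+ 2 / r ^+ 2) ->
  (\int[Q y]_(p in TD setT) (p.2 ^+ 2)%:E <= C%:E)%E ->
  fine (momT Q y B f) <= C * r ^- 2.
Proof.
move=> mf r0 f0 fz m2.
have r2 : 0 <= r ^- 2 by rewrite invr_ge0 sqr_ge0.
have H : (momT Q y B f <= (C * r ^- 2)%:E)%E.
  apply: (@le_trans _ _ (\int[Q y]_(p in TD setT) ((r ^- 2)%:E * (p.2 ^+ 2)%:E))%E).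
    apply: le_trans (_ : (\int[Q y]_(p in TD setT) (f p.2)%:E <= _)%E).
      apply: ge0_subset_integral => //.
      - exact: measurable_TD.
      - by apply/measurable_EFinP; apply: measurable_funTS; exact: measurable_comp_snd.
      - by move=> p _; rewrite lee_fin.
      - by move=> p [_ ?]; split.
    apply: ge0_le_integral => //.
    - exact: measurable_TD.
    - by move=> p _; rewrite lee_fin.
    - by apply/measurable_EFinP; apply: measurable_funTS; exact: measurable_comp_snd.
    - by apply: emeasurable_funM => //; apply/measurable_EFinP; apply: measurable_funTS; exact: measurable_snd_pow.
    - by move=> p [_ /=]; rewrite in_itv/= andbT => p2; rewrite -EFinM lee_fin mulrC fz.
  rewrite ge0_integralZl//.
  - by rewrite mulrC EFinM lee_wpmul2l// lee_fin.
  - exact: measurable_TD.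
  - by apply/measurable_EFinP; apply: measurable_funTS; exact: measurable_snd_pow.
  - by move=> p _; rewrite lee_fin sqr_ge0.
have m0 : (0 <= momT Q y B f)%E by apply: integral_ge0 => p _; rewrite lee_fin.
rewrite -[leRHS]/(fine (C * r ^- 2)%:E) fine_le// ge0_fin_numE//.
exact: le_lt_trans H (ltry _).
Qed.

End truncated_moment.

Section renewal_limit.
Context {R : realType} {dS : measure_display} {S : measurableType dS}
  {dO : measure_display} {O : measurableType dO} {I : finType} (D : pred I) (Sp : I -> set S)
  (Q_ : nat -> R.-pker S ~> (S * R)%type) (P : I -> I -> R) (nu : I -> probability R R) (C : R).
Hypothesis mSp : forall i, measurable (Sp i).
Hypothesis disj : forall i j, i != j -> Sp i `&` Sp j = set0.
Hypothesis P_ge0 : forall i j, 0 <= P i j.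
Hypothesis P_le1 : forall i j, P i j <= 1.
Hypothesis P_nu : forall i j (f : R -> R) (K : R), D i ->
  (forall u v, `|f u - f v| <= K * `|u - v|) -> (forall u, 0 <= f u <= 1) -> forall e, 0 < e ->
  \forall n \near \oo, forall y, Sp i y ->
    `|fine (momT (Q_ n) y (Sp j) f) - P i j * \int[nu i]_s f s| <= e.
Hypothesis moment2 : forall n i y, D i -> Sp i y ->
  (\int[Q_ n y]_(p in TD setT) (p.2 ^+ 2)%:E <= C%:E)%E.
Context (phi : R -> R) (L : R).
Hypothesis phi_ge0 : forall r, 0 <= phi r.
Hypothesis phi_le1 : forall r, phi r <= 1.
Hypothesis phi_lip : forall r s, `|phi r - phi s| <= L * `|r - s|.
Hypothesis phi_supp : forall r, phi r != 0 -> -1 <= r <= 1.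

Let L0 : 0 <= L.
Proof. by have := phi_lip 0 1; rewrite sub0r normrN normr1 mulr1; apply: le_trans. Qed.
Let phi1 r : `|phi r| <= 1. Proof. by rewrite ger0_norm. Qed.
Let lip_shift r u v : `|phi (r - u) - phi (r - v)| <= L * `|u - v|.
Proof.
apply: le_trans (phi_lip _ _) _; rewrite (_ : _ - _ - _ = v - u); last by ring.
by rewrite distrC.
Qed.
Let mphi r : measurable_fun setT (fun z : R => phi (r - z)).
Proof. exact: continuous_measurable (lipschitz_cont (lip_shift r)). Qed.
Let bphi r z : 0 <= phi (r - z) <= 1. Proof. by rewrite phi_ge0 phi_le1. Qed.
Let iphi i r : (nu i).-integrable setT (EFin \o (fun z : R => phi (r - z))).
Proof. exact: (@bounded_integrable _ _ _ _ _ 1). Qed.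

Let gap n y i k r := fine (momT (Q_ n) y (Sp k) (fun z => phi (r - z))) - P i k * \int[nu i]_z phi (r - z).

Let gap_lip n y i k r s : `|gap n y i k r - gap n y i k s| <= 2 * L * `|r - s|.
Proof.
have rs z : `|phi (r - z) - phi (s - z)| <= L * `|r - s|.
  by apply: le_trans (phi_lip _ _) _; rewrite (_ : _ - _ - _ = r - s)//; ring.
have -> : gap n y i k r - gap n y i k s =
    (fine (momT (Q_ n) y (Sp k) (fun z => phi (r - z))) - fine (momT (Q_ n) y (Sp k) (fun z => phi (s - z)))) -
    P i k * (\int[nu i]_z phi (r - z) - \int[nu i]_z phi (s - z)) by rewrite /gap; ring.
apply: le_trans (ler_normB _ _) _; rewrite (_ : 2 * L * _ = L * `|r - s| + L * `|r - s|); last by ring.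
apply: lerD; first by apply: (momT_dist _ _ (mSp k) (mphi r) (mphi s) (K := 1)).
rewrite normrM (ger0_norm (P_ge0 i k)) -[leRHS]mul1r; apply: ler_pM => //.
rewrite -(RintegralB measurableT (iphi i r) (iphi i s)); apply: le_trans (le_normr_Rintegral _ _) _ => //.
  by apply: (@bounded_integrable _ _ _ _ _ (L * `|r - s|)) => //; exact: measurable_funB.
rewrite -[leRHS](Rintegral_prob_cst (nu i)); apply: le_Rintegral => //.
- by apply: integrable_norm; apply: (@bounded_integrable _ _ _ _ _ (L * `|r - s|)) => //; exact: measurable_funB.
- by apply: (@bounded_integrable _ _ _ _ _ (L * `|r - s|)) => // z; rewrite ger0_norm// mulr_ge0.
Qed.

(** [P_nu] treats one test function at a time. A finite grid of mesh [h] covers the shifts [r], and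
    the Lipschitz bound [2 * L] of the gap costs at most [eta / 2] between grid points. *)
Let gap_small (B eta : R) : 0 < eta -> \forall n \near \oo, forall i k y r, D i -> Sp i y ->
  -1 <= r <= B -> `|gap n y i k r| <= eta.
Proof.
move=> eta0; pose h := eta / (4 * L + 1).
have h0 : 0 < h by rewrite divr_gt0//; have := L0; lra.
have Lh : 2 * L * h <= eta / 2.
  rewrite /h mulrA ler_pdivrMr; last by have := L0; lra.
  by have := L0; nra.
pose J := (Num.trunc (`|B + 1| / h)).+1.
have : \forall n \near \oo, forall j : 'I_J, forall ik : I * I, D ik.1 -> forall y, Sp ik.1 y ->
    `|gap n y ik.1 ik.2 (-1 + j%:R * h)| <= eta / 2.
  apply: filter_forall => j; apply: filter_forall => -[i k]/=.
  have [Di|nDi] := boolP (D i); last first.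
    by apply: nearW => n Di; case/negP: nDi.
  have e2 : 0 < eta / 2 by rewrite divr_gt0.
  have := P_nu k Di (lip_shift (-1 + j%:R * h)) (bphi _) e2.
  by apply: filterS => n H _ y iy; exact: H.
apply: filterS => n H i k y r Di iy /andP[r1 rB].
have r0 : 0 <= (r + 1) / h by apply: divr_ge0; [lra|exact: ltW].
pose j := Num.trunc ((r + 1) / h).
have /andP[j1 j2] : j%:R <= (r + 1) / h < j.+1%:R by exact: truncn_itv.
have jJ : (j < J)%N.
  rewrite ltnS; apply: le_truncn; rewrite ler_pM2r ?invr_gt0//.
  by apply: le_trans (ler_norm _); lra.
rewrite ler_pdivlMr// in j1; rewrite ltr_pdivrMr// -natr1 mulrDl mul1r in j2.
have := H (Ordinal jJ) (i, k) Di y iy => /= H1.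
rewrite -[gap _ _ _ _ r](subrK (gap n y i k (-1 + j%:R * h))).
apply: le_trans (ler_normD _ _) _.
have := gap_lip n y i k r (-1 + j%:R * h).
have : 2 * L * `|r - (-1 + j%:R * h)| <= 2 * L * h.
  by rewrite ler_wpM2l ?mulr_ge0//; rewrite ger0_norm; lra.
lra.
Qed.

Let phi0 r : ~~ (-1 <= r <= 1) -> phi r = 0.
Proof. by move=> h; apply/eqP; apply: contraR h; exact: phi_supp. Qed.

Let limit_le i k r c y : D i -> Sp i y ->
  (forall n, fine (momT (Q_ n) y (Sp k) (fun z => phi (r - z))) <= c) ->
  P i k * \int[nu i]_z phi (r - z) <= c.
Proof.
move=> Di iy H; apply/ler_addgt0Pr => e e0.
have [N _ /(_ N (leqnn N) y iy)] := P_nu k Di (lip_shift r) (bphi r) e0.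
by have := H N; rewrite ler_norml; lra.
Qed.

(** Three ranges of [r]. Before -1 both terms vanish, since sojourns are non-negative; up to [N - 1]
    the grid bound applies; beyond, both terms lie between 0 and Chebyshev's bound. What is used of
    [nu i] is inherited from the kernels through [limit_le]. *)
Let gap_err (N : nat) (eta : R) : 0 < eta -> (3 < N)%N ->
  \forall n \near \oo, forall k i y r, D i -> Sp i y ->
    `|gap n y i k r| <=
    eta * \1_`[-1, -1 + N%:R] r + C * (if N%:R - 2 < r - 1 then (r - 1) ^- 2 else 0).
Proof.
move=> eta0 N3; have N3' : 3 < N%:R :> R by rewrite ltr_nat.
have := gap_small (-1 + N%:R) eta0; apply: filterS => n H k i y r Di iy.
have C0 : 0 <= C.
  by rewrite -lee_fin; apply: le_trans (moment2 n Di iy); apply: integral_ge0 => p _; rewrite lee_fin sqr_ge0.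
have X0 : 0 <= P i k * \int[nu i]_z phi (r - z) by rewrite mulr_ge0//; apply: Rintegral_ge0.
have tail0 : 0 <= C * (if N%:R - 2 < r - 1 then (r - 1) ^- 2 else 0).
  by rewrite mulr_ge0//; case: ifP => // _; rewrite invr_ge0 sqr_ge0.
have [r1|r1] := ltP r (-1).
  have z0 z : 0 <= z -> phi (r - z) = 0 by move=> z0; apply: phi0; apply/negP; lra.
  have X1 : P i k * \int[nu i]_z phi (r - z) <= 0.
    by apply: (limit_le Di iy) => m; rewrite momT0.
  rewrite /gap momT0// (_ : _ * \int[_]_z _ = 0); last by apply/eqP; rewrite eq_le X1.
  by rewrite subrr normr0 addr_ge0// mulr_ge0// ltW.
have [rN|rN] := leP r (-1 + N%:R).
  apply: le_trans (H i k y r Di iy _) _; first by rewrite r1.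
  by rewrite indicE mem_setE in_itv/= r1 rN mulr1 lerDl.
rewrite indicE mem_setE in_itv/= r1 (lt_geF rN)/= mulr0 add0r ifT; last by lra.
have M m : fine (momT (Q_ m) y (Sp k) (fun z => phi (r - z))) <= C * (r - 1) ^- 2.
  apply: momT_chebyshev => //; [by lra| |exact: moment2 iy].
  move=> z z0; have [h|h] := boolP (-1 <= r - z <= 1); last first.
    by rewrite phi0// divr_ge0// sqr_ge0.
  apply: le_trans (phi_le1 _) _; rewrite ler_pdivlMr ?mul1r; last by rewrite exprn_gt0//; lra.
  by rewrite lerXn2r ?nnegrE//; lra.
have M0 : 0 <= fine (momT (Q_ n) y (Sp k) (fun z => phi (r - z))).
  by apply: fine_ge0; apply: integral_ge0 => p _; rewrite lee_fin.
have := M n; have := limit_le Di iy M; rewrite /gap ler_norml; lra.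
Qed.

Context (Pr_ : nat -> probability O R) (x_ : nat -> S) (Y_ : nat -> nat -> O -> S * R) (t_ : nat -> R)
  (U : R).
Local Notation A := (\bigcup_(i in [set i | D i]) Sp i).
Hypothesis HY : forall n, is_MRchain (Pr_ n) (Q_ n) (x_ n) (Y_ n).
Hypothesis Ax : forall n, A (x_ n).
Hypothesis unit_bound : forall n a,
  (renewal_sum (Pr_ n) (Y_ n) A (fun q => (\1_`[a, (a + 1)%R] q.2)%:E) <= U%:E)%E.
Hypothesis t_oo : t_ n @[n --> \oo] --> +oo.

Definition bump_mean n i u := renewal_fun (Pr_ n) (Y_ n) A (bump Sp phi (t_ n) i u).
Local Notation g := bump_mean.

Let U0 : 0 <= U. Proof. exact: (U_ge0 (unit_bound 0)). Qed.

Let g_le n i u : `|g n i u| <= 3 * U.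
Proof.
rewrite ger0_norm; last by apply: renewal_fun_ge0 => q; exact: bump_ge0.
exact: (tame_bump_le mSp (HY n) (unit_bound n) (t_ n) phi_ge0 phi_le1 phi_lip phi_supp i u).2.
Qed.

Let g_lip n i u v : `|g n i u - g n i v| <= 6 * L * U * `|u - v|.
Proof.
exact: (bump_lip mSp (HY n) (unit_bound n) (t_ n) phi_ge0 phi_le1 phi_lip phi_supp i u v).
Qed.

Let g_equation e k u : 0 < e -> D k -> \forall n \near \oo,
  `|g n k u - \sum_(i | D i) P i k * \int[nu i]_z g n i (u + z)| <= e.
Proof.
move=> e0 Dk.
have C0 : 0 <= C.
  have [i Di iy] := Ax 0%N.
  by rewrite -lee_fin; apply: le_trans (moment2 0%N Di iy); apply: integral_ge0 => p _; rewrite lee_fin sqr_ge0.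
(* [N] comes first, to bring the Chebyshev term with denominator [N - 3] below [e / 2]; [eta] is
   then adapted to the window of length [N]. *)
pose N := (Num.trunc (2 * C * U / e)).+1.+3.
have N3 : (3 < N)%N by [].
have Ne : C * (U / (N%:R - 3)) <= e / 2.
  have h : 2 * C * U / e < N%:R - 3.
    by rewrite /N -addn3 natrD addrK truncnS_gt.
  have N0 : 0 < N%:R - 3 :> R by apply: le_lt_trans h; rewrite divr_ge0 ?(ltW e0)// !mulr_ge0.
  rewrite mulrA ler_pdivrMr//; move: h; rewrite ltr_pdivrMr// => h.
  by have := e0; nra.
pose eta := e / (2 * U * N.+1%:R + 1).
have U1 : 0 < 2 * U * N.+1%:R + 1 by have := mulr_ge0 U0 (ler0n R N.+1); lra.
have eta0 : 0 < eta by rewrite divr_gt0.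
have etae : eta * (U * N.+1%:R) <= e / 2.
  rewrite /eta mulrAC ler_pdivrMr//; have := mulr_ge0 U0 (ler0n R N.+1); have := e0; nra.
near=> n.
have tn : u + 2 < t_ n by near: n; exact: cvgry_gt.
(* The contribution of the initial renewal at time 0 leaves the support of [phi] once [t_ n] is
   large. *)
have ph : phi (t_ n - u) = 0 by apply: phi0; apply/negP; lra.
have err : forall i y r, D i -> Sp i y -> `|gap n y i k r| <=
    eta * \1_`[-1, -1 + N%:R] r + C * (if N%:R - 2 < r - 1 then (r - 1) ^- 2 else 0).
  by near: n; apply: filterS (gap_err eta0 N3) => n H i y r; exact: H.
have := forward_equation mSp disj (HY n) (Ax n) (unit_bound n) (t_ n) phi_ge0 phi_le1 phi_lip
  phi_supp u Dk (P_ge0 ^~ k) (ltW eta0) C0 N3 err.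
by rewrite ph add0r => h; apply: (le_trans h); lra.
Unshelve. all: by end_near. Qed.

Lemma renewal_limit (lam : I -> R) (i0 : I) :
  (forall i j, D i -> 0 < P i j -> D j) ->
  (forall i j, D i -> D j -> i != j -> clos_trans I (fun a b => 0 < P a b) i j) ->
  (forall i, D i -> 0 < lam i) ->
  (forall j, D j -> lam j = \sum_(i | D i) lam i * P i j) ->
  D i0 -> (exists2 i1, D i1 & i0 != i1) -> (forall a, nu i0 [set a] = 0%E) ->
  exists psi c, (forall n, (psi n < psi n.+1)%N) /\
    forall k u, D k -> bump_mean (psi n) k u @[n --> \oo] --> lam k * c.
Proof.
move=> P_closed P_irr lam_gt0 lam_inv Di0 Dother nu0.
have [psi psiS cg] := arzela_ascoli g_le g_lip.
pose h k u := lim (g (psi n) k u @[n --> \oo]).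
have gh k u : g (psi n) k u @[n --> \oo] --> h k u by exact: cg.
have hC k u : `|h k u| <= 3 * U by apply: cvgn_norm_le (gh k u) _ => n; exact: g_le.
have hL k u v : `|h k u - h k v| <= 6 * L * U * `|u - v|.
  by apply: cvgn_norm_le (cvgB (gh k u) (gh k v)) _ => n; exact: g_lip.
have hE k u : D k -> h k u = \sum_(i | D i) P i k * \int[nu i]_z h i (u + z).
  move=> Dk.
  have R1 : \sum_(i | D i) P i k * \int[nu i]_z g (psi n) i (u + z) @[n --> \oo] -->
      \sum_(i | D i) P i k * \int[nu i]_z h i (u + z).
    apply: cvgn_sum => i Di; apply: cvgM; first exact: cvg_cst.
    apply: (@bounded_convergence _ _ _ (nu i) _ _ (3 * U)).
    - move=> n; apply: continuous_measurable; apply: (@lipschitz_cont _ _ (6 * L * U)) => r s.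
      by have := g_lip (psi n) i (u + r) (u + s); rewrite (_ : u + r - (u + s) = r - s)//; ring.
    - apply: continuous_measurable; apply: (@lipschitz_cont _ _ (6 * L * U)) => r s.
      by have := hL i (u + r) (u + s); rewrite (_ : u + r - (u + s) = r - s)//; ring.
    - by move=> n z; exact: g_le.
    - by apply: aeW => z; exact: gh.
  have R2 : g (psi n) k u - \sum_(i | D i) P i k * \int[nu i]_z g (psi n) i (u + z) @[n --> \oo] --> (0 : R).
    exact: (cvg0_subsequence psiS (X := fun n => g n k u - \sum_(i | D i) P i k * \int[nu i]_z g n i (u + z))
      (fun e e0 => g_equation u e0 Dk)).
  exact: (cvgn_close (gh k u) R1 R2).
have [c hc] := @choquet_deny _ _ D P lam nu i0 P_ge0 P_closed P_irr lam_gt0 lam_inv Di0 Dother nu0 _ _ h hC hL hE.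
by exists psi, c; split=> // k u Dk; rewrite -(hc k u Dk); exact: gh.
Qed.

End renewal_limit.

(** * From renewal densities to occupation probabilities *)

Section scaled_tent.
Context {R : realType} (m : R).
Hypothesis m1 : 1 <= m.

(** Tents of half-width [1 / m]: for [m >= 1] the support stays in [[-1, 1]], as the renewal
    estimates require, and the translates by multiples of [1 / m] still add up to one. *)
Definition stent (r : R) : R := tent (m * r).

Lemma stent_ge0 r : 0 <= stent r. Proof. exact: tent_ge0. Qed.
Lemma stent_le1 r : stent r <= 1. Proof. exact: tent_le1. Qed.

Lemma stent_lip r s : `|stent r - stent s| <= (2 * m) * `|r - s|.
Proof.
apply: le_trans (tent_lip _ _) _; rewrite -mulrBr normrM (ger0_norm (le_trans ler01 m1)).
by rewrite mulrA.
Qed.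

Lemma stent_supp r : stent r != 0 -> -1 <= r <= 1.
Proof.
move/tent_neq0/andP => [h1 h2]; apply/andP; split.
  case: (leP (-1) r) => // h; have := lt_le_trans h1 (ler_wpM2l (le_trans ler01 m1) (ltW h)).
  by rewrite mulrN1 ltrN2 ltNge m1.
case: (leP r 1) => // h; have := le_lt_trans (ler_wpM2l (le_trans ler01 m1) (ltW h)) h2.
by rewrite mulr1 ltNge m1.
Qed.

End scaled_tent.

Lemma clamp_affine_lip {R : realType} (m c u v : R) : 0 <= m ->
  `|clamp (m * u + c) - clamp (m * v + c)| <= m * `|u - v|.
Proof.
move=> m0; apply: le_trans (clamp_lip _ _) _.
by rewrite (_ : _ - _ = m * (u - v)); [rewrite normrM ger0_norm|ring].
Qed.

Lemma clamp_norm {R : realType} (x : R) : `|clamp x| <= 1.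
Proof. by rewrite ger0_norm ?clamp_ge0 ?clamp_le1. Qed.

Section sandwich.
Context {R : realType} {dS : measure_display} {S : measurableType dS}
  {dO : measure_display} {O : measurableType dO}
  (Pr : probability O R) (Q : R.-pker S ~> (S * R)%type) (x : S)
  (Y : nat -> O -> S * R) (U : R)
  {I : finType} (D : pred I) (Sp : I -> set S).
Hypothesis mSp : forall i, measurable (Sp i).
Hypothesis disj : forall i j, i != j -> Sp i `&` Sp j = set0.
Local Notation A := (\bigcup_(i in [set i | D i]) Sp i).
Hypothesis HY : is_MRchain Pr Q x Y.
Hypothesis Ax : A x.
Hypothesis Q_supp : forall y, Q y (TD setT) = 1%E.
Local Notation rsum := (renewal_sum Pr Y A).
Local Notation G := (renewal_fun Pr Y A).
Local Notation tame := (tame Pr Y A).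
Hypothesis unit_bound : forall a, (rsum (fun q => (\1_`[a, (a + 1)%R] q.2)%:E) <= U%:E)%E.
Context (m t C : R) (k : I).
Hypothesis m1 : 1 <= m.
Hypothesis Dk : D k.
Hypothesis moment2 : forall y, Sp k y -> (\int[Q y]_(p in TD setT) (p.2 ^+ 2)%:E <= C%:E)%E.

Let mA : measurable A. Proof. exact: measurable_class_union. Qed.
Let m0 : 0 < m. Proof. exact: lt_le_trans m1. Qed.
Let mclamp c : measurable_fun setT (fun z : R => clamp (m * z + c)).
Proof. exact: continuous_measurable (lipschitz_cont (fun u v => clamp_affine_lip c u v (ltW m0))). Qed.

Local Notation Bump j := (bump Sp (stent m) t k j).

Let tame_Bump j : tame (Bump j).
Proof.
exact: (tame_bump_le mSp HY unit_bound t (stent_ge0 m) (stent_le1 m) (stent_lip m1) (stent_supp m1) k j).1.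
Qed.

Definition survival (y : S) (r : R) : R := fine (Q y [set p | r < p.2]).

Let survivalE y r : survival y r = fine (momT Q y setT (\1_`]r, +oo[)).
Proof.
rewrite /survival /momT; congr fine.
have mT : measurable (TD setT : set (S * R)) by exact: measurable_TD.
have mr := measurable_TD_gt (S := S) r.
transitivity (\int[Q y]_(p in TD setT) (\1_[set p : S * R | (r < p.2)%R] p)%:E)%E; last first.
  by apply: eq_integral => p _; rewrite !indicE !mem_setE/= in_itv/= andbT.
rewrite integral_indic//; apply/eqP; rewrite eq_le; apply/andP; split; last first.
  by apply: le_measure; rewrite ?inE//; exact: measurableI.
have QC : Q y (~` TD setT) = 0%E.
  apply/eqP; rewrite eq_le measure_ge0 andbT -(@leeD2lE _ 1%E)// adde0 -{1}(Q_supp y).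
  rewrite -measureU ?setICr//; last exact: measurableC.
  by apply: kernel_le1; rewrite setUv; exact: measurableT.
apply: (@le_trans _ _ (Q y (([set p | (r < p.2)%R] `&` TD setT) `|` ~` TD setT))%E).
  apply: le_measure; rewrite ?inE//.
  - by apply: measurableU; [exact: measurableI|exact: measurableC].
  - by move=> p pr; have [pT|pT] := pselect (TD setT p); [left|right].
rewrite -[leRHS]adde0 -[X in (_ + X)%E]QC; apply: measureU2; [exact: measurableI|exact: measurableC].
Qed.

Let mind r : measurable_fun setT (\1_`]r, +oo[ : R -> R).
Proof. exact: measurable_indic. Qed.
Let nind r z : `|(\1_(`]r, +oo[%classic : set R) : R -> R) z| <= 1.
Proof. by rewrite indicE normr_nat lern1 leq_b1. Qed.

Let survival_ge0 y r : 0 <= survival y r. Proof. exact: fine_ge0. Qed.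

Definition occ (q : S * R) : R :=
  if (q.1 \in Sp k) && (q.2 <= t) then survival q.1 (t - q.2) else 0.

Lemma occupationE : occupation Q (Sp k) t = EFin \o occ.
Proof.
apply/funext => q; rewrite /occupation /occ/=; case: ifP => // _.
rewrite /survival fineK; last first.
  rewrite ge0_fin_numE//; apply: (@le_lt_trans _ _ 1%E); last exact: ltry.
  by apply: kernel_le1; exact: measurable_TD_gt.
by congr (Q _ _); apply/seteqP; split=> p /=; lra.
Qed.

Lemma occ_ge0 q : 0 <= occ q.
Proof. by rewrite /occ; case: ifP. Qed.

Let mocc : measurable_fun setT occ.
Proof. by apply/measurable_EFinP; rewrite -occupationE; exact: measurable_occupation. Qed.

Let BumpE j y s : Sp k y -> Bump (j / m) (y, s) = tent (m * (t - s) - j).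
Proof.
move=> ky; rewrite /bump/= indicE mem_set// mul1r /stent; congr tent.
by field; rewrite gt_eqF.
Qed.

Lemma tame_occ : tame occ.
Proof.
split=> //; first exact: occ_ge0.
rewrite -occupationE; apply: le_lt_trans (ge_Pr_Xt_in HY mA t (mSp k)) _.
by rewrite ltey_eq fin_num_measure//; exact: (measurable_Xt_in HY t (mSp k)).
Qed.

Hypothesis C0 : 0 <= C.

Let survival_le (f : R -> R) y r : measurable_fun setT f -> (forall z, `|f z| <= 1) ->
  (forall z, 0 <= f z) -> (forall z, r < z -> f z = 1) -> survival y r <= fine (momT Q y setT f).
Proof.
move=> mf f1 f0 fr; rewrite survivalE; apply: (momT_le Q y measurableT (mind r) mf (nind r) f1) => z z0.
by rewrite indicE mem_setE in_itv/= andbT; case: (ltP r z) => [/fr ->|].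
Qed.

(* On the support of the tent centred at age [j / m], survival is at most [b j]. *)
Lemma occupation_upper (b : nat -> R) (J : nat) : 1 < (J%:R - 1) / m -> (forall j, 0 <= b j) ->
  (forall j y, (j < J)%N -> Sp k y -> fine (momT Q y setT (fun z => clamp (m * z + (2 - j%:R)))) <= b j) ->
  G occ <= \sum_(j <- index_iota 0 J) b j * G (Bump (j%:R / m)) + C * (U / ((J%:R - 1) / m - 1)).
Proof.
move=> r1 b0 Hb; set r0 := (J%:R - 1) / m in r1 *.
pose tail (q : S * R) : R := if r0 < t - q.2 then (t - q.2) ^- 2 else 0.
have ttail : tame tail by exact: (tame_tail HY mA unit_bound).
have tCt := tameZ HY mA C0 ttail.
have tb j := tameZ HY mA (b0 j) (tame_Bump (j%:R / m)).
have tsum := tame_sum HY mA (index_iota 0 J) tb.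
have Bump0 j q : 0 <= Bump j q by apply: bump_ge0; exact: stent_ge0.
have tail0 q : 0 <= tail q by rewrite /tail; case: ifP => // _; rewrite invr_ge0 sqr_ge0.
have sum0 q : 0 <= \sum_(j <- index_iota 0 J) b j * Bump (j%:R / m) q.
  by apply: sumr_ge0 => j _; rewrite mulr_ge0.
have : G occ <= G (fun q => \sum_(j <- index_iota 0 J) b j * Bump (j%:R / m) q + C * tail q).
  apply: (renewal_fun_le HY mA tame_occ (tameD HY mA tsum tCt)) => y s Ay s0.
  rewrite /occ/=; case: ifPn => [/andP[/set_mem ky st]|_]; last by rewrite addr_ge0// mulr_ge0.
  have [rt|rt] := ltP r0 (t - s).
    rewrite -[leLHS]add0r; apply: lerD => //.
    rewrite /tail/= rt survivalE; apply: momT_chebyshev (moment2 ky) => //.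
    - by lra.
    - move=> z z0; rewrite indicE mem_setE in_itv/= andbT; case: (ltP (t - s) z) => rz; last first.
        by rewrite divr_ge0 ?sqr_ge0.
      by rewrite ler_pdivlMr ?exprn_gt0//; [rewrite mul1r lerXn2r ?nnegrE//; lra|lra].
  rewrite -[leLHS]addr0; apply: lerD; last by rewrite mulr_ge0.
  have mr : 0 <= m * (t - s) <= J%:R - 1.
    by rewrite mulr_ge0 ?subr_ge0 ?(ltW m0)//= mulrC -ler_pdivlMr.
  (* On ages from 0 to [(J - 1) / m] the first [J] tents form a partition of unity, so survival can
     be distributed over them. *)
  have sum1 : \sum_(j <- index_iota 0 J) tent (m * (t - s) - j%:R) = 1.
    by rewrite big_mkord sum_tent clamp1 ?clamp0 ?subr0//; lra.
  rewrite (_ : survival y (t - s) = survival y (t - s) * \sum_(j <- index_iota 0 J) tent (m * (t - s) - j%:R));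
    last by rewrite sum1 mulr1.
  rewrite mulr_sumr [leLHS]big_seq [leRHS]big_seq.
  apply: ler_sum => j; rewrite mem_index_iota/= => jJ.
  rewrite BumpE//; have [->|/tent_neq0/andP[j1 j2]] := eqVneq (tent (m * (t - s) - j%:R)) 0.
    by rewrite !mulr0.
  rewrite ler_wpM2r ?tent_ge0//; apply: le_trans (Hb j y jJ ky).
  apply: survival_le => [|z|z|z rz]; [exact: mclamp|exact: clamp_norm|exact: clamp_ge0|].
  apply: clamp1; have : m * (t - s) < m * z by rewrite ltr_pM2l.
  by lra.
rewrite (renewal_funD HY mA tsum tCt) (renewal_fun_sum HY mA _ tb) (renewal_funZ HY mA C0 ttail).
under eq_bigr do rewrite (renewal_funZ HY mA (b0 _) (tame_Bump _)).
move=> h; apply: (le_trans h); rewrite lerD2l ler_wpM2l//.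
exact: (renewal_fun_tail HY mA unit_bound t r1).
Qed.

(** Centres are shifted by one, so that every tent vanishes for renewals after [t]. On the tent
    centred at [(j + 1) / m] the age is below [(j + 2) / m], where the clamp with offset [- 2 - j]
    is still dominated by the indicator of survival. *)
Lemma occupation_lower (b : nat -> R) (J : nat) : (forall j, 0 <= b j) ->
  (forall j y, (j < J)%N -> Sp k y -> b j <= fine (momT Q y setT (fun z => clamp (m * z + (- 2 - j%:R))))) ->
  \sum_(j <- index_iota 0 J) b j * G (Bump (j.+1%:R / m)) <= G occ.
Proof.
move=> b0 Hb.
have tb j := tameZ HY mA (b0 j) (tame_Bump (j.+1%:R / m)).
have tsum := tame_sum HY mA (index_iota 0 J) tb.
suff : G (fun q => \sum_(j <- index_iota 0 J) b j * Bump (j.+1%:R / m) q) <= G occ.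
  rewrite (renewal_fun_sum HY mA _ tb).
  by under eq_bigr do rewrite (renewal_funZ HY mA (b0 _) (tame_Bump _)).
apply: (renewal_fun_le HY mA tsum tame_occ) => y s Ay s0.
rewrite /occ/=; case: ifPn => [/andP[/set_mem ky st]|nst]; last first.
  rewrite big1// => j _; have [ky|ky] := pselect (Sp k y); last first.
    by rewrite /bump/= indicE memNset ?mul0r ?mulr0.
  rewrite BumpE// tent_left ?mulr0//; move: nst; rewrite mem_set//= -ltNge => ts.
  have : m * (t - s) <= 0 by rewrite pmulr_rle0//; lra.
  by rewrite -natr1; have := ler0n R j; lra.
have sum1 : \sum_(j <- index_iota 0 J) tent (m * (t - s) - 1 - j%:R) <= 1.
  rewrite big_mkord sum_tent; have := clamp_le1 (m * (t - s) - 1 + 1).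
  by have := clamp_ge0 (m * (t - s) - 1 + 1 - J%:R); lra.
apply: (@le_trans _ _ (survival y (t - s) * \sum_(j <- index_iota 0 J) tent (m * (t - s) - 1 - j%:R))); last first.
  by rewrite -[leRHS]mulr1 ler_wpM2l.
rewrite mulr_sumr [leLHS]big_seq [leRHS]big_seq.
apply: ler_sum => j; rewrite mem_index_iota/= => jJ.
rewrite BumpE// (_ : m * (t - s) - j.+1%:R = m * (t - s) - 1 - j%:R); last by rewrite -natr1; ring.
have [->|/tent_neq0/andP[j1 j2]] := eqVneq (tent (m * (t - s) - 1 - j%:R)) 0.
  by rewrite !mulr0.
rewrite ler_wpM2r ?tent_ge0//; apply: le_trans (Hb j y jJ ky) _.
rewrite survivalE; apply: (momT_le Q y measurableT (mclamp _) (mind _) (fun z => clamp_norm _) (nind _)) => z z0.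
rewrite indicE mem_setE in_itv/= andbT; case: (ltP (t - s) z) => rz; first exact: clamp_le1.
by rewrite clamp0//; have : m * z <= m * (t - s) by [rewrite ler_pM2l]; lra.
Qed.

End sandwich.

(** * Means as Riemann sums of survival functions *)

Lemma sum_clamp_upper {R : realType} (x : R) (J : nat) : 0 <= x ->
  \sum_(j <- index_iota 0 J) clamp (x + (2 - j%:R)) <= x + 2.
Proof.
move=> x0; rewrite big_mkord.
under eq_bigr do rewrite addrA.
by rewrite sum_clamp ?ge_min ?lexx// addr_ge0.
Qed.

(** The sum equals [min (x - 2) J] when [x >= 2], and truncation at [J] is absorbed by the quadratic
    term, as [x - x^2 / J <= J]. After integration this term costs a second moment. *)
Lemma sum_clamp_lower {R : realType} (x : R) (J : nat) : (0 < J)%N -> 0 <= x ->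
  x - x ^+ 2 / J%:R - 2 <= \sum_(j <- index_iota 0 J) clamp (x + (- 2 - j%:R)).
Proof.
move=> J0 x0; rewrite big_mkord; under eq_bigr do rewrite addrA.
have J0' : 0 < J%:R :> R by rewrite ltr0n.
have q0 : 0 <= x ^+ 2 / J%:R by rewrite divr_ge0 ?sqr_ge0// ltW.
have [x2|x2] := ltP x 2.
  by apply: (@le_trans _ _ 0); [lra|apply: sumr_ge0 => j _; exact: clamp_ge0].
rewrite sum_clamp; last by lra.
rewrite le_min; apply/andP; split; first by lra.
rewrite -(ler_pM2r J0') !mulrBl divfK ?gt_eqF//.
by move: (J%:R) J0' => j j0; nra.
Qed.

Section moments.
Context {R : realType} {dS : measure_display} {S : measurableType dS}
  (Q : R.-pker S ~> (S * R)%type) (y : S) (C : R).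
Hypothesis moment2 : (\int[Q y]_(p in TD setT) (p.2 ^+ 2)%:E <= C%:E)%E.

Let mT : measurable (TD setT : set (S * R)). Proof. exact: measurable_TD. Qed.
Let mpow n : measurable_fun (TD setT) (fun p : S * R => (p.2 ^+ n)%:E).
Proof. by apply/measurable_EFinP; apply: measurable_funTS; exact: measurable_snd_pow. Qed.

Lemma integrable_sqr : (Q y).-integrable (TD setT) (fun p : S * R => (p.2 ^+ 2)%:E).
Proof.
apply/integrableP; split; first exact: mpow.
under eq_integral => p _ do rewrite gee0_abs ?lee_fin ?sqr_ge0//.
exact: le_lt_trans moment2 (ltry _).
Qed.

Lemma integrable_snd : (Q y).-integrable (TD setT) (fun p : S * R => (p.2)%:E).
Proof.
have i1 : (Q y).-integrable (TD setT) (fun p : S * R => (1 + p.2 ^+ 2)%:E).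
  have i0 : (Q y).-integrable (TD setT) (EFin \o cst (1 : R)).
    by apply: (momT_integrable Q y measurableT (f := cst 1) (K := 1)) => // r; rewrite normr1.
  exact: (integrableD mT i0 integrable_sqr).
apply: le_integrable i1 => //; first exact: (mpow 1%N).
move=> p [_ /=]; rewrite in_itv/= andbT => p0; rewrite !lee_fin.
rewrite !ger0_norm ?addr_ge0 ?sqr_ge0//.
by have := sqr_ge0 (p.2 - 1); nra.
Qed.

Lemma momT_sum (f : nat -> R -> R) (J : nat) : (forall j, measurable_fun setT (f j)) ->
  (forall j r, `|f j r| <= 1) ->
  (Q y).-integrable (TD setT) (fun p : S * R => (\sum_(j <- index_iota 0 J) f j p.2)%:E) /\
  \sum_(j <- index_iota 0 J) fine (momT Q y setT (f j)) =
  \int[Q y]_(p in TD setT) \sum_(j <- index_iota 0 J) f j p.2.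
Proof.
move=> mf f1; have iF j := momT_integrable Q y measurableT (mf j) (f1 j).
elim: J => [|J [IH1 IH2]].
  rewrite big_geq//; under eq_fun do rewrite big_geq//.
  split; first exact: integrable0.
  by rewrite /Rintegral; under eq_integral do rewrite big_geq//; rewrite integral0.
split.
  under eq_fun do rewrite big_nat_recr//= EFinD.
  exact: integrableD.
rewrite big_nat_recr//= IH2 -(RintegralD mT IH1 (iF J)).
by apply: eq_Rintegral => p _; rewrite big_nat_recr.
Qed.

Context (m : R) (J : nat).
Hypothesis m0 : 0 <= m.

Let mclamp c : measurable_fun setT (fun z : R => clamp (m * z + c)).
Proof. exact: continuous_measurable (lipschitz_cont (fun u v => clamp_affine_lip c u v m0)). Qed.

Let mean := fine (momT Q y setT id).
Hypothesis Q_supp : Q y (TD setT) = 1%E.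

Let cstE c : \int[Q y]_(p in TD setT) c = c.
Proof. by rewrite Rintegral_cst// Q_supp mulr1. Qed.

Let icst (c : R) : (Q y).-integrable (TD setT) (EFin \o cst c).
Proof. exact: (momT_integrable Q y measurableT (f := cst c) (K := `|c|)). Qed.

Let imean : (Q y).-integrable (TD setT) (fun p : S * R => (m * p.2)%:E).
Proof. by under eq_fun do rewrite EFinM; apply: integrableZl => //; exact: integrable_snd. Qed.

Let meanE : \int[Q y]_(p in TD setT) (m * p.2) = m * mean.
Proof. by rewrite RintegralZl//; exact: integrable_snd. Qed.

(** Divided by [m], the left side is a Riemann sum of the smoothed survival function, hence the mean
    up to [2 / m]. *)
Lemma sum_momT_upper :
  \sum_(j <- index_iota 0 J) fine (momT Q y setT (fun z => clamp (m * z + (2 - j%:R)))) <= m * mean + 2.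
Proof.
have [i1 ->] := momT_sum J (fun j => mclamp (2 - j%:R)) (fun j r => clamp_norm _).
have i2 := integrableD mT imean (icst 2).
rewrite -meanE -[X in _ + X]cstE -(RintegralD mT imean (icst 2)).
apply: (le_Rintegral mT i1 i2).
move=> p [_ /=]; rewrite in_itv/= andbT => p0.
by apply: sum_clamp_upper; rewrite mulr_ge0.
Qed.

Lemma sum_momT_lower : (0 < J)%N ->
  m * mean - m ^+ 2 / J%:R * C - 2 <=
  \sum_(j <- index_iota 0 J) fine (momT Q y setT (fun z => clamp (m * z + (- 2 - j%:R)))).
Proof.
move=> J0; have [i1 ->] := momT_sum J (fun j => mclamp (- 2 - j%:R)) (fun j r => clamp_norm _).
set a := m ^+ 2 / J%:R.
have a0 : 0 <= a by rewrite divr_ge0 ?sqr_ge0.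
have isq : (Q y).-integrable (TD setT) (fun p : S * R => (a * p.2 ^+ 2)%:E).
  by under eq_fun do rewrite EFinM; apply: integrableZl => //; exact: integrable_sqr.
have i2 := integrableB mT imean isq.
have i3 := integrableB mT i2 (icst 2).
have sqE : \int[Q y]_(p in TD setT) (a * p.2 ^+ 2) <= a * C.
  rewrite RintegralZl//; last exact: integrable_sqr.
  rewrite ler_wpM2l// -[leRHS]/(fine C%:E) fine_le//.
  exact: integrable_fin_num integrable_sqr.
apply: (@le_trans _ _ (\int[Q y]_(p in TD setT) (m * p.2 - a * p.2 ^+ 2 - 2))).
  rewrite (RintegralB mT i2 (icst 2)) (RintegralB mT imean isq) meanE cstE.
  by rewrite lerB// lerB.
apply: (le_Rintegral mT i3 i1).
move=> p [_ /=]; rewrite in_itv/= andbT => p0.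
have := @sum_clamp_lower _ (m * p.2) J J0; rewrite mulr_ge0// => /(_ isT).
by rewrite exprMn mulrAC.
Qed.

End moments.

(** * The limit of the occupation probabilities *)

Lemma cvgn_ge {R : realType} (u : nat -> R) (l c : R) :
  u n @[n --> \oo] --> l -> (forall n, c <= u n) -> c <= l.
Proof. by move=> ul h; rewrite -lerN2; apply: (cvgn_le (cvgN ul)) => n; rewrite lerN2. Qed.

Lemma cvgn_near {R : realType} (u : nat -> R) (l e : R) :
  u n @[n --> \oo] --> l -> 0 < e -> \forall n \near \oo, `|l - u n| <= e.
Proof. by move/cvgrPdist_le; apply. Qed.

Lemma sandwich_close {R : realType} (g Su Su' Sl Sl' T T' B b e : R) :
  g <= Su' + T' -> Sl' <= g -> T' <= T -> Su <= B -> b <= Sl ->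
  `|Su - Su'| <= e -> `|Sl - Sl'| <= e -> b - e <= g <= B + T + e.
Proof. by rewrite !ler_norml; lra. Qed.

(** This eliminates the unknown [kap]: the total occupation [T] is close to [kap * Lam] and also
    within [2 * p] of 1, so [kap] is close to [1 / Lam]. *)
Lemma ratio_close {R : realType} (N p d kap Lam T w g PX : R) : 0 < Lam -> 0 <= w <= 1 ->
  `|g - kap * w| <= d -> `|T - kap * Lam| <= N * d -> T <= 1 -> 1 <= T + 2 * p ->
  g <= PX <= g + 2 * p -> `|PX - w / Lam| <= 2 * p + d + (N * d + 2 * p) / Lam.
Proof.
move=> L0 /andP[w0 w1] gd Td T1 T2 gPX.
have h : `|kap * Lam - 1| <= N * d + 2 * p by move: Td; rewrite !ler_norml; lra.
have -> : PX - w / Lam = (PX - g) + (g - kap * w) + w * (kap * Lam - 1) / Lam by field; rewrite gt_eqF.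
apply: le_trans (ler_normD _ _) _; apply: lerD.
  by apply: le_trans (ler_normD _ _) _; apply: lerD => //; rewrite ler_norml; lra.
rewrite !normrM (ger0_norm w0) (@ger0_norm _ Lam^-1) ?invr_ge0 ?(ltW L0)//.
rewrite ler_pM2r ?invr_gt0//; apply: le_trans h.
by rewrite -[leRHS]mul1r ler_wpM2r.
Qed.

Section occupation_limit.
Context {R : realType} {dS : measure_display} {S : measurableType dS}
  {dO : measure_display} {O : measurableType dO} {I : finType} (D : pred I) (Sp : I -> set S)
  (Q_ : nat -> R.-pker S ~> (S * R)%type) (P : I -> I -> R) (nu : I -> probability R R) (C U : R)
  (Pr_ : nat -> probability O R) (x_ : nat -> S) (Y_ : nat -> nat -> O -> S * R) (t_ : nat -> R)
  (lam tau : I -> R) (i0 : I).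
Hypothesis mSp : forall i, measurable (Sp i).
Hypothesis disj : forall i j, i != j -> Sp i `&` Sp j = set0.
Hypothesis P_ge0 : forall i j, 0 <= P i j.
Hypothesis P_le1 : forall i j, P i j <= 1.
Hypothesis P_closed : forall i j, D i -> 0 < P i j -> D j.
Hypothesis P_irr : forall i j, D i -> D j -> i != j -> clos_trans I (fun a b => 0 < P a b) i j.
Hypothesis P_nu : forall i j (f : R -> R) (K : R), D i ->
  (forall u v, `|f u - f v| <= K * `|u - v|) -> (forall u, 0 <= f u <= 1) -> forall e, 0 < e ->
  \forall n \near \oo, forall y, Sp i y ->
    `|fine (momT (Q_ n) y (Sp j) f) - P i j * \int[nu i]_s f s| <= e.
Hypothesis nu_total : forall i (f : R -> R) (K : R), D i ->
  (forall u v, `|f u - f v| <= K * `|u - v|) -> (forall u, 0 <= f u <= 1) -> forall e, 0 < e ->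
  \forall n \near \oo, forall y, Sp i y ->
    `|fine (momT (Q_ n) y setT f) - \int[nu i]_s f s| <= e.
Hypothesis mean_lim : forall i, D i -> forall e, 0 < e ->
  \forall n \near \oo, forall y, Sp i y -> `|fine (momT (Q_ n) y setT id) - tau i| <= e.
Hypothesis Sp_nonempty : forall i, D i -> exists y, Sp i y.
Hypothesis C0 : 0 <= C.
Hypothesis moment2 : forall n i y, D i -> Sp i y ->
  (\int[Q_ n y]_(p in TD setT) (p.2 ^+ 2)%:E <= C%:E)%E.
Hypothesis Q_supp : forall n y, Q_ n y (TD setT) = 1%E.
Local Notation A := (\bigcup_(i in [set i | D i]) Sp i).
Hypothesis HY : forall n, is_MRchain (Pr_ n) (Q_ n) (x_ n) (Y_ n).
Hypothesis Ax : forall n, A (x_ n).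
Hypothesis unit_bound : forall n a,
  (renewal_sum (Pr_ n) (Y_ n) A (fun q => (\1_`[a, (a + 1)%R] q.2)%:E) <= U%:E)%E.
Hypothesis t_oo : t_ n @[n --> \oo] --> +oo.
Hypothesis lam_gt0 : forall i, D i -> 0 < lam i.
Hypothesis lam_sum : \sum_(i | D i) lam i = 1.
Hypothesis lam_inv : forall j, D j -> lam j = \sum_(i | D i) lam i * P i j.
Hypothesis tau01 : forall i, D i -> 0 <= tau i <= 1.
Hypothesis tau_i0 : tau i0 = 1.
Hypothesis D_i0 : D i0.
Hypothesis D_other : exists2 i1, D i1 & i0 != i1.
Hypothesis nu_i0 : forall a, nu i0 [set a] = 0%E.
Hypothesis half : forall n y, ~ A y -> ((2^-1)%:E <= Q_ n y [set p | (0 < p.2)%R])%E.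
Hypothesis exit_late : forall e, 0 < e ->
  \forall n \near \oo, fine (Pr_ n [set w | (exit_time (Y_ n) A w <= (t_ n)%:E)%E]) <= e.

Let mA : measurable A. Proof. exact: measurable_class_union. Qed.
Let U0 : 0 <= U. Proof. exact: (U_ge0 (unit_bound 0)). Qed.
Let lam_le1 i : D i -> lam i <= 1.
Proof.
move=> Di; rewrite -lam_sum (bigD1 i)//= lerDl; apply: sumr_ge0 => j /andP[Dj _].
exact: ltW (lam_gt0 Dj).
Qed.

Let pexit n := fine (Pr_ n [set w | (exit_time (Y_ n) A w <= (t_ n)%:E)%E]).
Let gocc n k := renewal_fun (Pr_ n) (Y_ n) A (occ (Q_ n) Sp (t_ n) k).

Let beta_lim k (m : R) (e : R) (c : nat -> R) J : D k -> 0 <= m -> 0 < e ->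
  \forall n \near \oo, forall j y, (j < J)%N -> Sp k y ->
    `|fine (momT (Q_ n) y setT (fun z => clamp (m * z + c j))) - \int[nu k]_z clamp (m * z + c j)| <= e.
Proof.
move=> Dk m0 e0.
have : \forall n \near \oo, forall j : 'I_J, forall y, Sp k y ->
    `|fine (momT (Q_ n) y setT (fun z => clamp (m * z + c j))) - \int[nu k]_z clamp (m * z + c j)| <= e.
  apply: filter_forall => j.
  apply: (nu_total Dk (K := m) (fun u v => clamp_affine_lip (c j) u v m0)) => // u.
  by rewrite clamp_ge0 clamp_le1.
by apply: filterS => n H j y jJ ky; exact: (H (Ordinal jJ) y ky).
Qed.

(** [nu k] is known only through weak limits, so the bound is proved for a kernel far in the
    sequence and transferred; [d] is small enough for the [J] weak errors and the error of the mean
    together. *)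
Let beta_upper k (m : R) J : D k -> 1 <= m ->
  \sum_(j <- index_iota 0 J) \int[nu k]_z clamp (m * z + (2 - j%:R)) <= m * tau k + 2.
Proof.
move=> Dk m1; apply/ler_addgt0Pr => e e0.
have m0 : 0 <= m by lra.
have J0 := ler0n R J.
pose d := e / (m + J%:R).
have d0 : 0 < d by rewrite divr_gt0//; lra.
have de : d * (m + J%:R) = e by rewrite divfK//; rewrite gt_eqF//; lra.
have [N _ HN] := filterI (beta_lim (fun j => 2 - j%:R) J Dk m0 d0) (mean_lim Dk d0).
have [H1 H2] := HN N (leqnn N).
have [y ky] := Sp_nonempty Dk.
have := sum_momT_upper (moment2 N Dk ky) J m0 (Q_supp N y).
have := H2 y ky; rewrite ler_norml => /andP[_ h2].
have : m * (fine (momT (Q_ N) y setT id) - tau k) <= m * d by rewrite ler_wpM2l.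
have : \sum_(j <- index_iota 0 J) \int[nu k]_z clamp (m * z + (2 - j%:R)) <=
    \sum_(j <- index_iota 0 J) (fine (momT (Q_ N) y setT (fun z => clamp (m * z + (2 - j%:R)))) + d).
  rewrite [leLHS]big_seq [leRHS]big_seq; apply: ler_sum => j; rewrite mem_index_iota/= => jJ.
  by have := H1 j y jJ ky; rewrite ler_norml; lra.
rewrite big_split/= big_const_seq count_predT size_iota subn0 iter_addr_0 -mulr_natr.
by move: de; rewrite mulrDr mulrBr; lra.
Qed.

Let beta_lower k (m : R) J : D k -> 1 <= m -> (0 < J)%N ->
  m * tau k - m ^+ 2 / J%:R * C - 2 <=
  \sum_(j <- index_iota 0 J) \int[nu k]_z clamp (m * z + (- 2 - j%:R)).
Proof.
move=> Dk m1 J1; apply/ler_addgt0Pr => e e0.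
have m0 : 0 <= m by lra.
have J0 := ler0n R J.
pose d := e / (m + J%:R).
have d0 : 0 < d by rewrite divr_gt0//; lra.
have de : d * (m + J%:R) = e by rewrite divfK//; rewrite gt_eqF//; lra.
have [N _ HN] := filterI (beta_lim (fun j => - 2 - j%:R) J Dk m0 d0) (mean_lim Dk d0).
have [H1 H2] := HN N (leqnn N).
have [y ky] := Sp_nonempty Dk.
have := sum_momT_lower (moment2 N Dk ky) m0 (Q_supp N y) J1.
have := H2 y ky; rewrite ler_norml => /andP[h2 _].
have : m * (tau k - fine (momT (Q_ N) y setT id)) <= m * d by rewrite ler_wpM2l//; lra.
have : \sum_(j <- index_iota 0 J) fine (momT (Q_ N) y setT (fun z => clamp (m * z + (- 2 - j%:R)))) <=
    \sum_(j <- index_iota 0 J) (\int[nu k]_z clamp (m * z + (- 2 - j%:R)) + d).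
  rewrite [leLHS]big_seq [leRHS]big_seq; apply: ler_sum => j; rewrite mem_index_iota/= => jJ.
  by have := H1 j y jJ ky; rewrite ler_norml; lra.
rewrite big_split/= big_const_seq count_predT size_iota subn0 iter_addr_0 -mulr_natr.
by move: de; rewrite mulrDr mulrBr; lra.
Qed.

(* [kappa] may depend on [m] and on the subsequence: it is only pinned down by survival up to [t_]. *)
Let occ_close (m : nat) : (2 < m)%N -> exists psi kappa, [/\ forall n, (psi n < psi n.+1)%N, 0 <= kappa &
  \forall n \near \oo, forall k, D k ->
    kappa * lam k * (tau k - (C + 3) / m%:R) - m%:R^-1 <= gocc (psi n) k <=
    kappa * lam k * (tau k + 3 / m%:R) + C * (U / (m%:R - 2)) + m%:R^-1].
Proof.
move=> m2; set M := m%:R : R.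
have M3 : 3 <= M by rewrite /M (ler_nat R 3).
have M1 : 1 <= M by lra.
have M0 : 0 <= M by lra.
have Mp : 0 < M by lra.
have [psi [c [psiS gc]]] := renewal_limit mSp disj P_ge0 P_le1 P_nu moment2
  (stent_ge0 M) (stent_le1 M) (stent_lip M1) (stent_supp M1) HY Ax unit_bound t_oo
  P_closed P_irr lam_gt0 lam_inv D_i0 D_other nu_i0.
have c0 : 0 <= c.
  rewrite -(pmulr_rge0 c (lam_gt0 D_i0)); apply: (cvgn_ge (gc i0 0 D_i0)) => n.
  apply: renewal_fun_ge0 => q; apply: bump_ge0; exact: stent_ge0.
(* A tent of scale [M] has integral [1 / M], so the limit [lam k * c] of its mean corresponds to a
   renewal density [M * c * lam k]. *)
exists psi, (M * c); split=> //; first by rewrite mulr_ge0.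
(* Ages are followed up to about [J / m = m]. This makes the Chebyshev tail of order [1 / m] and
   reduces the truncation loss [M^2 / J * C] to [C]. *)
pose J := (m * m)%N.
have JE : J%:R = M * M by rewrite natrM.
have J0 : (0 < J)%N by rewrite muln_gt0; case: (m) m2.
have J0' : 0 < J%:R :> R by rewrite ltr0n.
have JM : M - 1 <= (J%:R - 1) / M by rewrite ler_pdivlMr// JE mulrBl mul1r; lra.
have JM1 : 1 < (J%:R - 1) / M by lra.
have tl : C * (U / ((J%:R - 1) / M - 1)) <= C * (U / (M - 2)).
  by rewrite ler_wpM2l// ler_wpM2l// lef_pV2 ?posrE; lra.
(* The error allowed per grid point is such that all [J] errors add up to 1. With the 2 of the
   Riemann sums this gives the constant 3, and [C + 3] in the lower bound. *)
pose eta : R := J%:R^-1.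
have eta0 : 0 < eta by rewrite invr_gt0.
have etaJ : eta *+ J = 1 by rewrite -mulr_natr mulVf ?gt_eqF.
have Mi0 : 0 < M^-1 by rewrite invr_gt0.
pose G n k (u : R) := bump_mean D Sp (stent M) Pr_ Y_ t_ (psi n) k u.
pose bu k j := \int[nu k]_z clamp (M * z + (2 - j%:R)) + eta.
(* The lower sandwich needs non-negative weights, hence the maximum with 0. *)
pose bl k j := Num.max 0 (\int[nu k]_z clamp (M * z + (- 2 - j%:R)) - eta).
have bu0 k j : 0 <= bu k j.
  by rewrite addr_ge0 ?(ltW eta0)//; apply: Rintegral_ge0 => z _; exact: clamp_ge0.
have bl0 k j : 0 <= bl k j by rewrite le_max lexx.
have lim_sum (b : nat -> R) (u : nat -> R) k : D k ->
    \sum_(j <- index_iota 0 J) b j * G n k (u j) @[n --> \oo] -->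
    \sum_(j <- index_iota 0 J) b j * (lam k * c).
  move=> Dk; rewrite big_mkord; under eq_fun do rewrite big_mkord.
  by apply: cvgn_sum => j _; apply: cvgM; [exact: cvg_cst|exact: gc].
have near_all (F : nat -> I -> Prop) : (forall k, D k -> \forall n \near \oo, F n k) ->
    \forall n \near \oo, forall k, D k -> F n k.
  move=> H; apply: filter_forall => k; have [Dk|nDk] := boolP (D k).
    by apply: filterS (H k Dk).
  by apply: nearW => n Dk; case/negP: nDk.
apply: near_all => k Dk.
have su : \sum_(j <- index_iota 0 J) bu k j * (lam k * c) <= M * c * lam k * (tau k + 3 / M).
  rewrite -mulr_suml big_split/= big_const_seq count_predT size_iota subn0 iter_addr_0 etaJ.
  rewrite (_ : M * c * lam k * (tau k + 3 / M) = (M * tau k + 2 + 1) * (lam k * c)); last by field; rewrite gt_eqF.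
  rewrite ler_wpM2r ?mulr_ge0 ?(ltW (lam_gt0 Dk))// lerD2r; exact: beta_upper.
have sl : M * c * lam k * (tau k - (C + 3) / M) <= \sum_(j <- index_iota 0 J) bl k j * (lam k * c).
  rewrite -mulr_suml.
  rewrite (_ : M * c * lam k * (tau k - (C + 3) / M) = (M * tau k - C - 2 - 1) * (lam k * c)); last by field; rewrite gt_eqF.
  rewrite ler_wpM2r ?mulr_ge0 ?(ltW (lam_gt0 Dk))//.
  apply: (@le_trans _ _ (\sum_(j <- index_iota 0 J) (\int[nu k]_z clamp (M * z + (- 2 - j%:R)) - eta))); last first.
    by apply: ler_sum => j _; rewrite le_max lexx orbT.
  rewrite sumrB big_const_seq count_predT size_iota subn0 iter_addr_0 etaJ.
  rewrite lerB//; have := beta_lower Dk M1 J0.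
  by rewrite JE -expr2 divff ?mul1r// expf_neq0// gt_eqF.
have near_psi (F : nat -> Prop) : (\forall n \near \oo, F n) -> \forall n \near \oo, F (psi n).
  by case=> N _ HN; exists N => // n Nn; apply: HN; exact: leq_trans Nn (subsequence_ge psiS n).
have nHu := near_psi _ (beta_lim (fun j => 2 - j%:R) J Dk M0 eta0).
have nHl := near_psi _ (beta_lim (fun j => - 2 - j%:R) J Dk M0 eta0).
have nLu := cvgn_near (lim_sum (bu k) (fun j => j%:R / M) k Dk) Mi0.
have nLl := cvgn_near (lim_sum (bl k) (fun j => j.+1%:R / M) k Dk) Mi0.
have [N _ HN] := filterI (filterI nHu nHl) (filterI nLu nLl).
exists N => // n Nn; have [[Hu Hl] [Lu Ll]] := HN n Nn.
have up : gocc (psi n) k <= \sum_(j <- index_iota 0 J) bu k j * G n k (j%:R / M) +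
    C * (U / ((J%:R - 1) / M - 1)).
  apply: (occupation_upper mSp (HY _) (Q_supp _) (unit_bound _) (t_ (psi n)) M1
    (fun y => @moment2 (psi n) k y Dk) C0) => //.
  by move=> j y jJ ky; have := Hu j y jJ ky; rewrite ler_distl => /andP[].
have lo : \sum_(j <- index_iota 0 J) bl k j * G n k (j.+1%:R / M) <= gocc (psi n) k.
  apply: (occupation_lower mSp (HY _) (Q_supp _) (unit_bound _) (t_ (psi n)) M1) => //.
  move=> j y jJ ky; have := Hl j y jJ ky; rewrite ler_distl /bl ge_max => /andP[-> _].
  rewrite andbT.
  by apply: fine_ge0; apply: integral_ge0 => p _; rewrite lee_fin clamp_ge0.
exact: (sandwich_close up lo tl su sl Lu Ll).
Qed.

Let Pr_fin n E : measurable E -> Pr_ n E = (fine (Pr_ n E))%:E.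
Proof. by move=> mE; rewrite fineK// fin_num_measure. Qed.

Let tocc n k : tame (Pr_ n) (Y_ n) A (occ (Q_ n) Sp (t_ n) k).
Proof. exact: (tame_occ D mSp (HY n) (t_ n) k). Qed.

Let goccE n k : renewal_sum (Pr_ n) (Y_ n) A (occupation (Q_ n) (Sp k) (t_ n)) = (gocc n k)%:E.
Proof. by rewrite occupationE -(renewal_funE (tocc n k)). Qed.

Let PX n k := fine (Pr_ n [set w | Xt_in (Y_ n) (t_ n) (Sp k) w]).

Let pexitE n : Pr_ n [set w | (exit_time (Y_ n) A w <= (t_ n)%:E)%E] = (pexit n)%:E.
Proof. by apply: Pr_fin; exact: (measurable_exit_time (HY n) mA). Qed.

Let gocc_PX n k : D k -> 0 <= t_ n -> gocc n k <= PX n k <= gocc n k + 2 * pexit n.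
Proof.
move=> Dk t0; have mX := measurable_Xt_in (HY n) (t_ n) (mSp k).
rewrite -!lee_fin; apply/andP; split.
  by rewrite -goccE /PX -Pr_fin//; exact: (ge_Pr_Xt_in (HY n) mA).
rewrite EFinD EFinM -pexitE -goccE /PX -Pr_fin//.
apply: (le_Pr_Xt_in (HY n) mA (Ax n) (Q_supp n)) => //; last exact: half.
by move=> y ky; exists k.
Qed.

Let occupation_union n q :
  occupation (Q_ n) A (t_ n) q = (\sum_(k | D k) occupation (Q_ n) (Sp k) (t_ n) q)%E.
Proof.
have [[k Dk kq]|nA] := pselect (A q.1).
  rewrite (bigD1 k)//= big1 => [|j /andP[_ jk]].
    by rewrite adde0 /occupation !mem_set//; exists k.
  by rewrite /occupation memNset// => jq; move: jk; rewrite (class_unique disj jq kq) eqxx.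
rewrite /occupation memNset//= big1// => k Dk; rewrite memNset// => kq.
by apply: nA; exists k.
Qed.

Let gocc_sum n : renewal_sum (Pr_ n) (Y_ n) A (occupation (Q_ n) A (t_ n)) = (\sum_(k | D k) gocc n k)%:E.
Proof.
have -> : occupation (Q_ n) A (t_ n) = fun q => (\sum_(k | D k) occupation (Q_ n) (Sp k) (t_ n) q)%E.
  by apply/funext => q; exact: occupation_union.
rewrite (renewal_sum_sum (HY n) mA); last 2 first.
- by move=> k q; exact: occupation_ge0.
- by move=> k; exact: measurable_occupation.
by rewrite -sumEFin; apply: eq_bigr => k _; exact: goccE.
Qed.

Let gocc_sum_le1 n : \sum_(k | D k) gocc n k <= 1.
Proof.
rewrite -lee_fin -gocc_sum; apply: le_trans (ge_Pr_Xt_in (HY n) mA (t_ n) mA) _.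
by apply: probability_le1; exact: (measurable_Xt_in (HY n) (t_ n) mA).
Qed.

Let gocc_sum_ge n : 0 <= t_ n -> 1 <= \sum_(k | D k) gocc n k + 2 * pexit n.
Proof.
move=> t0; rewrite -lee_fin EFinD EFinM -pexitE -gocc_sum.
apply: (Pr_survival (HY n) mA (Ax n) (Q_supp n) t0); first exact: half.
pose N := (Num.trunc (t_ n)).+1.
have tN : t_ n < N%:R by exact: truncnS_gt.
apply: le_lt_trans (_ : (renewal_sum (Pr_ n) (Y_ n) A (fun q => (\1_`[0%R, (0 + N%:R)%R] q.2)%:E) < +oo)%E).
  apply: (le_renewal_sum (HY n) mA).
  - by move=> q; rewrite lee_fin.
  - apply/measurable_EFinP; apply: (@measurable_comp_snd _ _ _ (\1_`]-oo, t_ n])).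
    exact: measurable_indic.
  - exact: measurable_window.
  move=> y s _ s0; rewrite lee_fin !indicE !mem_setE !in_itv/= s0/= add0r.
  by case: (leP s (t_ n)) => // st; rewrite (le_trans st (ltW tN)).
by have [_ _] := tame_window (HY n) mA (unit_bound n) 0 N.
Qed.

(** One good index is enough for the final contradiction, and in this form the claim is insensitive
    to passing to subsequences. *)
Lemma time_in_class_limit k e : D k -> 0 < e -> exists n,
  `|fine (Pr_ n [set w | Xt_in (Y_ n) (t_ n) (Sp k) w]) -
    lam k * tau k / \sum_(j | D j) lam j * tau j| <= e.
Proof.
move=> Dk e0; set Lam := \sum_(j | D j) _.
have lt01 i : D i -> 0 <= lam i * tau i <= 1.
  move=> Di; have /andP[h0 h1] := tau01 Di; have l0 := ltW (lam_gt0 Di).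
  by rewrite mulr_ge0//= mulr_ile1// lam_le1.
have Lam0 : 0 < Lam.
  rewrite /Lam (bigD1 i0)//= tau_i0 mulr1 ltr_pwDl ?lam_gt0//.
  by apply: sumr_ge0 => i /andP[Di _]; have /andP[] := lt01 i Di.
pose N : R := (#|D|)%:R.
have c3 : 0 < 3 + (N + 2) / Lam by rewrite ltr_wpDr// divr_ge0 ?addr_ge0// ltW.
(* Solves [ratio_close] for total error [e] when both the exit probability and the occupation errors
   are at most [d]. *)
pose d := e / (3 + (N + 2) / Lam).
have d0 : 0 < d by rewrite divr_gt0.
have dE : 2 * d + d + (N * d + 2 * d) / Lam = e.
  have E z : 2 * z + z + (N * z + 2 * z) / Lam = z * (3 + (N + 2) / Lam) by field; rewrite gt_eqF.
  by rewrite E /d divfK// gt_eqF.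
(* A bound on [kappa] uniform in [m]: at [i0] the occupation is at most 1 and [tau i0 = 1], so
   [kappa * lam i0 / 2 <= 1 + 1 / m <= 2]. *)
pose K := 4 / lam i0.
have K0 : 0 < K by rewrite divr_gt0// lam_gt0.
(* Collects the errors of [occ_close] over the common denominator [m - 2]. The extra [2 * (C + 3)]
   in [m0] makes [(C + 3) / m <= 1/2], which the bound on [kappa] uses. *)
pose X := K * (C + 3) + C * U + 1.
have C3 : 0 <= C + 3 by rewrite addr_ge0.
have X0 : 0 <= X by rewrite !addr_ge0// mulr_ge0// ltW.
pose m0 := (Num.trunc (X / d + 2 * (C + 3))).+1; pose m := m0.+2.
have mX : X / d + 2 * (C + 3) < m%:R - 2.
  by rewrite (_ : m%:R = m0%:R + 2 :> R) ?addrK ?truncnS_gt// -natrD addn2.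
have Xd0 : 0 <= X / d by rewrite divr_ge0// ltW.
have [psi [kap [psiS kap0 [N1 _ close]]]] := occ_close (m := m) isT.
have [N2 _ HN2] := exit_late d0.
have [N3 _ HN3] := cvgry_ge t_oo 0.
pose n0 := maxn N1 (maxn N2 N3); exists (psi n0).
have n0psi := subsequence_ge psiS n0.
have {}close := close n0 (leq_maxl _ _).
have pd : pexit (psi n0) <= d.
  by apply: HN2; apply: leq_trans n0psi; rewrite /n0 leq_max leq_max leqnn orbT.
have t0 : 0 <= t_ (psi n0).
  by apply: HN3; apply: leq_trans n0psi; rewrite /n0 leq_max leq_max leqnn !orbT.
move: (psi n0) close pd t0 => n close pd t0.
have m2 : 0 < m%:R - 2 :> R by lra.
have mp : 0 < m%:R :> R by lra.
have C3m : (C + 3) / m%:R <= 2^-1 by rewrite ler_pdivrMr//; lra.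
have mi1 : m%:R^-1 <= 1 :> R by rewrite invf_le1//; lra.
have gocc_ge0 i : 0 <= gocc n i by apply: renewal_fun_ge0 => q; exact: occ_ge0.
have kapK : kap <= K.
  have /andP[h _] := close i0 D_i0; rewrite tau_i0 in h.
  have g1 : gocc n i0 <= 1.
    by apply: le_trans (gocc_sum_le1 n); rewrite (bigD1 i0)//= lerDl sumr_ge0.
  rewrite /K ler_pdivlMr ?lam_gt0//.
  have kl0 : 0 <= kap * lam i0 by rewrite mulr_ge0// ltW// lam_gt0.
  move: (kap * lam i0) kl0 h => a a0 h.
  have : a * 2^-1 <= a * (1 - (C + 3) / m%:R) by rewrite ler_wpM2l//; lra.
  by lra.
have eps i : D i -> `|gocc n i - kap * (lam i * tau i)| <= d.
  move=> Di; have /andP[h1 h2] := close i Di.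
  have kl0 : 0 <= kap * lam i by rewrite mulr_ge0// ltW// lam_gt0.
  have klK : kap * lam i <= K.
    by apply: le_trans kapK; rewrite -[leRHS]mulr1 ler_wpM2l// lam_le1.
  have XE : X / (m%:R - 2) <= d by rewrite ler_pdivrMr// mulrC -ler_pdivrMr//; lra.
  have minv : m%:R^-1 <= (m%:R - 2)^-1 :> R by rewrite lef_pV2 ?posrE//; lra.
  have e1 : kap * lam i * ((C + 3) / m%:R) <= K * (C + 3) / (m%:R - 2).
    rewrite mulrA; apply: ler_pM; rewrite ?invr_ge0 ?(ltW mp)//.
      by rewrite mulr_ge0.
    by rewrite ler_wpM2r.
  have e2 : kap * lam i * (3 / m%:R) <= kap * lam i * ((C + 3) / m%:R).
    by rewrite ler_wpM2l// ler_pM2r ?invr_gt0// lerDr.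
  have XE2 : X / (m%:R - 2) = K * (C + 3) / (m%:R - 2) + C * (U / (m%:R - 2)) + (m%:R - 2)^-1.
    by rewrite /X; field; rewrite gt_eqF.
  have CU0 : 0 <= C * (U / (m%:R - 2)) by rewrite mulr_ge0// divr_ge0// ltW.
  rewrite mulrA ler_distl; move: h1 h2; rewrite mulrBr mulrDr => h1 h2.
  by apply/andP; split; lra.
have sumd : `|\sum_(i | D i) gocc n i - kap * Lam| <= N * d.
  rewrite /Lam mulr_sumr -sumrB; apply: le_trans (ler_norm_sum _ _ _) _.
  apply: le_trans (ler_sum _ eps) _.
  by rewrite sumr_const mulr_natl.
apply: le_trans (ratio_close Lam0 (lt01 k Dk) (eps k Dk) sumd (gocc_sum_le1 n)
  (gocc_sum_ge t0) (gocc_PX Dk t0)) _.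
rewrite -dE; apply: lerD; first by rewrite lerD2r ler_wpM2l.
by rewrite ler_pM2r ?invr_gt0// lerD2l ler_wpM2l.
Qed.

End occupation_limit.

(** * Conditional sojourn laws *)

Section conditional_law.
Context {R : realType} {dS : measure_display} {S : measurableType dS}
  (Q : R.-pker S ~> (S * R)%type) (y : S) (B : set S).
Hypothesis mB : measurable B.
Hypothesis Pk_gt0 : 0 < Pk Q y B.

Let mTDB : measurable (TD B : set (S * R)). Proof. exact: measurable_TD. Qed.
Let PkE : Q y (TD B) = (Pk Q y B)%:E. Proof. exact: Pk_fin. Qed.

Lemma momT_EgT (g : R -> R) : fine (momT Q y B g) = Pk Q y B * EgT Q y B g.
Proof. by rewrite /EgT mulrC divfK// gt_eqF. Qed.

Lemma conditional_law (tau : R) : exists mu : probability R R,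
  forall f : R -> R, measurable_fun setT f -> (exists K, forall r, `|f r| <= K) ->
    \int[mu]_r f r = EgT Q y B (fun s => f (s / tau)).
Proof.
have [P HP] := conditional_probability ((y, 0) : S * R) mTDB PkE Pk_gt0.
have md : measurable_fun setT (fun p : S * R => p.2 / tau).
  by apply: (@measurable_comp_snd _ _ _ (fun s => s / tau)); exact: measurable_funM.
have [mu Hmu] := pushforward_probability P md.
exists mu => f mf [K fK]; rewrite Hmu//; last by exists K.
rewrite HP; [by rewrite mulrC|exact: measurableT_comp mf md|by exists K => p; exact: fK].
Qed.

Lemma EgT_ge0 (f : R -> R) : (forall z, 0 <= z -> 0 <= f z) -> 0 <= EgT Q y B f.
Proof.
move=> f0; apply: divr_ge0; last exact: ltW.
by apply: fine_ge0; apply: integral_ge0 => p [_ /=]; rewrite in_itv/= andbT lee_fin; exact: f0.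
Qed.

Let m := meanT Q y B.
Hypothesis m_gt0 : 0 < m.

(** [meanT] passes through [fine], which sends an infinite integral to 0; a positive mean therefore
    proves that the integral is finite. *)
Lemma momT_mean : momT Q y B id = (Pk Q y B * m)%:E.
Proof.
have : 0 < fine (momT Q y B id) by rewrite momT_EgT mulr_gt0.
rewrite -momT_EgT; case: (momT Q y B id) => [r|/=|/=]//; by rewrite ltxx.
Qed.

Lemma integrable_mean : (Q y).-integrable (TD B) (fun p : S * R => (p.2)%:E).
Proof.
apply/integrableP; split.
  by apply/measurable_EFinP; apply: measurable_funTS; exact: measurable_snd.
have -> : (\int[Q y]_(p in TD B) `|(p.2)%:E| = momT Q y B id)%E.
  apply: eq_integral => p /set_mem[_ /=]; rewrite in_itv/= andbT => p0.
  by rewrite /= ger0_norm.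
by rewrite momT_mean ltry.
Qed.

Lemma moment2_varT c : varT_le Q y B c ->
  (\int[Q y]_(p in TD B) (p.2 ^+ 2)%:E <= ((2 * c + 2 * m ^+ 2) * Pk Q y B)%:E)%E.
Proof.
rewrite /varT_le -/m => vT.
have mm : measurable_fun (TD B) (fun p : S * R => ((p.2 - m) ^+ 2)%:E).
  apply/measurable_EFinP; apply: measurable_funTS; apply: (@measurable_comp_snd _ _ _ (fun s => (s - m) ^+ 2)).
  by apply: measurable_funX; exact: measurable_funB.
apply: (@le_trans _ _ (\int[Q y]_(p in TD B) (2%:E * ((p.2 - m) ^+ 2)%:E + cst (2 * m ^+ 2)%:E p))%E).
  apply: ge0_le_integral => //.
  - by move=> p _; rewrite lee_fin sqr_ge0.
  - by apply/measurable_EFinP; apply: measurable_funTS; exact: measurable_snd_pow.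
  - by apply: emeasurable_funD => //; exact: emeasurable_funM.
  - move=> p _; rewrite /= -EFinM -EFinD lee_fin.
    by have := sqr_ge0 (p.2 - 2 * m); nra.
rewrite ge0_integralD//; last 3 first.
- by move=> p _; rewrite -EFinM lee_fin mulr_ge0// sqr_ge0.
- exact: emeasurable_funM.
- by move=> p _; rewrite lee_fin mulr_ge0// sqr_ge0.
rewrite ge0_integralZl//; last by move=> p _; rewrite lee_fin sqr_ge0.
have -> : ((2 * c + 2 * m ^+ 2) * Pk Q y B)%:E =
    (2%:E * (c * Pk Q y B)%:E + (2 * m ^+ 2)%:E * (Pk Q y B)%:E)%E.
  by rewrite -!EFinM -EFinD; congr EFin; ring.
by rewrite integral_cst// PkE leeD2r// lee_wpmul2l.
Qed.

Lemma EgT_markov (f : R -> R) (a : R) : measurable_fun setT f -> 0 <= a ->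
  (forall z, 0 <= f z) -> (forall z, 0 <= z -> f z <= a * z) -> EgT Q y B f <= a * m.
Proof.
move=> mf a0 f0 fz; rewrite /EgT ler_pdivrMr// -mulrA [m * _]mulrC.
have H : (momT Q y B f <= (a * (Pk Q y B * m))%:E)%E.
  rewrite EFinM -momT_mean /momT -ge0_integralZl//.
  - apply: ge0_le_integral => //.
    + by move=> p _; rewrite lee_fin.
    + by apply/measurable_EFinP; apply: measurable_funTS; exact: measurable_comp_snd.
    + by apply: emeasurable_funM => //; apply/measurable_EFinP; apply: measurable_funTS; exact: measurable_snd.
    + by move=> p [_ /=]; rewrite in_itv/= andbT lee_fin; exact: fz.
  - by apply/measurable_EFinP; apply: measurable_funTS; exact: measurable_snd.
  - by move=> p [_ /=]; rewrite in_itv/= andbT lee_fin.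
have f0' : (0 <= momT Q y B f)%E by apply: integral_ge0 => p _; rewrite lee_fin.
rewrite -[leRHS]/(fine (a * (Pk Q y B * m))%:E) fine_le// ge0_fin_numE//.
exact: le_lt_trans H (ltry _).
Qed.

(** Bridge between the normalised sojourn [T / tau], to which (d) and (e) apply, and the unscaled
    [T] of the renewal equation. Comparing with [tau0 * (T / tau)] avoids dividing by [tau0], which
    may be 0. *)
Lemma EgT_shift (f : R -> R) (K tau tau0 : R) : 0 < tau -> 0 <= K ->
  (forall u v, `|f u - f v| <= K * `|u - v|) -> (forall u, 0 <= f u <= 1) ->
  `|EgT Q y B f - EgT Q y B (fun s => f (tau0 * (s / tau)))| <= K * `|1 - tau0 / tau| * m.
Proof.
move=> t0 K0 fL f01.
have f1 r : `|f r| <= 1 by have /andP[? ?] := f01 r; rewrite ger0_norm.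
have mf : measurable_fun setT f by exact: continuous_measurable (lipschitz_cont fL).
have mg : measurable_fun setT (fun s : R => f (tau0 * (s / tau))).
  by apply: measurableT_comp mf _; apply: measurable_funM => //; exact: measurable_funM.
have i1 := momT_integrable Q y mB mf f1.
have i2 := momT_integrable Q y mB mg (fun s => f1 (tau0 * (s / tau))).
pose a := K * `|1 - tau0 / tau|.
have a0 : 0 <= a by rewrite mulr_ge0.
have i3 : (Q y).-integrable (TD B) (fun p : S * R => (a * p.2)%:E).
  by under eq_fun do rewrite EFinM; apply: integrableZl => //; exact: integrable_mean.
rewrite /EgT -mulrBl normrM (@ger0_norm _ (Pk Q y B)^-1) ?invr_ge0 ?(ltW Pk_gt0)//.
rewrite ler_pdivrMr//.
rewrite (_ : fine _ - fine _ = \int[Q y]_(p in TD B) (f p.2 - f (tau0 * (p.2 / tau)))); last first.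
  by rewrite RintegralB.
have i4 := integrableB mTDB i1 i2.
apply: le_trans (le_normr_Rintegral mTDB i4) _.
apply: (@le_trans _ _ (\int[Q y]_(p in TD B) (a * p.2))).
  apply: (le_Rintegral mTDB (integrable_norm i4) i3) => p [_ /=]; rewrite in_itv/= andbT => p0.
  apply: le_trans (fL _ _) _; rewrite /a -mulrA ler_wpM2l//.
  rewrite (_ : p.2 - tau0 * (p.2 / tau) = (1 - tau0 / tau) * p.2); last by field; rewrite gt_eqF.
  by rewrite normrM (ger0_norm p0).
rewrite RintegralZl//; last exact: integrable_mean.
rewrite (_ : \int[Q y]_(p in TD B) p.2 = fine (momT Q y B id))// momT_mean/=.
by rewrite (_ : K * _ * m * _ = a * (Pk Q y B * m))// /a; ring.
Qed.

End conditional_law.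

Lemma momT_TD_union {R : realType} {dS : measure_display} {S : measurableType dS} {I : finType}
  (Sp : I -> set S) (Q : R.-pker S ~> (S * R)%type) (y : S) (f : R -> R) :
  (forall i, measurable (Sp i)) -> (forall i j, i != j -> Sp i `&` Sp j = set0) ->
  \bigcup_(i in [set: I]) Sp i = setT ->
  measurable_fun setT f -> (forall z, 0 <= z -> 0 <= f z) ->
  momT Q y setT f = (\sum_(j : I) momT Q y (Sp j) f)%E.
Proof.
move=> mSp disj cov mf f0.
have := @integral_TD_union R dS S I xpredT Sp mSp disj (Q y) (fun p => (f p.2)%:E).
rewrite (_ : \bigcup_(i in [set i | xpredT i]) Sp i = setT); last by rewrite -cov; apply: eq_bigcupl.
apply.
  by apply/measurable_EFinP; exact: measurable_comp_snd.
by move=> p [_ /=]; rewrite in_itv/= andbT lee_fin; exact: f0.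
Qed.

(** * Limits as [eps] decreases to zero *)

Lemma unif_lim0_near {R : realType} {X : Type} (A : set X) (f : R -> X -> R) (l e : R) :
  unif_lim0 A f l -> 0 < e -> \forall eps \near 0^'+, forall x, A x -> `|f eps x - l| < e.
Proof.
move=> H e0; have [d d0 Hd] := H e e0.
by apply: filterS2 (nbhs_right_gt 0) (nbhs_right_lt d0) => eps e1 e2 x; exact: Hd.
Qed.

Lemma near_at_right0 {R : realType} (F : R -> Prop) : (\forall eps \near 0^'+, F eps) ->
  exists2 d : R, 0 < d & forall eps, 0 < eps -> eps < d -> F eps.
Proof.
move=> [d /= d0 Hd]; exists d => // eps e0 ed; apply: (Hd eps) => //=.
by rewrite sub0r normrN gtr0_norm.
Qed.

Lemma cvg_at_right0 {R : realType} (e_ : nat -> R) (F : R -> Prop) :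
  (forall n, 0 < e_ n) -> e_ n @[n --> \oo] --> (0 : R) ->
  (\forall eps \near 0^'+, F eps) -> \forall n \near \oo, F (e_ n).
Proof.
move=> e0 el /near_at_right0[d d0 H].
have /cvgr0Pnorm_lt/(_ d d0) := el; apply: filterS => n; rewrite gtr0_norm// => h.
exact: H.
Qed.

(** Each term is chosen below the previous one and below [1 / n]; monotonicity is recorded because
    (e) speaks of decreasing sequences only. *)
Lemma vanishing_sequence {R : realType} (P F : R -> Prop) :
  ~ (\forall eps \near 0^'+, P eps) -> (\forall eps \near 0^'+, F eps) ->
  exists e_ : nat -> R, [/\ forall n, 0 < e_ n, forall n, e_ n.+1 <= e_ n,
    e_ n @[n --> \oo] --> (0 : R) & forall n, ~ P (e_ n) /\ F (e_ n)].
Proof.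
move=> nP HF.
have ex d : exists eps, 0 < d -> [/\ 0 < eps, eps < d, ~ P eps & F eps].
  have [d0|d0] := boolP (0 < d); last by exists 0.
  apply: contrapT => H; apply: nP.
  apply: filterS3 (nbhs_right_gt 0) (nbhs_right_lt d0) HF => eps e1 e2 Fe.
  by apply: contrapT => nPe; apply: H; exists eps.
have [f Hf] := choice (ex : forall d : R, exists eps : R, _).
pose e_ := fix e_ n := if n is p.+1 then f (Num.min (e_ p) p.+1%:R^-1) else f 1.
have e0 n : 0 < e_ n.
  elim: n => [|n IH]; first by have [] := Hf 1 ltr01.
  by rewrite /=; have [] := Hf (Num.min (e_ n) n.+1%:R^-1); rewrite ?lt_min ?IH/= ?invr_gt0.
have m0 n : 0 < Num.min (e_ n) n.+1%:R^-1 by rewrite lt_min e0 invr_gt0 ltr0n.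
exists e_; split=> //.
- by move=> n /=; have [_ + _ _] := Hf _ (m0 n); rewrite lt_min => /andP[/ltW].
- apply/cvgrPdist_le => e ep; near=> n; rewrite sub0r normrN gtr0_norm//.
  have n0 : (0 < n)%N by near: n; exists 1%N.
  rewrite -(prednK n0) /=; have [_ + _ _] := Hf _ (m0 n.-1); rewrite lt_min => /andP[_ /ltW h].
  apply: (le_trans h); rewrite prednK// invf_ple ?posrE ?ltr0n//.
  by near: n; exact: nbhs_infty_ger.
- by case=> [|n] /=; [have [] := Hf 1 ltr01|have [] := Hf _ (m0 n)].
Unshelve. all: by end_near. Qed.

Lemma Rintegral_indic {R : realType} (nu : probability R R) (E : set R) : measurable E ->
  nu E = (\int[nu]_r \1_E r)%:E.
Proof.
move=> mE; rewrite /Rintegral integral_indic// setIT fineK//; exact: fin_num_measure.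
Qed.

Section conditional_limits.
Context {R : realType} {dS : measure_display} {S : measurableType dS}.
Context (Q_ : nat -> R.-pker S ~> (S * R)%type) (y_ : nat -> S) (tau_ : nat -> R) (B : set S).
Hypothesis mB : measurable B.
Hypothesis Pk_gt0 : forall n, 0 < Pk (Q_ n) (y_ n) B.
Hypothesis tau_gt0 : forall n, 0 < tau_ n.
Hypothesis mean_near : forall n, `|meanT (Q_ n) (y_ n) B / tau_ n - 1| <= 2^-1.

Lemma mean_bounds n : tau_ n / 2 <= meanT (Q_ n) (y_ n) B <= 2 * tau_ n.
Proof.
have := mean_near n; rewrite ler_norml => /andP[h1 h2].
have e : meanT (Q_ n) (y_ n) B = meanT (Q_ n) (y_ n) B / tau_ n * tau_ n.
  by rewrite divfK// gt_eqF.
rewrite e; move: (_ / tau_ n) h1 h2 => z h1 h2.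
have t0 := tau_gt0 n; apply/andP; split; first by rewrite [tau_ n / 2]mulrC ler_pM2r//; lra.
by rewrite ler_pM2r//; lra.
Qed.

(** Tightness is Markov's inequality: the normalised mean is at most 2, whence the radius
    [2 / e]. *)
Lemma conditional_laws : exists mu : nat -> probability R R,
  (forall n (f : R -> R), measurable_fun setT f -> (exists K, forall r, `|f r| <= K) ->
    \int[mu n]_r f r = EgT (Q_ n) (y_ n) B (fun s => f (s / tau_ n))) /\
  (forall e, 0 < e -> exists K : R, forall n,
    (mu n (~` (`[(- K)%R, K]%classic : set R)) <= e%:E)%E).
Proof.
have [mu Hmu] := choice (fun n => conditional_law mB (Pk_gt0 n) (tau_ n)).
exists mu; split=> // e e0; exists (2 / e) => n.
set K := 2 / e; have K0 : 0 < K by rewrite divr_gt0.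
have mE : measurable (~` (`[(- K)%R, K]%classic : set R)) by exact: measurableC.
have mi : measurable_fun setT (\1_(~` (`[(- K)%R, K]%classic : set R)) : R -> R).
  exact: measurable_indic.
have ti := tau_gt0 n.
rewrite Rintegral_indic// lee_fin Hmu//; last first.
  by exists 1 => r; rewrite indicE normr_nat lern1 leq_b1.
have m0 : 0 < meanT (Q_ n) (y_ n) B.
  by have /andP[h _] := mean_bounds n; apply: lt_le_trans h; rewrite divr_gt0.
apply: (le_trans (EgT_markov mB (Pk_gt0 n) m0 (a := (K * tau_ n)^-1) _ _ _ _)).
- by apply: measurableT_comp mi _; exact: measurable_funM.
- by rewrite invr_ge0 mulr_ge0// ltW.
- by move=> z; rewrite indicE.
- move=> z z0; rewrite indicE in_setC mem_setE in_itv/= -ler_pdivrMl ?invrK; last first.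
    by rewrite invr_gt0 mulr_gt0.
  case: (boolP (_ && _)) => [_|/=]; first by rewrite mulr0.
  have -> : - K <= z / tau_ n by apply: (@le_trans _ _ 0); rewrite ?oppr_le0 ?divr_ge0// ltW.
  by rewrite /= -ltNge mulr1 ltr_pdivlMr// => /ltW.
- have /andP[_ h] := mean_bounds n.
  rewrite (ler_pdivrMl _ _ (mulr_gt0 K0 ti)); apply: (le_trans h).
  by rewrite /K mulrAC divfK ?gt_eqF.
Qed.

End conditional_limits.

(** * Perturbed kernels *)

Lemma tent0 {R : realType} : tent 0 = 1 :> R.
Proof. by rewrite /tent add0r clamp1// clamp0// subr0. Qed.

Lemma product_close {R : realType} (a b x y d d' : R) : `|a| <= d -> 0 <= x <= 1 ->
  0 <= b <= 1 -> `|y| <= d' -> `|a * x + b * y| <= d + d'.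
Proof.
move=> ad /andP[x0 x1] /andP[b0 b1] yd.
apply: le_trans (ler_normD _ _) _; rewrite !normrM (ger0_norm x0) (ger0_norm b0).
by apply: lerD; [rewrite -[leRHS]mulr1 ler_pM|rewrite -[leRHS]mul1r ler_pM].
Qed.

Section perturbed_kernels.
Context {R : realType} {dS : measure_display} {S : measurableType dS} (M M' : nat)
  (Sp : 'I_M -> set S) (Q : R -> R.-pker S ~> (S * R)%type)
  (Pm : R -> 'I_M -> 'I_M -> R) (tau : R -> 'I_M -> R).
Hypothesis mSp : forall i, measurable (Sp i).
Hypothesis disj : forall i j, i != j -> Sp i `&` Sp j = set0.
Hypothesis cover : \bigcup_(i in [set: 'I_M]) Sp i = [set: S].
Hypothesis Q_supp : forall eps y, 0 < eps -> Q eps y (TD [set: S]) = 1%E.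
Hypothesis Ha_diag : forall eps i y, 0 < eps -> Sp i y -> Pk (Q eps) y (Sp i) = 0.
Hypothesis Ha_diagP : forall eps i, 0 < eps -> Pm eps i i = 0.
Hypothesis Ha_dich : forall i j, i != j ->
  ((forall eps x, 0 < eps -> Sp i x -> Pk (Q eps) x (Sp j) = 0) /\
   (forall eps, 0 < eps -> Pm eps i j = 0))
  \/
  ((forall eps x, 0 < eps -> Sp i x -> 0 < Pk (Q eps) x (Sp j)) /\
   (forall eps, 0 < eps -> 0 < Pm eps i j) /\
   unif_lim0 (Sp i) (fun eps x => Pk (Q eps) x (Sp j) / Pm eps i j) 1).
Hypothesis Ha_sum : forall eps i, 0 < eps -> \sum_(j < M) Pm eps i j = 1.
Hypothesis Hb_pos : forall eps i, 0 < eps -> 0 < tau eps i.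
Hypothesis Hb : forall i j, Pnz Pm i j ->
  unif_lim0 (Sp i) (fun eps x => meanT (Q eps) x (Sp j) / tau eps i) 1.
Hypothesis Hc : exists C eps0 : R, 0 < eps0 /\
  forall eps, 0 < eps -> eps <= eps0 -> forall i j, Pnz Pm i j ->
    forall x, Sp i x -> varT_le (Q eps) x (Sp j) (C * tau eps i ^+ 2).
Hypothesis Hd : forall f : R -> R, continuous f -> bounded_fun_R f ->
  forall i j1 j2, Pnz Pm i j1 -> Pnz Pm i j2 ->
  unif_lim0 [set p : S * S | Sp i p.1 /\ Sp i p.2]
    (fun eps p => EgT (Q eps) p.1 (Sp j1) (fun s => f (s / tau eps i))
                - EgT (Q eps) p.2 (Sp j2) (fun s => f (s / tau eps i))) 0.
Hypothesis He : forall i j, Pnz Pm i j ->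
  forall (epsn : nat -> R) (xn : nat -> S) (nu : probability R R),
    (forall n, 0 < epsn n) -> (forall n, epsn n.+1 <= epsn n) ->
    epsn n @[n --> \oo] --> 0 ->
    (forall n, Sp i (xn n)) ->
    (forall f : R -> R, continuous f -> bounded_fun_R f ->
       EgT (Q (epsn n)) (xn n) (Sp j) (fun s => f (s / tau (epsn n) i))
         @[n --> \oo] --> fine (\int[nu]_r (f r)%:E)%E) ->
    forall a : R, nu [set a] = 0%E.

Local Notation N := (Pnz Pm).

Let class_of y : exists i, Sp i y.
Proof. by have : [set: S] y by []; rewrite -cover => -[i _ iy]; exists i. Qed.

Lemma NP i j : N i j -> [/\ i != j, forall eps x, 0 < eps -> Sp i x -> 0 < Pk (Q eps) x (Sp j),
  forall eps, 0 < eps -> 0 < Pm eps i j &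
  unif_lim0 (Sp i) (fun eps x => Pk (Q eps) x (Sp j) / Pm eps i j) 1].
Proof.
move=> [eps [e0 nz]]; have ij : i != j.
  by apply: contraNneq nz => ->; rewrite Ha_diagP.
have [[_ Z]|[? [? ?]]] := Ha_dich ij; last by split.
by rewrite Z ?eqxx in nz.
Qed.

Lemma nNP i j eps : ~ N i j -> 0 < eps -> (forall x, Sp i x -> Pk (Q eps) x (Sp j) = 0) /\ Pm eps i j = 0.
Proof.
move=> nN e0; have [<-|ij] := eqVneq i j.
  by split=> [x ix|]; [exact: Ha_diag|exact: Ha_diagP].
have [[Z1 Z2]|[_ [Z _]]] := Ha_dich ij.
  by split=> [x ix|]; [exact: Z1|exact: Z2].
by case: nN; exists 1; rewrite gt_eqF// Z.
Qed.

Lemma Pm_ge0 i j eps : 0 < eps -> 0 <= Pm eps i j.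
Proof.
move=> e0; have [/NP[_ _ h _]|/nNP/(_ e0)[_ ->]//] := pselect (N i j).
by rewrite ltW// h.
Qed.

Lemma Pm_le1 i j eps : 0 < eps -> Pm eps i j <= 1.
Proof.
by move=> e0; rewrite -(Ha_sum i e0) (bigD1 j)//= lerDl sumr_ge0// => k _; exact: Pm_ge0.
Qed.

Lemma N_ex i : exists j, N i j.
Proof.
apply: contrapT => H; have := Ha_sum i (@ltr01 R).
rewrite big1 => [|j _]; first by move/eqP; rewrite eq_sym oner_eq0.
by apply: (nNP _ ltr01).2 => Nij; apply: H; exists j.
Qed.

Lemma near_ij (F : 'I_M -> 'I_M -> R -> Prop) :
  (forall i j, N i j -> \forall eps \near 0^'+, F i j eps) ->
  \forall eps \near 0^'+, forall i j, N i j -> F i j eps.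
Proof.
move=> H; apply: filter_forall => i; apply: filter_forall => j.
have [Nij|nN] := pselect (N i j); first by apply: filterS (H i j Nij).
by apply: nearW.
Qed.

Lemma mean_close e : 0 < e -> \forall eps \near 0^'+, forall i j, N i j -> forall y, Sp i y ->
  `|meanT (Q eps) y (Sp j) / tau eps i - 1| <= e.
Proof.
move=> e0; apply: near_ij => i j Nij; apply: filterS (unif_lim0_near (Hb Nij) e0) => eps H y iy.
by rewrite ltW// H.
Qed.

(** If instant sojourns kept probability above one half along some sequence, tightness would provide
    a limit law with an atom at 0, which (e) forbids. *)
Lemma half_near : \forall eps \near 0^'+, forall i j, N i j -> forall y, Sp i y ->
  EgT (Q eps) y (Sp j) (\1_([set 0] : set R)) <= 2^-1.
Proof.
apply: near_ij => i j Nij; apply: contrapT => H.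
have h2 : 0 < 2^-1 :> R by rewrite invr_gt0.
have [e_ [e0 edec elim Pe]] := vanishing_sequence H (mean_close h2).
have ex n : exists y, Sp i y /\ 2^-1 < EgT (Q (e_ n)) y (Sp j) (\1_([set 0] : set R)).
  apply: contrapT => nex; apply: (Pe n).1 => y iy; rewrite leNgt; apply/negP => h.
  by apply: nex; exists y.
have [y_ Hy] := choice (ex : forall n, exists y : S, _).
have [_ Pkp _ _] := NP Nij.
have Pky n : 0 < Pk (Q (e_ n)) (y_ n) (Sp j) by apply: Pkp => //; exact: (Hy n).1.
have mc n := (Pe n).2 i j Nij (y_ n) (Hy n).1.
have [mu [Hmu tight]] := conditional_laws (mSp j) Pky (fun n => Hb_pos i (e0 n)) mc.
have [phi phiS [nu Hnu]] := helly (J := unit) (mu := fun n _ => mu n) (fun _ => tight).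
have cvgE (f : R -> R) : continuous f -> bounded_fun_R f ->
    EgT (Q (e_ (phi n))) (y_ (phi n)) (Sp j) (fun s => f (s / tau (e_ (phi n)) i)) @[n --> \oo] -->
    \int[nu tt]_r f r.
  move=> cf bf; have := Hnu tt f cf bf.
  by under eq_fun do rewrite (Hmu _ f (continuous_measurable cf) bf).
have edec' : {homo e_ : m n / (m <= n)%N >-> n <= m}.
  by apply: (homo_leq (r := fun x y => y <= x)) => // x y z h1 h2'; exact: le_trans h2' h1.
have atom : nu tt [set 0] = 0%E.
  apply: (He Nij (epsn := fun n => e_ (phi n)) (xn := fun n => y_ (phi n))) => //.
  - by move=> n; apply: edec'; exact: ltnW.
  - exact: (cvg_comp _ _ (cvg_subsequence phiS) elim).
  - by move=> n; exact: (Hy _).1.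
(* Tents of width shrinking with [k] are continuous majorants of the indicator of 0. They keep the
   lower bound 1/2 through the weak limit and then decrease to the atom. *)
pose f (k : nat) (s : R) := tent (k%:R * s).
have fL k u v : `|f k u - f k v| <= 2 * k%:R * `|u - v|.
  apply: le_trans (tent_lip _ _) _.
  by rewrite -mulrBr normrM ger0_norm// mulrA.
have fn k s : `|f k s| <= 1 by rewrite ger0_norm ?tent_ge0 ?tent_le1.
have cf k : continuous (f k) by exact: (lipschitz_cont (fL k)).
have f_half k : 2^-1 <= \int[nu tt]_r f k r.
  apply: (cvgn_ge (cvgE (f k) (cf k) _)) => [|n]; first by exists 1.
  apply: (le_trans (ltW (Hy (phi n)).2)).
  rewrite /EgT ler_pM2r ?invr_gt0//.
  apply: (momT_le _ _ (mSp j) (K := 1)) => //.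
  - by apply: measurableT_comp (continuous_measurable (cf k)) _; exact: measurable_funM.
  - by move=> r; rewrite indicE normr_nat lern1 leq_b1.
  - move=> r r0; rewrite indicE; case: (boolP (r \in _)) => [/set_mem ->|_]; last by rewrite tent_ge0.
    by rewrite /f mul0r mulr0 tent0.
have fl : \int[nu tt]_r f k r @[k --> \oo] --> \int[nu tt]_r \1_([set 0] : set R) r.
  apply: (@bounded_convergence _ _ _ (nu tt) _ _ 1) => //.
  - by move=> k; exact: continuous_measurable.
  - apply: aeW => s; have [->|s0] := eqVneq s 0.
      rewrite indicE mem_set//; under eq_fun do rewrite /f mulr0 tent0.
      exact: cvg_cst.
    rewrite indicE memNset; last by move=> /= h; rewrite h eqxx in s0.
    apply/cvgrPdist_le => e ep; near=> k; rewrite sub0r normrN.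
    have ks : `|s|^-1 <= k%:R by near: k; exact: nbhs_infty_ger.
    have {}ks : 1 <= k%:R * `|s| by rewrite -ler_pdivrMr ?normr_gt0// div1r.
    suff -> : f k s = 0 by rewrite normr0 ltW.
    rewrite /f; have [sp|sn] := leP 0 s.
      by apply: tent_right; rewrite (ger0_norm sp) in ks.
    by apply: tent_left; move: ks; rewrite (ltr0_norm sn) mulrN => ks; rewrite lerNr.
have : 2^-1 <= \int[nu tt]_r \1_([set 0] : set R) r by exact: (cvgn_ge fl f_half).
move: atom; rewrite Rintegral_indic// => -[->].
by rewrite leNgt h2.
Unshelve. all: by end_near. Qed.

Lemma momT_null eps y i (f : R -> R) : measurable_fun setT f -> (forall z, 0 <= z -> 0 <= f z) ->
  Pk (Q eps) y (Sp i) = 0 -> momT (Q eps) y (Sp i) f = 0%E.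
Proof.
move=> mf f0 Pk0; have mT : measurable (TD (Sp i) : set (S * R)) by exact: measurable_TD.
rewrite /momT (@ge0_negligible_integral _ _ _ _ _ (TD (Sp i)))//.
- by rewrite setDv integral_set0.
- by apply/measurable_EFinP; apply: measurable_funTS; exact: measurable_comp_snd.
- by move=> p [_ /=]; rewrite in_itv/= andbT lee_fin; exact: f0.
- by rewrite Pk_fin// Pk0.
Qed.

Lemma momT_cst1 (K : R.-pker S ~> (S * R)%type) y (B : set S) : measurable B ->
  momT K y B (cst 1) = (Pk K y B)%:E.
Proof.
move=> mB; transitivity (\int[K y]_(p in TD B) cst 1%E p)%E; first by [].
by rewrite integral_cst ?mul1e ?Pk_fin//; exact: measurable_TD.
Qed.

Lemma Pk_sum1 eps y : 0 < eps -> \sum_j Pk (Q eps) y (Sp j) = 1.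
Proof.
move=> e0; have := momT_TD_union (Q eps) y mSp disj cover (f := cst 1) (measurable_cst _) (fun _ _ => ler01).
rewrite (momT_cst1 _ _ measurableT) (eq_bigr _ (fun j _ => momT_cst1 (Q eps) y (mSp j))).
by rewrite -(Pk_fin _ _ measurableT) Q_supp// sumEFin => -[].
Qed.

(** Supplies the factor 2 between leaving the class and being seen to leave it by [exit_time]. *)
Lemma half_kernel : \forall eps \near 0^'+, forall y,
  ((2^-1)%:E <= Q eps y [set p | (0 < p.2)%R])%E.
Proof.
apply: filterS2 (nbhs_right_gt 0) half_near => eps e0 H y.
have [i iy] := class_of y.
pose z0 : R -> R := \1_([set 0] : set R).
have mi : measurable_fun setT z0 by exact: measurable_indic.
have i0 z : 0 <= z -> 0 <= z0 z by move=> _; rewrite /z0 indicE.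
have mT : measurable (TD setT : set (S * R)) by exact: measurable_TD.
have E : (momT (Q eps) y setT z0 <= (2^-1)%:E)%E.
  rewrite (momT_TD_union (Q eps) y mSp disj cover mi i0).
  apply: (@le_trans _ _ (\sum_j (Pk (Q eps) y (Sp j) / 2)%:E)%E); last first.
    by rewrite sumEFin -mulr_suml Pk_sum1// mul1r.
  apply: lee_sum => j _; have [Nij|nN] := pselect (N i j); last first.
    by have [Z _] := nNP nN e0; rewrite momT_null ?Z// mul0r.
  have [_ /(_ eps y e0 iy) Pkp _ _] := NP Nij.
  have := H i j Nij y iy; rewrite -(ler_pM2l Pkp) -momT_EgT// -lee_fin fineK//.
  rewrite ge0_fin_numE; last by apply: integral_ge0 => p _; rewrite lee_fin /z0 indicE.
  apply: (@le_lt_trans _ _ (\int[Q eps y]_(p in TD (Sp j)) cst 1 p)%E).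
    apply: ge0_le_integral => //.
    - exact: measurable_TD.
    - by apply/measurable_EFinP; apply: measurable_funTS; exact: measurable_comp_snd.
    - by move=> p _; rewrite lee_fin /z0 indicE lern1 leq_b1.
  by rewrite integral_cst ?mul1e; [rewrite Pk_fin ?ltry|exact: measurable_TD].
have m0 := measurable_TD_gt (S := S) (0 : R).
have mZ : measurable (TD setT `&` [set p : S * R | p.2 = 0]).
  apply: measurableI => //; rewrite (_ : [set _ | _] = snd @^-1` [set 0])//.
  by rewrite -[X in measurable X]setTI; exact: measurable_snd.
have h : (1 <= Q eps y (TD setT `&` [set p | p.2 = 0%R]) + Q eps y [set p | (0 < p.2)%R])%E.
  rewrite -(Q_supp y e0); apply: le_trans (measureU2 _ mZ m0); apply: le_measure; rewrite ?inE//.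
    exact: measurableU.
  move=> p [? /=]; rewrite in_itv/= andbT le_eqVlt => /orP[/eqP p2|p2]; [left|by right].
  by split=> //; split=> //=; rewrite in_itv/= -p2 lexx.
have hZ : (Q eps y (TD setT `&` [set p | p.2 = 0%R]) <= (2^-1)%:E)%E.
  apply: le_trans E; rewrite /momT.
  rewrite (_ : Q eps y _ = \int[Q eps y]_(p in TD setT) ((\1_[set p : S * R | p.2 = 0%R] p : R))%:E)%E; last first.
    rewrite integral_indic// 1?setIC//.
    rewrite (_ : [set _ | _] = snd @^-1` [set 0])//.
    by rewrite -[X in measurable X]setTI; exact: measurable_snd.
  rewrite (_ : (\int[_]_(p in _) _)%E = \int[Q eps y]_(p in TD setT) (\1_([set 0] : set R) p.2)%:E)%E//.
have := le_trans h (leeD hZ (lexx (Q eps y [set p | (0 < p.2)%R]))).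
rewrite -leeBlDl// -EFinB; congr (_ <= _)%E; congr EFin; lra.
Qed.

(** * Comparison with the limit chain *)

Context (P0 : 'I_M -> 'I_M -> R) (lam tau0 : 'I_M -> R).
Hypothesis HP0 : forall i j : 'I_M, (i < M')%N -> Pm eps i j @[eps --> 0^'+] --> P0 i j.
Hypothesis Hclosed : forall i j : 'I_M, (i < M')%N -> (M' <= j)%N -> P0 i j = 0.
Hypothesis Hirred : forall i j : 'I_M, (i < M')%N -> (j < M')%N -> i != j ->
  clos_trans 'I_M (fun a b => 0 < P0 a b) i j.
Hypothesis Hlam_ge0 : forall i : 'I_M, (i < M')%N -> 0 <= lam i.
Hypothesis Hlam_sum : \sum_(i < M | (i < M')%N) lam i = 1.
Hypothesis Hlam_inv : forall j : 'I_M, (j < M')%N ->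
  lam j = \sum_(i < M | (i < M')%N) lam i * P0 i j.
Hypothesis Htau0 : forall i : 'I_M, (i < M')%N -> tau eps i @[eps --> 0^'+] --> tau0 i.
Hypothesis Htau_le1 : forall i : 'I_M, (i < M')%N -> tau0 i <= 1.

Let D : pred 'I_M := fun i => (i < M')%N.

Let near_D (F : 'I_M -> R -> Prop) : (forall i, D i -> \forall eps \near 0^'+, F i eps) ->
  \forall eps \near 0^'+, forall i, D i -> F i eps.
Proof.
move=> H; apply: filter_forall => i; have [Di|nD] := boolP (D i).
  by apply: filterS (H i Di).
by apply: nearW => eps Di; case/negP: nD.
Qed.

Lemma P0_close e : 0 < e -> \forall eps \near 0^'+, forall i j, D i -> `|P0 i j - Pm eps i j| <= e.
Proof.
move=> e0; apply: filter_forall => i; apply: filter_forall => j.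
have [Di|nD] := boolP (D i); last by apply: nearW => eps Di; case/negP: nD.
by have /cvgrPdist_le/(_ e e0) := @HP0 i j Di; apply: filterS.
Qed.

Lemma tau_close e : 0 < e -> \forall eps \near 0^'+, forall i, D i -> `|tau0 i - tau eps i| <= e.
Proof.
by move=> e0; apply: near_D => i Di; have /cvgrPdist_le/(_ e e0) := Htau0 Di.
Qed.

Let approx e : 0 < e -> exists eps, [/\ 0 < eps, forall i j, D i -> `|P0 i j - Pm eps i j| <= e &
  forall i, D i -> `|tau0 i - tau eps i| <= e].
Proof.
move=> e0; apply: (@filter_ex _ (0 : R)^'+).
by apply: filterS3 (nbhs_right_gt 0) (P0_close e0) (tau_close e0) => eps; split.
Qed.

Lemma P0_ge0 i j : D i -> 0 <= P0 i j.
Proof.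
move=> Di; apply/ler_addgt0Pr => e e0; have [eps [eps0 H _]] := approx e0.
by have := H i j Di; have := Pm_ge0 i j eps0; rewrite ler_norml; lra.
Qed.

Lemma P0_le1 i j : D i -> P0 i j <= 1.
Proof.
move=> Di; apply/ler_addgt0Pr => e e0; have [eps [eps0 H _]] := approx e0.
by have := H i j Di; have := Pm_le1 i j eps0; rewrite ler_norml; lra.
Qed.

Lemma tau0_ge0 i : D i -> 0 <= tau0 i.
Proof.
move=> Di; apply/ler_addgt0Pr => e e0; have [eps [eps0 _ H]] := approx e0.
by have := H i Di; have := Hb_pos i eps0; rewrite ler_norml; lra.
Qed.

Lemma P0_sum i : D i -> \sum_(j | D j) P0 i j = 1.
Proof.
move=> Di; transitivity (\sum_j P0 i j).
  rewrite [RHS](bigID D)/= [X in _ + X]big1 ?addr0// => j; rewrite /D -leqNgt; exact: Hclosed.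
apply/eqP; rewrite -subr_eq0 -normr_le0; apply/ler_addgt0Pr => e e0; rewrite add0r.
have M0 : (0 < M)%N by exact: leq_ltn_trans (leq0n i) (ltn_ord i).
have eM : 0 < e / M%:R by rewrite divr_gt0// ltr0n.
have [eps [eps0 H _]] := approx eM.
rewrite -(Ha_sum i eps0) -sumrB; apply: le_trans (ler_norm_sum _ _ _) _.
apply: (@le_trans _ _ (\sum_(j < M) e / M%:R)); first by apply: ler_sum => j _; exact: H.
by rewrite sumr_const card_ord -[_ *+ M](mulr_natr (e / M%:R)) divfK// pnatr_eq0 -lt0n.
Qed.

Lemma Pk_close e : 0 < e -> \forall eps \near 0^'+, forall i j, D i -> forall y, Sp i y ->
  `|Pk (Q eps) y (Sp j) - P0 i j| <= e.
Proof.
move=> e0; have e2 : 0 < e / 2 by rewrite divr_gt0.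
have H1 : \forall eps \near 0^'+, forall i j, N i j -> forall y, Sp i y ->
    `|Pk (Q eps) y (Sp j) / Pm eps i j - 1| < e / 2.
  by apply: near_ij => i j /NP[_ _ _ U]; exact: unif_lim0_near U e2.
apply: filterS3 (nbhs_right_gt 0) H1 (P0_close e2) => eps eps0 {}H1 H2 i j Di y iy.
have := H2 i j Di; rewrite distrC => h2.
have [Nij|nN] := pselect (N i j); last first.
  by have [Z1 Z2] := nNP nN eps0; rewrite Z1//; rewrite Z2 in h2; lra.
have [_ _ /(_ eps eps0) Pp _] := NP Nij.
rewrite -(subrK (Pm eps i j) (Pk _ _ _)) -addrA; apply: le_trans (ler_normD _ _) _.
rewrite [leRHS](_ : e = e / 2 + e / 2); last by lra.
apply: lerD => //.
rewrite (_ : _ - _ = (Pk (Q eps) y (Sp j) / Pm eps i j - 1) * Pm eps i j); last first.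
  by rewrite mulrBl divfK ?mul1r// gt_eqF.
rewrite normrM (gtr0_norm Pp) -[leRHS]mulr1; apply: ler_pM => //; last exact: Pm_le1.
  exact: ltW.
by rewrite ltW// H1.
Qed.

Lemma mean_pos eps i j y : 0 < eps -> N i j -> Sp i y ->
  `|meanT (Q eps) y (Sp j) / tau eps i - 1| <= 2^-1 ->
  0 < meanT (Q eps) y (Sp j) <= 2 * tau eps i.
Proof.
move=> e0 Nij iy H.
have /andP[h1 h2] := mean_bounds (Q_ := fun=> Q eps) (y_ := fun=> y) (tau_ := fun=> tau eps i)
  (fun=> Hb_pos i e0) (fun=> H) 0%N.
by rewrite h2 andbT; apply: lt_le_trans h1; rewrite divr_gt0// Hb_pos.
Qed.

Let half0 : 0 < 2^-1 :> R. Proof. by rewrite invr_gt0. Qed.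

Lemma momT_id eps i y j : 0 < eps -> Sp i y ->
  (N i j -> `|meanT (Q eps) y (Sp j) / tau eps i - 1| <= 2^-1) ->
  momT (Q eps) y (Sp j) id = (Pk (Q eps) y (Sp j) * meanT (Q eps) y (Sp j))%:E.
Proof.
move=> e0 iy H; have [Nij|nN] := pselect (N i j).
  have [_ Pp _ _] := NP Nij.
  by apply: (momT_mean (Pp _ _ e0 iy)); have /andP[] := mean_pos e0 Nij iy (H Nij).
by have [Z _] := nNP nN e0; rewrite momT_null ?Z// mul0r.
Qed.

Lemma mean_total e : 0 < e -> \forall eps \near 0^'+, forall i, D i -> forall y, Sp i y ->
  momT (Q eps) y setT id \is a fin_num /\ `|fine (momT (Q eps) y setT id) - tau0 i| <= e.
Proof.
move=> e0; pose d := Num.min 2^-1 (e / 4).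
have d0 : 0 < d by rewrite lt_min half0 divr_gt0.
have d1 : 0 < Num.min 1 (e / 4) by rewrite lt_min ltr01 divr_gt0.
apply: filterS3 (nbhs_right_gt 0) (mean_close d0) (tau_close d1) => eps eps0 H1 H2 i Di y iy.
have d2 : d <= 2^-1 by rewrite ge_min lexx.
have d4 : d <= e / 4 by rewrite ge_min lexx orbT.
rewrite (momT_TD_union (Q eps) y mSp disj cover (f := id)) //.
under eq_bigr => j _ do rewrite (momT_id eps0 iy (fun Nij => le_trans (H1 i j Nij y iy) d2)).
rewrite sumEFin/=; split=> //.
have t2 : `|tau0 i - tau eps i| <= Num.min 1 (e / 4) by exact: H2.
have ht1 : tau eps i <= 2.
  have := Htau_le1 Di; have := le_trans t2 (_ : Num.min 1 (e / 4) <= 1); rewrite ge_min lexx => /(_ isT).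
  by rewrite ler_norml; lra.
have ht4 : `|tau0 i - tau eps i| <= e / 4 by apply: le_trans t2 _; rewrite ge_min lexx orbT.
have tp := Hb_pos i eps0.
have h : `|\sum_j Pk (Q eps) y (Sp j) * meanT (Q eps) y (Sp j) - tau eps i| <= d * tau eps i.
  rewrite -{1}[tau eps i]mul1r -{1}(Pk_sum1 y eps0) mulr_suml -sumrB.
  apply: le_trans (ler_norm_sum _ _ _) _.
  rewrite -[leRHS]mul1r -(Pk_sum1 y eps0) mulr_suml; apply: ler_sum => j _.
  have [Nij|nN] := pselect (N i j); last by have [Z _] := nNP nN eps0; rewrite Z// !mul0r subrr normr0.
  have Pk0 : 0 <= Pk (Q eps) y (Sp j) by exact: fine_ge0.
  rewrite -mulrBr normrM (ger0_norm Pk0) ler_wpM2l//.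
  rewrite (_ : _ - _ = (meanT (Q eps) y (Sp j) / tau eps i - 1) * tau eps i); last first.
    by rewrite mulrBl divfK ?mul1r// gt_eqF.
  by rewrite normrM (gtr0_norm tp) ler_pM2r// H1.
have h2 : d * tau eps i <= e / 4 * 2 by apply: ler_pM => //; exact: ltW.
move: h ht4; rewrite !ler_norml; lra.
Qed.

Lemma moment2_near : exists2 C, 0 <= C & \forall eps \near 0^'+, forall i, D i -> forall y, Sp i y ->
  (\int[Q eps y]_(p in TD setT) (p.2 ^+ 2)%:E <= C%:E)%E.
Proof.
have [C1 [eps1 [eps10 HC]]] := Hc.
(* The raw second moment is at most [2 * C1 * tau^2 + 2 * mean^2] in each cell, and for small [eps]
   one has [tau <= 2] and [mean <= 4]. *)
exists (8 * `|C1| + 32); first by rewrite addr_ge0// mulr_ge0.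
have H0 : \forall eps \near 0^'+, 0 < eps /\ eps <= eps1.
  by apply: filterS2 (nbhs_right_gt 0) (nbhs_right_le eps10).
apply: filterS3 H0 (mean_close half0) (tau_close ltr01) => eps [eps0 le1] H1 H2 i Di y iy.
have tp := Hb_pos i eps0.
have t2 : tau eps i <= 2 by have := H2 i Di; have := Htau_le1 Di; rewrite ler_norml; lra.
rewrite -[(\int[_]_(p in _) _)%E]/(momT (Q eps) y setT (fun s => s ^+ 2)).
have msq : measurable_fun setT (fun s : R => s ^+ 2) by exact: exprn_measurable.
have sq0 (z : R) : 0 <= z -> 0 <= z ^+ 2 by move=> _; exact: sqr_ge0.
rewrite (momT_TD_union (Q eps) y mSp disj cover msq sq0).
apply: (@le_trans _ _ (\sum_j ((8 * `|C1| + 32) * Pk (Q eps) y (Sp j))%:E)%E); last first.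
  by rewrite sumEFin -mulr_sumr Pk_sum1// mulr1.
apply: lee_sum => j _; have [Nij|nN] := pselect (N i j); last first.
  by have [Z _] := nNP nN eps0; rewrite momT_null ?Z// mulr0.
have [_ /(_ eps y eps0 iy) Pp _ _] := NP Nij.
have /andP[m0 m2] := mean_pos eps0 Nij iy (H1 i j Nij y iy).
apply: le_trans (moment2_varT (mSp j) (HC eps eps0 le1 i j Nij y iy)) _.
rewrite lee_fin ler_pM2r//; apply: lerD.
  have : C1 * tau eps i ^+ 2 <= `|C1| * 2 ^+ 2.
    apply: le_trans (ler_norm _) _; rewrite normrM ler_wpM2l// ger0_norm ?sqr_ge0//.
    by rewrite lerXn2r ?nnegrE// ltW.
  by rewrite expr2; lra.
have : meanT (Q eps) y (Sp j) ^+ 2 <= 4 ^+ 2.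
  by rewrite lerXn2r ?nnegrE ?(ltW m0)//; lra.
by rewrite expr2 [4 ^+ 2]expr2; lra.
Qed.

(** Nothing is assumed on the rows of [P0] outside the class; setting them to 0 makes the matrix
    non-negative for all indices. *)
Let P (i j : 'I_M) : R := if D i then P0 i j else 0.
Let PE i j : D i -> P i j = P0 i j. Proof. by rewrite /P => ->. Qed.

Let P_ge0 i j : 0 <= P i j.
Proof. by rewrite /P; case: ifP => // Di; exact: P0_ge0. Qed.

Let P_le1 i j : P i j <= 1.
Proof. by rewrite /P; case: ifP => // Di; exact: P0_le1. Qed.

Let P0_closed i j : D i -> 0 < P0 i j -> D j.
Proof. by move=> Di; apply: contraLR; rewrite /D -leqNgt => /(Hclosed Di) ->; rewrite ltxx. Qed.

Let P_closed i j : D i -> 0 < P i j -> D j.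
Proof. by move=> Di; rewrite PE//; exact: P0_closed. Qed.

Let P_irr i j : D i -> D j -> i != j -> clos_trans 'I_M (fun a b => 0 < P a b) i j.
Proof.
move=> Di Dj ij.
suff H a b : clos_trans 'I_M (fun a b => 0 < P0 a b) a b -> D a ->
    D b /\ clos_trans 'I_M (fun a b => 0 < P a b) a b.
  exact: (H i j (Hirred Di Dj ij) Di).2.
elim=> {a b} [a b ab Da|a b c _ IH1 _ IH2 Da].
  by split; [exact: P0_closed ab|apply: t_step; rewrite PE].
have [Db ab] := IH1 Da; have [Dc bc] := IH2 Db; split=> //; exact: t_trans ab bc.
Qed.

Let D_path (F : 'I_M -> Prop) i j : D i -> D j -> F i ->
  (forall a b, D a -> D b -> 0 < P0 a b -> F a -> F b) -> F j.
Proof.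
move=> Di Dj Fi step; have [<-//|ij] := eqVneq i j.
suff H a b : clos_trans 'I_M (fun a b => 0 < P0 a b) a b -> D a -> F a -> D b /\ F b.
  exact: (H i j (Hirred Di Dj ij) Di Fi).2.
elim=> {a b} [a b ab Da Fa|a b c _ IH1 _ IH2 Da Fa].
  by have Db := P0_closed Da ab; split=> //; exact: step ab Fa.
by have [Db Fb] := IH1 Da Fa; exact: IH2.
Qed.

(** Some weight is positive because the sum is 1, and invariance carries positivity along every edge
    of the irreducible class. *)
Lemma lam_gt0 j : D j -> 0 < lam j.
Proof.
move=> Dj; have [i Di lami] : exists2 i, D i & 0 < lam i.
  apply: contrapT => H; have := Hlam_sum; rewrite big1 => [|i Di].
    by move/eqP; rewrite eq_sym oner_eq0.
  apply/eqP; rewrite eq_le Hlam_ge0// andbT leNgt; apply/negP => li; apply: H; by exists i.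
apply: (D_path (F := fun i => 0 < lam i) Di Dj lami) => a b Da Db ab la.
rewrite Hlam_inv// (bigD1 a)//= ltr_pwDl ?mulr_gt0// sumr_ge0// => k /andP[Dk _].
by rewrite mulr_ge0 ?Hlam_ge0 ?P0_ge0.
Qed.

Let P0_nN i j : D i -> ~ N i j -> P0 i j = 0.
Proof.
move=> Di nN; apply/eqP; rewrite eq_le P0_ge0// andbT; apply/ler_addgt0Pr => e e0.
have [eps [eps0 H _]] := approx e0.
by have := H i j Di; have [_ ->] := nNP nN eps0; rewrite subr0 add0r; apply: le_trans (ler_norm _).
Qed.

Local Notation A := (\bigcup_(i in [set i | D i]) Sp i).
Let mA : measurable A. Proof. exact: measurable_class_union. Qed.

(** A cell could be empty a priori. The starting point provides one inhabited cell, and a positive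
    transition probability forces its target to be inhabited. *)
Lemma class_nonempty x i : A x -> D i -> exists y, Sp i y.
Proof.
move=> [k Dk xk] Di; apply: (D_path (F := fun i => exists y, Sp i y) Dk Di); first by exists x.
move=> a b Da Db ab [y ya].
have Nab : N a b by apply: contrapT => nN; rewrite P0_nN ?ltxx// in ab.
have [_ /(_ 1 y ltr01 ya) Pp _ _] := NP Nab.
apply: contrapT => nb; suff : Pk (Q 1) y (Sp b) = 0 by move=> Z; rewrite Z ltxx in Pp.
rewrite (_ : Sp b = set0); first by rewrite /Pk /TD set0X measure0.
by apply/seteqP; split=> // z bz; case: nb; exists z.
Qed.

Context {dO : measure_display} {O : measurableType dO}.

Lemma unit_bound_near i0 : D i0 -> tau0 i0 = 1 -> exists U, \forall eps \near 0^'+,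
  forall (Pr : probability O R) (x : S) (Y : nat -> O -> S * R), is_MRchain Pr (Q eps) x Y -> A x ->
  forall a, (renewal_sum Pr Y A (fun q => (\1_`[a, (a + 1)%R] q.2)%:E) <= U%:E)%E.
Proof.
move=> Di0 tau_i0.
have P_sum i : D i -> \sum_(j | D j) P i j = 1.
  by move=> Di; rewrite -(P0_sum Di); apply: eq_bigr => j _; rewrite PE.
have [W [c [c0 W01 HW]]] := lyapunov P_ge0 P_sum P_closed (fun i Di => P_irr Di Di0).
have [C C0 HC] := moment2_near.
have C1 : 0 < C + 1 by rewrite ltr_wpDl.
pose theta := (4 * (C + 1))^-1.
have th0 : 0 < theta by rewrite invr_gt0 mulr_gt0.
have c2 : 0 < c / 2 by rewrite divr_gt0.
(* Equality in the last condition of [drift_bound], with drift [c / 2]. The other half of [c] pays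
   for replacing [P0] by the actual transition probabilities, at most [c / 2 / M] for each
   target. *)
pose L := (1 + c / 2) / (theta / 4).
have th4 : 0 < theta / 4 by rewrite divr_gt0.
have L0 : 0 <= L by rewrite divr_ge0 ?(ltW th4)// addr_ge0// ltW.
exists ((L + 1) * expR theta / (c / 2)).
have M0 : (0 < M)%N by exact: leq_ltn_trans (leq0n i0) (ltn_ord i0).
have MR0 : 0 < M%:R :> R by rewrite ltr0n.
have cM : 0 < c / 2 / M%:R by rewrite divr_gt0.
have H0 : \forall eps \near 0^'+, 0 < eps /\ forall i, D i -> forall y, Sp i y ->
  (\int[Q eps y]_(p in TD setT) (p.2 ^+ 2)%:E <= C%:E)%E.
  by apply: filterS2 (nbhs_right_gt 0) HC.
apply: filterS3 H0 (mean_total half0) (Pk_close cM) => eps [eps0 H1] H2 H3 Pr x Y HY Ax a.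
have V01 j : 0 <= L + W j <= L + 1.
  by have /andP[w0 w1] := W01 j; rewrite addr_ge0//= lerD2l.
apply: (renewal_unit_bound HY mA Ax (v := class_fun D Sp (fun j => L + W j)) (L := L + 1)) => //.
- exact: measurable_class_fun.
- move=> z; have [[i Di iz]|nA] := pselect (A z); first by rewrite (class_funE disj _ Di iz).
  by rewrite class_fun_out// lexx/= addr_ge0.
- exact: ltW.
move=> y [i Di iy].
apply: (drift_bound (Q_supp y eps0) mSp disj (i0 := i0) Di iy L0 (ltW th0) W01).
- move=> ii0; apply: (@le_trans _ _ (\sum_(j | D j) (P i j * W j + c / 2 / M%:R))).
    apply: ler_sum => j Dj; rewrite PE//; have := H3 i j Di y iy.
    rewrite ler_norml => /andP[_ h]; have /andP[w0 w1] := W01 j.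
    by rewrite -lerBlDl -mulrBl; apply: le_trans (ler_wpM2r w0 h) _; rewrite ler_piMr// ltW.
  rewrite big_split/=; have h1 := HW i Di ii0.
  have h2 : \sum_(j | D j) c / 2 / M%:R <= c / 2.
    apply: (@le_trans _ _ (\sum_(j < M) c / 2 / M%:R)).
      by rewrite [leRHS](bigID D)/= lerDl sumr_ge0// => j _; exact: ltW.
    by rewrite sumr_const card_ord -[_ *+ M](mulr_natr (c / 2 / M%:R)) divfK// gt_eqF.
  by lra.
- move=> ii0; have [fin m1] := H2 i Di y iy; rewrite ii0 tau_i0 in m1.
  apply: (laplace_bound (Q_supp y eps0) C1 erefl).
    rewrite -[leRHS]/(momT (Q eps) y setT id) -(fineK fin) lee_fin.
    by move: m1; rewrite ler_norml; lra.
  by apply: le_trans (H1 i Di y iy) _; rewrite lee_fin lerDl.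
- by rewrite /L divfK// gt_eqF.
Qed.

Let momT_fin eps y (B : set S) (f : R -> R) : measurable B -> measurable_fun setT f ->
  (forall r, 0 <= f r <= 1) -> momT (Q eps) y B f \is a fin_num.
Proof.
move=> mB mf f01; apply: integrable_fin_num; first exact: measurable_TD.
apply: (momT_integrable (Q eps) y mB mf (K := 1)) => r.
by have /andP[? ?] := f01 r; rewrite ger0_norm.
Qed.

Let EgT01 eps y (B : set S) (f : R -> R) : measurable B -> measurable_fun setT f ->
  (forall r, 0 <= f r <= 1) -> 0 < Pk (Q eps) y B -> 0 <= EgT (Q eps) y B f <= 1.
Proof.
move=> mB mf f01 Pp; apply/andP; split.
  by apply: EgT_ge0 => // z _; have /andP[] := f01 z.
rewrite /EgT ler_pdivrMr// mul1r -[leRHS]/(fine (Pk (Q eps) y B)%:E) -momT_cst1//.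
apply: (momT_le (Q eps) y mB (K := 1)) => //.
- by move=> r; have /andP[? ?] := f01 r; rewrite ger0_norm.
- by move=> r; rewrite normr1.
- by move=> r _; have /andP[] := f01 r.
Qed.

(** * Limit laws and occupation along a vanishing sequence *)

Section sequence.
Context (e_ : nat -> R) (C U : R) (i0 : 'I_M).
Hypothesis e_gt0 : forall n, 0 < e_ n.
Hypothesis e_dec : forall n, e_ n.+1 <= e_ n.
Hypothesis e_lim : e_ n @[n --> \oo] --> (0 : R).
Hypothesis mean_half : forall n i j, N i j -> forall y, Sp i y ->
  `|meanT (Q (e_ n)) y (Sp j) / tau (e_ n) i - 1| <= 2^-1.
Hypothesis Di0 : D i0.
Hypothesis tau_i0 : tau0 i0 = 1.

(* By (d) the limit law depends neither on the starting point nor on the target cell, so one choice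
   of point and cell per class is enough for the compactness argument. *)
Lemma limit_laws : (forall i, D i -> exists y, Sp i y) ->
  exists (phi : nat -> nat) (nu : 'I_M -> probability R R),
  [/\ forall n, (phi n < phi n.+1)%N, forall a, nu i0 [set a] = 0%E &
  forall i j (f : R -> R) (K : R), D i -> (forall u v, `|f u - f v| <= K * `|u - v|) ->
    (forall u, 0 <= f u <= 1) -> forall e, 0 < e ->
    \forall n \near \oo, forall y, Sp i y ->
      `|fine (momT (Q (e_ (phi n))) y (Sp j) f) - P i j * \int[nu i]_s f s| <= e].
Proof.
move=> ne.
have [z0 _] := ne i0 Di0.
have /choice[yy Hyy] : forall i, exists y : S, D i -> Sp i y.
  move=> i.
  have [Di|nD] := boolP (D i); last by exists z0 => Di; case/negP: nD.
  by have [y iy] := ne i Di; exists y.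
have [jj Hjj] := choice N_ex.
have /choice[mu Hmu] : forall i, exists mu : nat -> probability R R,
    (D i -> forall n (f : R -> R), measurable_fun setT f -> (exists K, forall r, `|f r| <= K) ->
      \int[mu n]_r f r = EgT (Q (e_ n)) (yy i) (Sp (jj i)) (fun s => f (s / tau (e_ n) i))) /\
    (forall e, 0 < e -> exists K : R, forall n,
      (mu n (~` (`[(- K)%R, K]%classic : set R)) <= e%:E)%E).
  move=> i.
  have [Di|nD] := boolP (D i).
    have [_ Pp _ _] := NP (Hjj i).
    have [mu [H1 H2]] := conditional_laws (mSp (jj i)) (fun n => Pp (e_ n) (yy i) (e_gt0 n) (Hyy i Di))
      (fun n => Hb_pos i (e_gt0 n)) (fun n => mean_half n (Hjj i) (Hyy i Di)).
    by exists mu; split.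
  (* [helly] needs a tight family for every index; outside the class any fixed law will do. *)
  exists (fun=> dirac (0 : R) : probability R R); split=> [Di|e ep]; first by case/negP: nD.
  exists 1 => n; rewrite /= diracE memNset ?lee_fin ?ltW// => /=; apply.
  by rewrite in_itv/= ler01 lerN10.
have [phi phiS [nu' Hnu']] := helly (mu := fun n i => mu i n) (fun i => (Hmu i).2).
have mscale i : measurable_fun setT (fun s : R => tau0 i * s) by exact: measurable_funM.
(* [nu'] is the limit law of [T / tau]; its image under multiplication by [tau0] is that of [T]. At
   [i0] the factor is 1, so atomlessness survives. *)
have [nu Hnu] := choice (fun i => pushforward_probability (nu' i) (mscale i)).
have cvgE i (f : R -> R) : D i -> continuous f -> bounded_fun_R f ->
    EgT (Q (e_ (phi n))) (yy i) (Sp (jj i)) (fun s => f (s / tau (e_ (phi n)) i)) @[n --> \oo] -->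
    \int[nu' i]_r f r.
  move=> Di cf bf; have := Hnu' i f cf bf.
  by under eq_fun do rewrite ((Hmu i).1 Di _ f (continuous_measurable cf) bf).
have edec' : {homo e_ : m n / (m <= n)%N >-> n <= m}.
  by apply: (homo_leq (r := fun x y => y <= x)) => // x y z h1 h2'; exact: le_trans h2' h1.
have phi_gt0 n : 0 < e_ (phi n) by [].
have phi_lim : e_ (phi n) @[n --> \oo] --> (0 : R) by exact: (cvg_comp _ _ (cvg_subsequence phiS) e_lim).
have atom a : nu' i0 [set a] = 0%E.
  apply: (He (Hjj i0) (epsn := fun n => e_ (phi n)) (xn := fun=> yy i0)) => //.
  - by move=> n; apply: edec'; exact: ltnW.
  - by move=> _; exact: Hyy.
  - by move=> f cf bf; exact: cvgE.
exists phi, nu; split=> //.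
  move=> a; rewrite Rintegral_indic// Hnu; last 2 first.
  - exact: measurable_indic.
  - by exists 1 => r; rewrite indicE normr_nat lern1 leq_b1.
  rewrite tau_i0; have := atom a; rewrite Rintegral_indic// => <-; congr EFin.
  by apply: eq_Rintegral => s _; rewrite mul1r.
move=> i j f K Di fL f01 e ep.
have f1 r : `|f r| <= 1 by have /andP[? ?] := f01 r; rewrite ger0_norm.
have cf : continuous f := lipschitz_cont fL.
have mf := continuous_measurable cf.
have K0 : 0 <= K by have := fL 0 1; rewrite sub0r normrN normr1 mulr1; apply: le_trans.
have [Nij|nN] := pselect (N i j); last first.
  apply: nearW => n y iy; rewrite PE// P0_nN// mul0r subr0.
  have [Z _] := nNP nN (phi_gt0 n); rewrite momT_null ?Z ?normr0 ?ltW// => z _.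
  by have /andP[] := f01 z.
set I := \int[nu i]_s f s.
have IE : I = \int[nu' i]_s f (tau0 i * s) by rewrite /I Hnu//; exists 1.
pose h (s : R) := f (tau0 i * s).
have hL u v : `|h u - h v| <= K * `|tau0 i| * `|u - v|.
  by apply: le_trans (fL _ _) _; rewrite -mulrBr normrM mulrA.
have ch : continuous h := lipschitz_cont hL.
have bh : bounded_fun_R h by exists 1 => r; exact: f1.
have I01 : 0 <= I <= 1.
  apply/andP; split; first by apply: Rintegral_ge0 => r _; have /andP[] := f01 r.
  rewrite -[leRHS](Rintegral_prob_cst (nu i) 1); apply: le_Rintegral => //.
  - exact: (@bounded_integrable _ _ _ _ _ 1).
  - by apply: (@bounded_integrable _ _ _ _ _ 1) => // r; rewrite normr1.
  - by move=> r _; have /andP[] := f01 r.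
have e4 : 0 < e / 4 by rewrite divr_gt0.
(* The rescaling error is at most [K * (d / t) * (2 * t) = 2 * K * d]. The other three quarters of
   [e] go to the transition probability, to the change of point and target by (d), and to the weak
   limit. *)
pose d := e / 4 / (2 * K + 1).
have d0 : 0 < d by rewrite divr_gt0//; lra.
have dK : 2 * K * d <= e / 4.
  rewrite /d mulrA ler_pdivrMr; last by lra.
  by rewrite [leRHS]mulrC ler_wpM2r ?(ltW e4)//; lra.
have n1 := cvg_at_right0 phi_gt0 phi_lim (Pk_close e4).
have n2 := cvg_at_right0 phi_gt0 phi_lim (tau_close d0).
have n3 := cvg_at_right0 phi_gt0 phi_lim (unif_lim0_near (Hd ch bh Nij (Hjj i)) e4).
have n4 := cvgn_near (cvgE i h Di ch bh) e4.
apply: filterS2 (filterI n1 n2) (filterI n3 n4) => n [H1 H2] [H3 H4] y iy.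
have [_ /(_ _ y (phi_gt0 n) iy) Pp _ _] := NP Nij.
set q := Q (e_ (phi n)) in H1 H3 H4 Pp *; set t := tau (e_ (phi n)) i in H3 H4.
have tp : 0 < t by exact: Hb_pos.
have /andP[m0 m2] : 0 < meanT q y (Sp j) <= 2 * t.
  by apply: (mean_pos (phi_gt0 n) Nij iy); exact: mean_half.
have /andP[E0 E1] : 0 <= EgT q y (Sp j) f <= 1 by exact: EgT01.
have s1 : `|EgT q y (Sp j) f - EgT q y (Sp j) (fun s => h (s / t))| <= e / 4.
  apply: le_trans (EgT_shift (mSp j) Pp m0 (tau0 i) tp K0 fL f01) _; apply: le_trans dK.
  rewrite (_ : 1 - tau0 i / t = (t - tau0 i) / t); last by field; rewrite gt_eqF.
  rewrite normrM (@gtr0_norm _ t^-1) ?invr_gt0// distrC.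
  apply: (@le_trans _ _ (K * (d / t) * (2 * t))).
    apply: ler_pM => //; [by rewrite mulr_ge0// mulr_ge0// invr_ge0 ltW|exact: ltW|].
    by rewrite ler_wpM2l// ler_pM2r ?invr_gt0//; exact: H2.
  by rewrite le_eqVlt; apply/orP; left; apply/eqP; field; rewrite gt_eqF.
have s2 : `|EgT q y (Sp j) (fun s => h (s / t)) - EgT q (yy i) (Sp (jj i)) (fun s => h (s / t))| < e / 4.
  by have := H3 (y, yy i) (conj iy (Hyy i Di)); rewrite subr0.
have s3 := H1 i j Di y iy.
rewrite momT_EgT// -/q PE//.
have s4 : `|EgT q y (Sp j) f - I| <= 3 * (e / 4).
  by move: s1 s2 H4; rewrite IE !ler_norml ltr_norml; lra.
rewrite (_ : _ - _ = (Pk q y (Sp j) - P0 i j) * EgT q y (Sp j) f + P0 i j * (EgT q y (Sp j) f - I)); last by ring.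
rewrite [leRHS](_ : e = e / 4 + 3 * (e / 4)); last by lra.
by apply: product_close => //; [rewrite E0|rewrite P0_ge0//= P0_le1].
Qed.

Hypothesis C_ge0 : 0 <= C.
Hypothesis moment2 : forall n i, D i -> forall y, Sp i y ->
  (\int[Q (e_ n) y]_(p in TD setT) (p.2 ^+ 2)%:E <= C%:E)%E.
Hypothesis half : forall n y, ((2^-1)%:E <= Q (e_ n) y [set p | (0 < p.2)%R])%E.
Hypothesis unit_bound : forall n (Pr : probability O R) (x : S) (Y : nat -> O -> S * R),
  is_MRchain Pr (Q (e_ n)) x Y -> A x ->
  forall a, (renewal_sum Pr Y A (fun q => (\1_`[a, (a + 1)%R] q.2)%:E) <= U%:E)%E.
Hypothesis D_other : exists2 i1, D i1 & i0 != i1.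
Context (Pr_ : nat -> probability O R) (x_ : nat -> S) (Y_ : nat -> nat -> O -> S * R) (t_ : nat -> R).
Hypothesis HY : forall n, is_MRchain (Pr_ n) (Q (e_ n)) (x_ n) (Y_ n).
Hypothesis Ax : forall n, A (x_ n).
Hypothesis t_oo : t_ n @[n --> \oo] --> +oo.
Hypothesis exit_late : forall e, 0 < e ->
  \forall n \near \oo, fine (Pr_ n [set w | (exit_time (Y_ n) A w <= (t_ n)%:E)%E]) <= e.

Lemma sequence_limit k e : D k -> 0 < e -> exists n,
  `|fine (Pr_ n [set w | Xt_in (Y_ n) (t_ n) (Sp k) w]) -
    lam k * tau0 k / \sum_(j | D j) lam j * tau0 j| <= e.
Proof.
move=> Dk ep.
have ne i : D i -> exists y, Sp i y by exact: class_nonempty (Ax 0%N).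
have [phi [nu [phiS atom P_nu]]] := limit_laws ne.
have phi_gt0 n : 0 < e_ (phi n) by [].
have phi_lim : e_ (phi n) @[n --> \oo] --> (0 : R) by exact: (cvg_comp _ _ (cvg_subsequence phiS) e_lim).
have near_phi (F : nat -> Prop) : (\forall n \near \oo, F n) -> \forall n \near \oo, F (phi n).
  by case=> m _ Hm; exists m => // n mn; apply: Hm; exact: leq_trans mn (subsequence_ge phiS n).
have P_sum i : D i -> \sum_j P i j = 1.
  move=> Di; rewrite (bigID D)/= [X in _ + X]big1 ?addr0 => [|j].
    by rewrite -(P0_sum Di); apply: eq_bigr => j _; rewrite PE.
  by rewrite /D -leqNgt => Mj; rewrite PE//; exact: Hclosed.
have M0 : (0 < M)%N by exact: leq_ltn_trans (leq0n i0) (ltn_ord i0).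
(* The row sums of [P] are 1 and the sojourn law is common to all targets, so summing over the cells
   leaves [nu i] alone. *)
have nu_total i (f : R -> R) (K : R) : D i -> (forall u v, `|f u - f v| <= K * `|u - v|) ->
    (forall u, 0 <= f u <= 1) -> forall d, 0 < d -> \forall n \near \oo, forall y, Sp i y ->
    `|fine (momT (Q (e_ (phi n))) y setT f) - \int[nu i]_s f s| <= d.
  move=> Di fL f01 d d0; have mf := continuous_measurable (lipschitz_cont fL).
  have dM : 0 < d / M%:R by rewrite divr_gt0// ltr0n.
  have : \forall n \near \oo, forall j, forall y, Sp i y ->
      `|fine (momT (Q (e_ (phi n))) y (Sp j) f) - P i j * \int[nu i]_s f s| <= d / M%:R.
    by apply: filter_forall => j; exact: P_nu fL f01 _ dM.
  apply: filterS => n H y iy.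
  rewrite (momT_TD_union _ y mSp disj cover mf) => [|z _]; last by have /andP[] := f01 z.
  rewrite (eq_bigr (fun j => (fine (momT (Q (e_ (phi n))) y (Sp j) f))%:E)) => [|j _]; last first.
    by rewrite fineK//; exact: momT_fin.
  rewrite sumEFin/= -[X in _ - X]mul1r -(P_sum i Di) mulr_suml -sumrB.
  apply: le_trans (ler_norm_sum _ _ _) _.
  apply: (@le_trans _ _ (\sum_(j < M) d / M%:R)); first by apply: ler_sum => j _; exact: H.
  by rewrite sumr_const card_ord -[_ *+ M](mulr_natr (d / M%:R)) divfK// pnatr_eq0 -lt0n.
have mean_lim i : D i -> forall d, 0 < d -> \forall n \near \oo, forall y, Sp i y ->
    `|fine (momT (Q (e_ (phi n))) y setT id) - tau0 i| <= d.
  move=> Di d d0; have := cvg_at_right0 phi_gt0 phi_lim (mean_total d0).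
  by apply: filterS => n H y iy; have [] := H i Di y iy.
have lam_inv j : D j -> lam j = \sum_(i | D i) lam i * P i j.
  by move=> Dj; rewrite Hlam_inv//; apply: eq_bigr => i Di; rewrite PE.
have t_oo' : t_ (phi n) @[n --> \oo] --> +oo by exact: (cvg_comp _ _ (cvg_subsequence phiS) t_oo).
have tau01 i : D i -> 0 <= tau0 i <= 1 by move=> Di; rewrite tau0_ge0//= Htau_le1.
have [n Hn] := time_in_class_limit (C := C) (U := U) (i0 := i0) mSp disj P_ge0 P_le1 P_closed P_irr P_nu nu_total
  mean_lim ne C_ge0 (fun n i y Di => @moment2 (phi n) i Di y) (fun n y => Q_supp y (phi_gt0 n))
  (fun n => HY (phi n)) (fun n => Ax (phi n)) (fun n => unit_bound (HY (phi n)) (Ax (phi n)))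
  t_oo' lam_gt0 Hlam_sum lam_inv tau01 tau_i0 Di0 D_other atom (fun n y _ => half (phi n) y)
  (fun d d0 => near_phi _ (exit_late d0)) Dk ep.
by exists (phi n).
Qed.

End sequence.

End perturbed_kernels.

(** * Uniform convergence of the occupation probabilities *)

Theorem theorem7p4
  (R : realType) (S0 : metricType R) (s0 : S0)
  (M M' : nat) (Sp : 'I_M -> set (borel_space s0))
  (Q : R -> R.-pker (borel_space s0) ~> (borel_space s0 * R)%type)
  (Pm : R -> 'I_M -> 'I_M -> R) (tau : R -> 'I_M -> R)
  (dO : measure_display) (O : measurableType dO)
  (Pr : R -> borel_space s0 -> probability O R)
  (Y : R -> borel_space s0 -> nat -> O -> borel_space s0 * R)
  (* S = S_1 u ... u S_M, disjoint Borel sets *)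
  (HSmeas : forall i, measurable (Sp i))
  (HSdisj : forall i j, i != j -> Sp i `&` Sp j = set0)
  (HScover : \bigcup_(i in [set: 'I_M]) Sp i = [set: borel_space s0])
  (* Q^eps(x,.) is concentrated on S x [0,oo) *)
  (HQsupp : forall eps x, 0 < eps -> Q eps x (TD [set: borel_space s0]) = 1%E)
  (* the Markov renewal process started at (x,0) *)
  (HY : forall eps x, 0 < eps -> is_MRchain (Pr eps x) (Q eps) x (Y eps x))
  (* (a) *)
  (Ha_diag : forall eps i x, 0 < eps -> Sp i x -> Pk (Q eps) x (Sp i) = 0)
  (Ha_diagP : forall eps i, 0 < eps -> Pm eps i i = 0)
  (Ha_dich : forall i j, i != j ->
     ((forall eps x, 0 < eps -> Sp i x -> Pk (Q eps) x (Sp j) = 0) /\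
      (forall eps, 0 < eps -> Pm eps i j = 0))
     \/
     ((forall eps x, 0 < eps -> Sp i x -> 0 < Pk (Q eps) x (Sp j)) /\
      (forall eps, 0 < eps -> 0 < Pm eps i j) /\
      unif_lim0 (Sp i) (fun eps x => Pk (Q eps) x (Sp j) / Pm eps i j) 1))
  (Ha_sum : forall eps i, 0 < eps -> \sum_(j < M) Pm eps i j = 1)
  (Ha_conn : forall i j, i != j -> clos_trans 'I_M (Pnz Pm) i j)
  (* (b) *)
  (Hb_pos : forall eps i, 0 < eps -> 0 < tau eps i)
  (Hb : forall i j, Pnz Pm i j ->
     unif_lim0 (Sp i) (fun eps x => meanT (Q eps) x (Sp j) / tau eps i) 1)
  (* (c) *)
  (Hc : exists C eps0 : R, 0 < eps0 /\
     forall eps, 0 < eps -> eps <= eps0 -> forall i j, Pnz Pm i j ->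
       forall x, Sp i x -> varT_le (Q eps) x (Sp j) (C * tau eps i ^+ 2))
  (* (d) *)
  (Hd : forall f : R -> R, continuous f -> bounded_fun_R f ->
     forall i j1 j2, Pnz Pm i j1 -> Pnz Pm i j2 ->
     unif_lim0 [set p : borel_space s0 * borel_space s0 | Sp i p.1 /\ Sp i p.2]
       (fun eps p => EgT (Q eps) p.1 (Sp j1) (fun s => f (s / tau eps i))
                   - EgT (Q eps) p.2 (Sp j2) (fun s => f (s / tau eps i))) 0)
  (* (e) *)
  (He : forall i j, Pnz Pm i j ->
     forall (epsn : nat -> R) (xn : nat -> borel_space s0) (nu : probability R R),
       (forall n, 0 < epsn n) -> (forall n, epsn n.+1 <= epsn n) ->
       epsn n @[n --> \oo] --> 0 ->
       (forall n, Sp i (xn n)) ->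
       (forall f : R -> R, continuous f -> bounded_fun_R f ->
          EgT (Q (epsn n)) (xn n) (Sp j) (fun s => f (s / tau (epsn n) i))
            @[n --> \oo] --> fine (\int[nu]_r (f r)%:E)%E) ->
       forall a : R, nu [set a] = 0%E)
  (* (f) *)
  (Hf : forall (n : nat) (a c : 'I_M) (ak bk dk : nat -> 'I_M),
     (forall k, (k < n)%N -> Pnz Pm (ak k) (dk k)) ->
     exists l : \bar R,
       ((\prod_(k < n) (Pm eps (ak k) (bk k) / Pm eps (ak k) (dk k)))
          * (tau eps a / tau eps c))%:E @[eps --> 0^'+] --> l)
  (* 1 < M' < M, {1..M'} one ergodic class of P^0 *)
  (HM' : (1 < M')%N) (HM'M : (M' < M)%N)
  (P0 : 'I_M -> 'I_M -> R)
  (HP0 : forall i j : 'I_M, (i < M')%N -> Pm eps i j @[eps --> 0^'+] --> P0 i j)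
  (Hclosed : forall i j : 'I_M, (i < M')%N -> (M' <= j)%N -> P0 i j = 0)
  (Hirred : forall i j : 'I_M, (i < M')%N -> (j < M')%N -> i != j ->
     clos_trans 'I_M (fun a b => 0 < P0 a b) i j)
  (* invariant probability lambda on {1..M'} *)
  (lam : 'I_M -> R)
  (Hlam_ge0 : forall i : 'I_M, (i < M')%N -> 0 <= lam i)
  (Hlam_sum : \sum_(i < M | (i < M')%N) lam i = 1)
  (Hlam_inv : forall j : 'I_M, (j < M')%N ->
     lam j = \sum_(i < M | (i < M')%N) lam i * P0 i j)
  (* limits tau_i *)
  (tau0 : 'I_M -> R)
  (Htau0 : forall i : 'I_M, (i < M')%N -> tau eps i @[eps --> 0^'+] --> tau0 i)
  (Htau_one : exists2 i0 : 'I_M, (i0 < M')%N & tau0 i0 = 1)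
  (Htau_le1 : forall i : 'I_M, (i < M')%N -> tau0 i <= 1) :
  let S' := \bigcup_(i in [set i : 'I_M | (i < M')%N]) Sp i in
  let mu := fun i : 'I_M =>
    lam i * tau0 i / \sum_(j < M | (j < M')%N) lam j * tau0 j in
  let Peta_le := fun (eps : R) (x : borel_space s0) (t : R) =>
    fine (Pr eps x [set w | (exit_time (Y eps x) S' w <= t%:E)%E]) in
  let PX_in := fun (eps : R) (x : borel_space s0) (t : R) (i : 'I_M) =>
    fine (Pr eps x [set w | Xt_in (Y eps x) t (Sp i) w]) in
  (forall t : R -> R,
     t eps @[eps --> 0^'+] --> +oo ->
     unif_lim0 S' (fun eps x => Peta_le eps x (t eps)) 0 ->
     forall i : 'I_M, (i < M')%N ->
       unif_lim0 S' (fun eps x => PX_in eps x (t eps) i) (mu i))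
  /\
  (forall t1 t2 : R -> R,
     (forall eps, 0 < eps -> t1 eps <= t2 eps) ->
     t1 eps @[eps --> 0^'+] --> +oo ->
     unif_lim0 S' (fun eps x => Peta_le eps x (t2 eps)) 0 ->
     forall i : 'I_M, (i < M')%N ->
     forall e : R, 0 < e -> exists2 d : R, 0 < d &
       forall t : R -> R, (forall eps, 0 < eps -> t1 eps <= t eps <= t2 eps) ->
       forall eps, 0 < eps -> eps < d ->
       forall x, S' x -> `|PX_in eps x (t eps) i - mu i| < e).
Proof.
move=> S' mu Peta_le PX_in.
(* The time is a number between the two bounds rather than a function of [eps], so uniformity over
   time scales is built in and the first assertion is the case [t1 = t2]. *)
have second : forall t1 t2 : R -> R,
    (forall eps, 0 < eps -> t1 eps <= t2 eps) ->
    t1 eps @[eps --> 0^'+] --> +oo ->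
    unif_lim0 S' (fun eps x => Peta_le eps x (t2 eps)) 0 ->
    forall i : 'I_M, (i < M')%N -> forall e : R, 0 < e ->
    \forall eps \near 0^'+, forall t, t1 eps <= t <= t2 eps -> forall x, S' x ->
      `|PX_in eps x t i - mu i| < e.
  move=> t1 t2 t12 t1oo exit i iM e e0; apply: contrapT => nP.
  have [i0 i0M tau_i0] := Htau_one.
  have D_other : exists2 i1 : 'I_M, (i1 < M')%N & i0 != i1.
    have M1 : (1 < M)%N by exact: ltn_trans HM'M.
    have [i00|i00] := eqVneq i0 (Ordinal (ltnW M1)).
      by exists (Ordinal M1) => //; rewrite i00.
    by exists (Ordinal (ltnW M1)) => //; exact: ltnW.
  have half0 : 0 < 2^-1 :> R by rewrite invr_gt0.
  have mean_half := mean_close Hb half0.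
  have [C C0 HC] := moment2_near HSmeas HSdisj HScover HQsupp Ha_diag Ha_diagP Ha_dich Hb_pos Hb Hc Htau0 Htau_le1.
  have [U HU] := unit_bound_near HSmeas HSdisj HScover HQsupp Ha_diag Ha_diagP Ha_dich Ha_sum Hb_pos Hb Hc
    HP0 Hclosed Hirred Htau0 Htau_le1 (O := O) i0M tau_i0.
  have half := half_kernel HSmeas HSdisj HScover HQsupp Ha_diag Ha_diagP Ha_dich Hb_pos Hb He.
  have [e_ [e_gt0 e_dec e_lim He_]] := vanishing_sequence nP (filterI (filterI mean_half half) (filterI HC HU)).
  (* Failure of the uniform limit yields a bad pair of time and starting point for each [e_ n]; both
     vary with [n] in what follows. *)
  have ex n : exists p : R * borel_space s0, [/\ t1 (e_ n) <= p.1 <= t2 (e_ n), S' p.2 &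
      e <= `|PX_in (e_ n) p.2 p.1 i - mu i|].
    apply: contrapT => H; apply: (He_ n).1 => t tt x Sx; rewrite ltNge; apply/negP => h.
    by apply: H; exists (t, x).
  have [p Hp] := choice ex.
  have mS' : measurable S' by exact: (measurable_class_union (fun i : 'I_M => (i < M')%N) HSmeas).
  have e2 : 0 < e / 2 by rewrite divr_gt0.
  (* The hypothesis concerns the latest admissible time [t2], and exit probabilities increase with
     time. *)
  have exit_late d : 0 < d -> \forall n \near \oo,
      fine (Pr (e_ n) (p n).2 [set w | (exit_time (Y (e_ n) (p n).2) S' w <= ((p n).1)%:E)%E]) <= d.
    move=> d0; have := cvg_at_right0 e_gt0 e_lim (unif_lim0_near exit d0); apply: filterS => n Hn.
    have [/andP[_ st] Sx _] := Hp n.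
    have := Hn _ Sx; rewrite subr0 => h; apply: le_trans (le_trans (ler_norm _) (ltW h)).
    have HYn := HY (e_ n) (p n).2 (e_gt0 n).
    have m1 := measurable_exit_time HYn mS' (p n).1.
    have m2 := measurable_exit_time HYn mS' (t2 (e_ n)).
    apply: fine_le; [exact: fin_num_measure|exact: fin_num_measure|].
    apply: le_measure; rewrite ?inE// => w /= h1; apply: le_trans h1 _; by rewrite lee_fin.
  have t_oo : (p n).1 @[n --> \oo] --> +oo.
    apply/cvgryPge => K; have /cvgryPge/(_ K) H := t1oo.
    apply: filterS (cvg_at_right0 e_gt0 e_lim H) => n Hn.
    by have [/andP[st _] _ _] := Hp n; exact: le_trans Hn st.
  have [n Hn] := sequence_limit HSmeas HSdisj HScover HQsupp Ha_diag Ha_diagP Ha_dich Ha_sum Hb_pos Hb Hd He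
    HP0 Hclosed Hirred Hlam_ge0 Hlam_sum Hlam_inv Htau0 Htau_le1 e_gt0 e_dec e_lim
    (fun n => (He_ n).2.1.1) i0M tau_i0 C0 (fun n => (He_ n).2.2.1) (fun n => (He_ n).2.1.2)
    (fun n => (He_ n).2.2.2) D_other (fun n => HY (e_ n) (p n).2 (e_gt0 n)) (fun n => (let: And3 _ h _ := Hp n in h))
    t_oo exit_late iM e2.
  have [_ _ h] := Hp n.
  by have := le_trans h Hn; rewrite ler_pdivlMr//; lra.
split.
  move=> t toc exit i iM e e0.
  have [d d0 H] := near_at_right0 (second t t (fun eps _ => lexx _) toc exit i iM e e0).
  by exists d => // eps eps0 epsd x Sx; apply: H => //; rewrite lexx.
move=> t1 t2 t12 t1oo exit i iM e e0.
have [d d0 H] := near_at_right0 (second t1 t2 t12 t1oo exit i iM e e0).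
by exists d => // t tt eps eps0 epsd x Sx; apply: H => //; exact: tt.
Qed.
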